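(* Let $n$ be a positive integer and let $\sigma,\sigma'$ be $m$-component welded string links. Then $\sigma$ and $\sigma'$ are $(V^{n}+\mathrm{sv})$-equivalent if and only if $\mu^{\mathrm w}_{\sigma}(I)\equiv\mu^{\mathrm w}_{\sigma'}(I)\pmod n$ for every non-repeated sequence $I$ of elements of $\{1,\dots,m\}$.
   Context: An $m$-component virtual string link diagram is an ordered, oriented string link diagram of $m$ strands in the plane whose transverse double points are either classical crossings or virtual crossings. A welded string link is an equivalence class of such diagrams under welded Reidemeister moves: classical Reidemeister moves R1–R3, virtual moves V1–V4 (virtual Reidemeister moves and the mixed move), and the overcrossings commute move OC. A sequence of such moves is a welded isotopy. Welded Milnor invariants. Given a virtual diagram $D=D_1\cup\dots\cup D_m$ of $\sigma$, an arc is a piece of strand whose boundary points are strand endpoints or classical undercrossings and whose interior contains no classical undercrossing. Label the arcs of $D_i$ as $a_{i1},\dots,a_{ir(i)}$ in order along the orientation. The group $G(\sigma)$ has the Wirtinger presentation with generators $a_{ij}$ and relations $a_{i,j+1}^{-1}u_{ij}^{-1}a_{ij}u_{ij}$, where $u_{ij}$ is the over-arc generator at the crossing separating $a_{ij}$ and $a_{i,j+1}$ or its inverse, according to the crossing sign. Put $v_{ij}=u_{i1}\cdots u_{ij}$; the preferred $i$th longitude is $l_i=a_{i1}^{s}v_{i,r(i)-1}$ with $s$ chosen so that the total exponent of generators of the $i$th component in $l_i$ is zero. Modulo the $q$th lower central series term $G(\sigma)_q$, $l_i$ is represented by a word $\lambda_i$ in the images $\alpha_1,\dots,\alpha_m$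 of $a_{11},\dots,a_{m1}$. With the Magnus expansion $E(\alpha_i)=1+X_i$, $E(\alpha_i^{-1})=1-X_i+X_i^2-\cdots$ into $\mathbb Z\langle\langle X_1,\dots,X_m\rangle\rangle$, for $I=j_1\dots j_k i$ ($k<q$) the invariant $\mu^{\mathrm w}_\sigma(I)$ is the coefficient of $X_{j_1}\cdots X_{j_k}$ in $E(\lambda_i)$. A sequence is non-repeated if its entries are pairwise distinct. A $V^n$-move is the following local move on two oriented strands in a disk: two parallel strands without crossings are replaced by a configuration in which one strand passes under the other strand $n$ times consecutively at classical crossings all of the same sign, returning across the other strand through a virtual crossing after each classical crossing (so the two strands meet in $n$ classical and $n$ virtual crossings), and the inverse move. ($V^1$-move is equivalent to crossing virtualization.) A self-crossing virtualization replaces a classical crossing between two strands of the same component by a virtual crossing or conversely. The $(V^n+\mathrm{sv})$-equivalence is generated by $V^n$-moves, self-crossing virtualizations and welded isotopy. *)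

(* Defs.v *)
(* Welded string links are encoded by Gauss diagrams. *)
From Stdlib Require Import Relations ClassicalEpsilon.
From HB Require Import structures.
From mathcomp Require Import all_boot all_order all_algebra.
Set Implicit Arguments. Unset Strict Implicit. Unset Printing Implicit Defensive.
Import Order.TTheory GRing.Theory Num.Theory.

(* A crossing endpoint: (crossing id, is_over, sign), where is_over = true
   means the endpoint lies on the over strand (tail of the Gauss arrow),
   and sign = true means a positive crossing. *)
Definition letter := (nat * bool * bool)%type.
Definition lid (l : letter) : nat := l.1.1.
Definition lover (l : letter) : bool := l.1.2.
Definition lsgn (l : letter) : bool := l.2.

(* A diagram: the list of strands (strand i = component i), each strand being
   the sequence of crossing endpoints met along its orientation. *)
Definition gdiag := seq (seq letter).

Definition wf (m : nat) (d : gdiag) : Prop :=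
  size d = m /\
  (forall c : nat,
     count (fun l => (lid l == c) && lover l) (flatten d) =
     count (fun l => (lid l == c) && ~~ lover l) (flatten d) /\
     count (fun l => (lid l == c) && lover l) (flatten d) <= 1) /\
  (forall x y, x \in flatten d -> y \in flatten d -> lid x = lid y ->
     lsgn x = lsgn y).

Definition del (C : seq nat) (d : gdiag) : gdiag :=
  map (filter (fun l => lid l \notin C)) d.

Definition at_pair (d : gdiag) (i p : nat) (x y : letter) : Prop :=
  exists u v, nth [::] d i = u ++ [:: x; y] ++ v /\ size u = p.

Definition swap_at (d : gdiag) (i p : nat) : gdiag :=
  let s := nth [::] d i in
  set_nth [::] d i
    (take p s ++ [:: nth (0, false, false) s p.+1; nth (0, false, false) s p]
              ++ drop p.+2 s).

Definition has_block (d : gdiag) (w : seq letter) : Prop :=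
  exists i u v, nth [::] d i = u ++ w ++ v.

Definition relabel (f : nat -> nat) (d : gdiag) : gdiag :=
  map (map (fun l : letter => (f (lid l), lover l, lsgn l))) d.

Definition Tl (c : nat) (e : bool) : letter := (c, true, e).
Definition Hl (c : nat) (e : bool) : letter := (c, false, e).

Definition R1_step (d d' : gdiag) : Prop :=
  exists c x y, d = del [:: c] d' /\ lid x = c /\ lid y = c /\
    has_block d' [:: x; y].

Definition R2_step (d d' : gdiag) : Prop :=
  exists c c' e, d = del [:: c; c'] d' /\
    (has_block d' [:: Tl c e; Tl c' (~~ e)] \/
     has_block d' [:: Tl c' (~~ e); Tl c e]) /\
    (has_block d' [:: Hl c e; Hl c' (~~ e)] \/
     has_block d' [:: Hl c' (~~ e); Hl c e]).

(* R3: crossings a (top over middle), b (top over bottom), c (middle over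
   bottom); the endpoint pairs on the middle and bottom segments are
   transposed (the two adjacent tails on the top segment are unchanged). *)
Definition R3_step (d d' : gdiag) : Prop :=
  exists a b c ea eb ec i1 p1 i2 p2,
    (has_block d [:: Tl a ea; Tl b eb] \/ has_block d [:: Tl b eb; Tl a ea]) /\
    at_pair d i1 p1 (Hl a ea) (Tl c ec) /\
    ((at_pair d i2 p2 (Hl b eb) (Hl c ec) /\ ea = eb) \/
     (at_pair d i2 p2 (Hl c ec) (Hl b eb) /\ ea = ~~ eb)) /\
    d' = swap_at (swap_at d i1 p1) i2 p2.

Definition OC_step (d d' : gdiag) : Prop :=
  exists i p x y, lover x /\ lover y /\ at_pair d i p x y /\
    d' = swap_at d i p.

Definition relabel_step (d d' : gdiag) : Prop :=
  exists f, injective f /\ d' = relabel f d.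

Definition Vn_step (n : nat) (d d' : gdiag) : Prop :=
  exists (C : seq nat) (e : bool) (wo wu : seq letter),
    uniq C /\ size C = n /\ d = del C d' /\
    size wo = n /\ size wu = n /\
    all (fun l => lover l && (lid l \in C) && (lsgn l == e)) wo /\
    all (fun l => ~~ lover l && (lid l \in C) && (lsgn l == e)) wu /\
    has_block d' wo /\ has_block d' wu.

(* self-crossing virtualization: d' = d plus one crossing with both endpoints
   on the same strand (= same component) *)
Definition sv_step (d d' : gdiag) : Prop :=
  exists c i, d = del [:: c] d' /\
    has (fun l => lid l == c) (nth [::] d' i) /\
    count (fun l => lid l == c) (nth [::] d' i) = 2.

Definition welded_step (m : nat) (d d' : gdiag) : Prop :=
  wf m d /\ wf m d' /\
  (R1_step d d' \/ R2_step d d' \/ R3_step d d' \/ OC_step d d' \/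
   relabel_step d d').

Definition welded_isotopic (m : nat) : relation gdiag :=
  clos_refl_sym_trans gdiag (welded_step m).

Definition Vn_sv_step (m n : nat) (d d' : gdiag) : Prop :=
  wf m d /\ wf m d' /\
  (R1_step d d' \/ R2_step d d' \/ R3_step d d' \/ OC_step d d' \/
   relabel_step d d' \/ Vn_step n d d' \/ sv_step d d').

Definition Vn_sv_equiv (m n : nat) : relation gdiag :=
  clos_refl_sym_trans gdiag (Vn_sv_step m n).

(* generator (i, k) = arc a_{i,k+1} (0-based: k-th arc of strand i) *)
Definition gen := (nat * nat)%type.
(* word letter: (generator, true = exponent +1 / false = exponent -1) *)
Definition word := seq (gen * bool).

Definition winv (w : word) : word := rev (map (fun x => (x.1, ~~ x.2)) w).

Definition over_arc (d : gdiag) (c : nat) : gen :=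
  let isov := fun l : letter => (lid l == c) && lover l in
  let i := find (fun s => has isov s) d in
  let s := nth [::] d i in
  (i, count (fun l => ~~ lover l) (take (find isov s) s)).

Definition u_word (d : gdiag) (i : nat) : word :=
  [seq (over_arc d (lid l), lsgn l) | l <- nth [::] d i & ~~ lover l].

Definition dfltg : gen * bool := ((0, 0), true).

Definition is_relator (d : gdiag) (r : word) : Prop :=
  exists i j, i < size d /\ j < size (u_word d i) /\
    r = [:: ((i, j.+1), false)] ++ winv [:: nth dfltg (u_word d i) j] ++
        [:: ((i, j), true); nth dfltg (u_word d i) j].

(* left-normed commutators of weight k of arbitrary words: they normally
   generate the k-th lower central series term F_k (F_1 = F) *)
Inductive is_comm : nat -> word -> Prop :=
| comm1 w : is_comm 1 w
| commS k w v : is_comm k w -> is_comm k.+1 (winv w ++ winv v ++ w ++ v).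

(* elementary steps presenting G(sigma) / G(sigma)_q = F / <<R, F_q>> *)
Inductive wstep (d : gdiag) (q : nat) : word -> word -> Prop :=
| ws_free u v x : wstep d q (u ++ [:: x; (x.1, ~~ x.2)] ++ v) (u ++ v)
| ws_rel u v r : is_relator d r -> wstep d q (u ++ r ++ v) (u ++ v)
| ws_comm u v r : is_comm q r -> wstep d q (u ++ r ++ v) (u ++ v).

Definition congr_q (d : gdiag) (q : nat) : relation word :=
  clos_refl_sym_trans word (wstep d q).

Definition longitude (d : gdiag) (i : nat) : word :=
  let v := u_word d i in
  let pos := count (fun x : gen * bool => (x.1.1 == i) && x.2) v in
  let neg := count (fun x : gen * bool => (x.1.1 == i) && ~~ x.2) v in
  (if pos <= neg then nseq (neg - pos) ((i, 0), true)
   else nseq (pos - neg) ((i, 0), false)) ++ v.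

(* words in alpha_1..alpha_m : (j, exponent sign), alpha_j = image of a_{j1} *)
Definition emb (lam : seq (nat * bool)) : word :=
  map (fun x => ((x.1, 0), x.2)) lam.

Definition blockc (pos : bool) (p : nat) : int :=
  if pos then Posz (p <= 1) else ((-1) ^+ p)%R.

(* coefficient of the monomial X_{M_1} ... X_{M_k} in E(lam), where
   E(alpha_j) = 1 + X_j, E(alpha_j^-1) = 1 - X_j + X_j^2 - ... *)
Fixpoint mcoef (lam : seq (nat * bool)) (M : seq nat) : int :=
  match lam with
  | [::] => Posz (M == [::])
  | x :: lam' =>
      \sum_(p < (size M).+1)
        (if take p M == nseq p x.1
         then blockc x.2 p * mcoef lam' (drop p M) else 0)
  end%R.

Definition IsMuRep (m : nat) (d : gdiag) (I : seq 'I_m) (c : int) : Prop :=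
  exists (q : nat) (lam : seq (nat * bool)),
    size I <= q /\ all (fun x => x.1 < m) lam /\
    congr_q d q (longitude d (last 0 (map val I))) (emb lam) /\
    c = mcoef lam (take (size I).-1 (map val I)).

Definition mu_w (m : nat) (d : gdiag) (I : seq 'I_m) : int :=
  epsilon (inhabits 0%R) (IsMuRep d I).

(* Main.v *)
(* Send the Wirtinger generators into the Magnus ring over Z/n with all monomials
   having a repeated variable killed.  Degree by degree, a Gauss diagram has exactly
   one such coloring starting with 1 + X_i on strand i, and the coefficients of the
   i-th longitude at monomials without X_i are the non-repeated Milnor numbers mod n.
   Each move transports colorings: conjugates of 1 + X_i commute with each other,
   which takes care of self-crossings, and their n-th power is 1, which takes care
   of V^n-moves.

   Conversely, after deleting the self-arrows of a strand, R2 and R3 let its tails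
   slide in front of its heads; treating the strands one after the other ends in a
   diagram with all tails first on every strand, which up to OC is just a word
   in the generators for each strand.  On the i-th word R2, V^n and sv give free
   reduction, n-th powers of generators and deletion of a_i, and a self-arrow on
   another strand j makes the conjugates of a_j commute.  These are the relations
   of the reduced free group modulo n-th powers of its generators, and there the
   reduced Magnus expansion mod n is faithful: the conjugates of a generator x span
   an abelian normal subgroup in which x^h is the product of the iterated commutators
   [x, a_{j_1}, ..., a_{j_k}] with the Magnus coefficients of h as exponents. *)
Require Import Defs.
From Stdlib Require Import Relations ClassicalEpsilon Morphisms.
From HB Require Import structures.
From mathcomp Require Import all_boot all_order all_algebra zify ring generic_quotient.
Set Implicit Arguments. Unset Strict Implicit. Unset Printing Implicit Defensive.
Import GRing.Theory.

(** * Words and congruences *)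

Section SignedWords.
Variable T : Type.
Implicit Types (x : T * bool) (u v h : seq (T * bool)) (e : bool).

Definition invl x := (x.1, ~~ x.2).
Definition invw u := rev (map invl u).
Definition conjw u h := invw h ++ u ++ h.
Definition expw u e := if e then u else invw u.

Lemma invlK : involutive invl.
Proof. by case=> k e; rewrite /invl /= negbK. Qed.

Lemma invw_cat u v : invw (u ++ v) = invw v ++ invw u.
Proof. by rewrite /invw map_cat rev_cat. Qed.

Lemma invwK : involutive invw.
Proof. by move=> u; rewrite /invw map_rev revK (mapK invlK). Qed.

Lemma conjw0 u : conjw u [::] = u.
Proof. by rewrite /conjw cats0. Qed.

Lemma conjw_cat u g h : conjw u (g ++ h) = conjw (conjw u g) h.
Proof. by rewrite /conjw invw_cat !catA. Qed.

Lemma invw_conjw u h : invw (conjw u h) = conjw (invw u) h.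
Proof. by rewrite /conjw !invw_cat invwK catA. Qed.

Lemma invw_expw u e : invw (expw u e) = expw u (~~ e).
Proof. by case: e; rewrite /= ?invwK. Qed.

Lemma expw_conjw u h e : expw (conjw u h) e = conjw (expw u e) h.
Proof. by case: e; rewrite /= ?invw_conjw. Qed.

Lemma expw_letter x e : expw [:: x] e = [:: (x.1, x.2 == e)].
Proof. by case: x e => k [] []. Qed.

End SignedWords.

Class group_congruence (T : Type) (R : relation (seq (T * bool))) : Prop := {
  congr_equivalence :: Equivalence R;
  congr_cat :: Proper (R ==> R ==> R) cat;
  congr_cancel : forall x, R [:: x; invl x] [::] }.

Section GroupCongruence.
Context (T : Type) (R : relation (seq (T * bool))) {RC : group_congruence R}.
Implicit Types (u v w h : seq (T * bool)).

Lemma congr_mulwV w : R (w ++ invw w) [::].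
Proof.
elim/last_ind: w => [|w x IH]; first by reflexivity.
rewrite -cats1 invw_cat -catA -[[:: x] ++ _]/([:: x; invl x] ++ invw w).
by rewrite congr_cancel.
Qed.

Lemma congr_mulVw w : R (invw w ++ w) [::].
Proof. by have := congr_mulwV (invw w); rewrite invwK. Qed.

#[export] Instance congr_invw : Proper (R ==> R) (@invw T).
Proof.
move=> u v uv; rewrite -[invw u]cats0 -(congr_mulwV v) catA -{1}uv.
by rewrite congr_mulVw; reflexivity.
Qed.

#[export] Instance congr_conjw : Proper (R ==> R ==> R) (@conjw T).
Proof. by move=> u v uv g h gh; rewrite /conjw uv gh; reflexivity. Qed.

#[export] Instance congr_expw : Proper (R ==> eq ==> R) (@expw T).
Proof. by move=> u v uv _ e ->; case: e => //=; rewrite uv; reflexivity. Qed.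

Lemma congr_conj1w h : R (conjw [::] h) [::].
Proof. exact: congr_mulVw. Qed.

Lemma congr_conjMw u v h : R (conjw (u ++ v) h) (conjw u h ++ conjw v h).
Proof.
by rewrite /conjw -!catA (catA h) congr_mulwV; reflexivity.
Qed.

Lemma congr_mul_conjw u h : R (h ++ conjw u h) (u ++ h).
Proof. by rewrite /conjw catA congr_mulwV; reflexivity. Qed.

Lemma congr_conjw_mulV u h : R (conjw u h ++ invw h) (invw h ++ u).
Proof. by rewrite /conjw -!catA congr_mulwV cats0; reflexivity. Qed.

Lemma congr_conjw_nseq k u h : R (flatten (nseq k (conjw u h))) (conjw (flatten (nseq k u)) h).
Proof.
elim: k => [|k IH] /=; first by symmetry; apply: congr_conj1w.
by rewrite IH congr_conjMw; reflexivity.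
Qed.

Lemma congr_conjw_commute u h : R (u ++ h) (h ++ u) -> R (conjw u h) u.
Proof. by move=> uh; rewrite /conjw uh catA congr_mulVw; reflexivity. Qed.

End GroupCongruence.

Lemma group_congruence_closure (T : Type) (step : relation (seq (T * bool))) :
  (forall a b u v, step u v -> step (a ++ u ++ b) (a ++ v ++ b)) ->
  (forall x, step [:: x; invl x] [::]) ->
  group_congruence (clos_refl_sym_trans _ step).
Proof.
move=> step_ctx step_cancel; pose R := clos_refl_sym_trans _ step.
have R_ctx a b u v : R u v -> R (a ++ u ++ b) (a ++ v ++ b).
  elim=> {u v} [u v uv|u|u v _|u v w _ uv _ vw]; first exact/rst_step/step_ctx.
  - exact: rst_refl.
  - exact: rst_sym.
  - exact: rst_trans uv vw.
split=> [|u u' uu' v v' vv'|x]; last exact: rst_step.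
  by split; [exact: rst_refl | exact: rst_sym | exact: rst_trans].
apply: (@rst_trans _ _ _ (u' ++ v)); first exact: (R_ctx [::]).
by have := R_ctx u' [::] _ _ vv'; rewrite !cats0.
Qed.

(** * Reduced Magnus expansions *)

Definition aword := seq (nat * bool).
Definition word_in (D : pred nat) (w : aword) : bool := all (fun x => D x.1) w.

Lemma word_in_cat D u v : word_in D (u ++ v) = word_in D u && word_in D v.
Proof. exact: all_cat. Qed.

(* The coefficient of X_M in the Magnus expansion with the monomials having a
   repeated variable killed, so that the inverse of 1 + X is 1 - X.  It is
   meaningful only for duplicate-free M. *)
Fixpoint rcoef (w : aword) (M : seq nat) : int :=
  match w with
  | [::] => Posz (M == [::])
  | x :: w' => rcoef w' M +
      (if M is k :: M' then
         if k == x.1 then (-1) ^+ (~~ x.2) * rcoef w' M' else 0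
       else 0)
  end%R.

Lemma rcoef_nil w : rcoef w [::] = 1%R.
Proof. by elim: w => //= x w ->; rewrite addr0. Qed.

Lemma mcoef_rcoef w M : uniq M -> mcoef w M = rcoef w M.
Proof.
elim: w M => [|[j e] w IH] M uM //=.
rewrite big_ord_recl /= take0 drop0 eqxx IH //.
have -> : (blockc e 0 = 1)%R by case: e.
rewrite mul1r; congr (_ + _)%R.
case: M uM => [|k M] uM; first by rewrite big_ord0.
rewrite big_ord_recl /= take0 drop0 big1 => [|p _]; last first.
  rewrite /bump /=; case: ifP => // /eqP; case: M uM p => [|k' M] uM [p plt] //=.
  by case=> kj k'j _; move: uM; rewrite kj k'j /= inE eqxx.
rewrite addr0 eqseq_cons andbT IH; last by case/andP: uM.
by case: ifP => // _; case: e.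
Qed.

Lemma rcoef_cat u v M : rcoef (u ++ v) M =
  (\sum_(p < (size M).+1) rcoef u (take p M) * rcoef v (drop p M))%R.
Proof.
elim: u M => [|x u IH] M /=.
  rewrite big_ord_recl /= take0 drop0 eqxx mul1r big1 ?addr0 // => p _.
  by rewrite /bump /=; case: M p => [|k M] p //=; [case: p | rewrite mul0r].
rewrite IH; under [RHS]eq_bigr => p _ do rewrite mulrDl.
rewrite big_split /=; congr (_ + _)%R.
case: M => [|k M]; first by rewrite big_ord1 /= mul0r.
rewrite big_ord_recl /= mul0r add0r.
case: ifP => kx; last by rewrite big1 // => p _; rewrite mul0r.
by rewrite IH mulr_sumr; apply: eq_bigr => p _; rewrite mulrA.
Qed.

Lemma rcoef_erase x w M : x \notin M ->
  rcoef [seq y <- w | y.1 != x] M = rcoef w M.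
Proof.
elim: w M => [|[j e] w IH] M xM //=.
have rec k M' : M = k :: M' -> rcoef [seq y <- w | y.1 != x] M' = rcoef w M'.
  by move=> M_def; apply: IH; move: xM; rewrite M_def inE negb_or => /andP[].
case: eqP => [jx|_] /=; rewrite IH //; case: M xM rec => [|k M'] //=.
- by rewrite addr0.
- by rewrite inE negb_or jx eq_sym => /andP[/negPf -> _]; rewrite addr0.
- by move=> _ rec; rewrite (rec k).
Qed.

Lemma rcoef_absent x w M : x \in M -> x \notin map fst w -> rcoef w M = 0%R.
Proof.
elim: w M => [|[j e] w IH] M xM; first by case: M xM.
rewrite inE negb_or => /andP[xj xw] /=; rewrite IH // add0r.
case: M xM => [//|k M]; rewrite inE; case: (k =P j) => [->|//].
by rewrite (negPf xj) => xM; rewrite IH ?mulr0.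
Qed.

Lemma rcoef_nseq k x M : uniq M ->
  rcoef (nseq k x) M = (Posz (M == [::]) + k%:R * (-1) ^+ (~~ x.2) * (M == [:: x.1])%:R)%R.
Proof.
elim: k M => [|k IH] M uM; first by rewrite !mul0r addr0.
rewrite [LHS]/= IH //; case: M uM => [|i M] /=; first by rewrite !mulr0 !addr0.
case/andP=> iM uM; rewrite eqseq_cons; case: eqP => [ix|_]; last by rewrite !mulr0 !addr0.
rewrite IH // -natr1 (_ : (M == [:: x.1]) = false); last first.
  by apply: contraNF iM => /eqP ->; rewrite ix mem_head.
by case: (M == [::]); rewrite /=; ring.
Qed.

Section MagnusCongruence.
Variables (n q : nat) (D : pred nat).
Implicit Types (u v w h : aword).

Definition magnus_eq u v : Prop := forall M, uniq M -> size M < q -> all D M ->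
  (rcoef u M = rcoef v M %[mod n])%Z.

#[export] Instance magnus_congruence : group_congruence magnus_eq.
Proof.
split.
- split=> [u|u v uv|u v w uv vw] M uM sM DM //; first by rewrite uv.
  by rewrite uv // vw.
- move=> u u' uu v v' vv M uM sM DM; rewrite !rcoef_cat.
  apply: (big_ind2 (fun a b : int => a = b %[mod n])%Z) => // [a b c d ab cd | p _].
    by rewrite -modzDm ab cd modzDm.
  rewrite -modzMm uu ?vv ?modzMm ?drop_uniq ?take_uniq //.
  + by rewrite size_drop (leq_ltn_trans (leq_subr _ _) sM).
  + by apply/allP => x /mem_drop; apply/allP.
  + by rewrite size_take_min (leq_ltn_trans (geq_minr _ _) sM).
  + by apply/allP => x /mem_take; apply/allP.
- case=> j e M uM _ _ /=; congr (modz _ _).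
  case: M uM => [|k M] /=; first by rewrite !addr0.
  case: eqP => [kj|_]; last by rewrite !addr0.
  case: M => [|i M] /=; first by move=> _; rewrite signrN; ring.
  by rewrite kj inE negb_or eq_sym => /andP[/andP[/negPf -> _] _]; ring.
Qed.

End MagnusCongruence.

#[local] Hint Extern 0 (magnus_eq _ _ _ _ _) => reflexivity : core.

Lemma magnus_eq_sub n q q' (D D' : pred nat) u v : q' <= q -> subpred D' D ->
  magnus_eq n q D u v -> magnus_eq n q' D' u v.
Proof.
move=> qq DD uv M uM sM DM; apply: uv => //; first exact: leq_trans sM qq.
exact: sub_all DM.
Qed.

Lemma magnus_eq_catC (n q : nat) D u v :
  (forall M1 M2 : seq nat, M1 != [::] -> M2 != [::] -> uniq (M1 ++ M2) ->
     size (M1 ++ M2) < q -> all D (M1 ++ M2) ->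
     (rcoef u M1 * rcoef v M2 = 0 %[mod n])%Z /\ (rcoef v M1 * rcoef u M2 = 0 %[mod n])%Z) ->
  magnus_eq n q D (u ++ v) (v ++ u).
Proof.
move=> cross M uM sM DM; case: (eqVneq M [::]) => [->|M0]; first by rewrite !rcoef_nil.
have cat_ends x y : (forall M1 M2 : seq nat, M1 != [::] -> M2 != [::] -> M1 ++ M2 = M ->
    (rcoef x M1 * rcoef y M2 = 0 %[mod n])%Z) ->
    (rcoef (x ++ y) M = rcoef x M + rcoef y M %[mod n])%Z.
  move=> vanish; rewrite rcoef_cat; case: M M0 vanish {uM sM DM} => [//|k M] _ vanish.
  rewrite big_ord_recr big_ord_recl /= take_size drop_size !rcoef_nil mul1r mulr1.
  rewrite addrAC [(rcoef y _ + _)%R]addrC; set S := (\sum_(i < _) _)%R.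
  suff S0 : (S %% n)%Z = 0 by rewrite -[LHS]modzDmr S0 addr0.
  apply: (big_ind (fun a : int => (a %% n)%Z = 0)) => [|a b a0 b0|i _].
  - exact: mod0z.
  - by rewrite -modzDm a0 b0 mod0z.
  - rewrite (vanish (k :: take i M) (drop i M)) ?mod0z //= ?cat_take_drop //.
    by rewrite -size_eq0 size_drop subn_eq0 -ltnNge ltn_ord.
rewrite (cat_ends u v) ?(cat_ends v u) 1?addrC // => M1 M2 M10 M20 M_def.
  by rewrite -M_def in uM sM DM; case: (cross M1 M2).
by rewrite -M_def in uM sM DM; case: (cross M1 M2).
Qed.

Lemma magnus_eq_comm_succ n q D u v : magnus_eq n q D u [::] ->
  magnus_eq n q.+1 D (u ++ v) (v ++ u).
Proof.
move=> u1; have u0 (M : seq nat) : M != [::] -> uniq M -> size M < q -> all D M ->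
    (rcoef u M = 0 %[mod n])%Z.
  by move=> M0 uM sM DM; rewrite u1 //= (negPf M0).
apply: magnus_eq_catC => M1 M2 M10 M20; rewrite cat_uniq all_cat size_cat.
move=> /and3P[uM1 _ uM2] sM /andP[DM1 DM2].
have [sM1 sM2] : 0 < size M1 /\ 0 < size M2 by rewrite !lt0n !size_eq0.
split; first by rewrite -modzMml u0 ?modzMml ?mul0r //; lia.
by rewrite -modzMmr u0 ?modzMmr ?mulr0 //; lia.
Qed.

Lemma magnus_eq_commute_off n q (D : pred nat) k u v :
  magnus_eq n q (predI D (predC1 k)) u [::] -> magnus_eq n q (predI D (predC1 k)) v [::] ->
  magnus_eq n q D (u ++ v) (v ++ u).
Proof.
have vanish w (M : seq nat) : magnus_eq n q (predI D (predC1 k)) w [::] -> M != [::] -> uniq M ->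
    size M < q -> all D M -> k \notin M -> (rcoef w M = 0 %[mod n])%Z.
  move=> w1 M0 uM sM DM kM; rewrite w1 //= ?(negPf M0) //.
  by rewrite all_predI DM; apply/allP => j jM; apply: contraNneq kM => <-.
move=> u1 v1; apply: magnus_eq_catC => M1 M2 M10 M20; rewrite cat_uniq all_cat size_cat.
move=> /and3P[uM1 /hasPn M12 uM2] sM /andP[DM1 DM2].
have [sM1 sM2] : size M1 < q /\ size M2 < q by lia.
have [kM1|kM1] := boolP (k \in M1); last first.
  by split; rewrite -modzMml vanish ?modzMml ?mul0r.
have kM2 : k \notin M2 by apply/negP => /M12; rewrite /= kM1.
by split; rewrite -modzMmr vanish ?modzMmr ?mulr0.
Qed.

Lemma magnus_eq_conj_succ n q D u h h' : magnus_eq n q D h h' ->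
  magnus_eq n q.+1 D (conjw u h) (conjw u h').
Proof.
move=> hh; have k1 : magnus_eq n q D (invw h ++ h') [::] by rewrite -hh; apply: congr_mulVw.
have h'E : magnus_eq n q.+1 D h' (h ++ invw h ++ h') by rewrite catA congr_mulwV.
by rewrite h'E conjw_cat (congr_conjw_commute (symmetry (magnus_eq_comm_succ _ k1))).
Qed.

Lemma magnus_eq_letter n q (D : pred nat) x : ~~ D x.1 -> magnus_eq n q D [:: x] [::].
Proof.
move=> Dx [|k M] _ _ //= /andP[Dk _]; congr (modz _ _).
by case: eqP Dx => [<-|_]; rewrite ?Dk.
Qed.

Lemma magnus_eq_conj_letter n q (D : pred nat) x h : ~~ D x.1 ->
  magnus_eq n q D (conjw [:: x] h) [::].
Proof. by move=> Dx; rewrite magnus_eq_letter // congr_conj1w. Qed.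

Lemma magnus_eq_nseq n q D x : magnus_eq n q D (nseq n x) [::].
Proof.
move=> M uM _ _; rewrite rcoef_nseq // -mulrA [(_%:R * _)%R]mulrC (natz n).
by rewrite -modzDmr modzMl addr0.
Qed.

(** * Products of iterated commutators *)

Section DoubleCentralizer.
Local Open Scope group_scope.
Variable G : groupType.
Implicit Types (x u v g : G).

Definition signg u (e : bool) := if e then u else u^-1.

Lemma conjg_signg u g e : signg u e ^ g = signg (u ^ g) e.
Proof. by case: e; rewrite //= conjVg. Qed.

Lemma commute_conj u v g : commute u v -> commute (u ^ g) (v ^ g).
Proof. by rewrite /commute -!conjMg => ->. Qed.

Lemma commute_signg u v e f : commute u v -> commute (signg u e) (signg v f).
Proof.
have commute_signr (s t : G) b : commute s t -> commute s (signg t b).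
  by case: b => //= st; apply: commuteV.
by move=> uv; apply/commute_signr/commute_sym/commute_signr/commute_sym.
Qed.

Definition class_bicent x u := forall z, (forall g, commute z (x ^ g)) -> commute u z.

Lemma class_bicent_id x : class_bicent x x.
Proof. by move=> z /(_ 1); rewrite conjg1; apply: commute_sym. Qed.

Lemma class_bicentM x u v : class_bicent x u -> class_bicent x v -> class_bicent x (u * v).
Proof.
move=> xu xv z zx; apply/commute_sym/commuteM; apply/commute_sym; [exact: xu | exact: xv].
Qed.

Lemma class_bicentV x u : class_bicent x u -> class_bicent x u^-1.
Proof. by move=> xu z zx; apply/commute_sym/commuteV/commute_sym/xu. Qed.

Lemma class_bicentJ x u g : class_bicent x u -> class_bicent x (u ^ g).
Proof.
move=> xu z zx; rewrite -[z](conjgKV g); apply/commute_conj/xu => h.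
by rewrite -[x ^ h](conjgK g) -(conjgM x h g); apply/commute_conj/zx.
Qed.

Lemma class_bicent_commgl x u v : class_bicent x u -> class_bicent x [~ u, v].
Proof.
by move=> xu; rewrite commgEl; apply: class_bicentM; [exact: class_bicentV | exact: class_bicentJ].
Qed.

Lemma class_bicent_commgr u v : class_bicent v [~ u, v].
Proof.
rewrite (_ : [~ u, v] = v^-1 ^ u * v); last by rewrite /commg !conjgE !mulgA.
by apply: class_bicentM; [apply/class_bicentJ/class_bicentV | ]; apply: class_bicent_id.
Qed.

Section CommutingClass.
Variable x : G.
Hypothesis x_commute_conj : forall g, commute x (x ^ g).

Lemma class_bicent_commute_conj u g : class_bicent x u -> commute u (x ^ g).
Proof.
move=> xu; apply: xu => h.
by rewrite -[x ^ g](conjgKV h) -(conjgM x g); apply/commute_conj/commute_sym.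
Qed.

Lemma class_bicent_commute u v : class_bicent x u -> class_bicent x v -> commute u v.
Proof. by move=> xu xv; apply/commute_sym/xv => g; apply: class_bicent_commute_conj. Qed.

End CommutingClass.

End DoubleCentralizer.

Section ReducedFreeImage.
Local Open Scope group_scope.
Variables (G : groupType) (n : nat) (a : nat -> G).
Hypothesis a_commute_conj : forall k g, commute (a k) (a k ^ g).
Hypothesis a_expn : forall k, a k ^+ n = 1.

Definition word_eval (w : aword) : G := \prod_(x <- w) signg (a x.1) x.2.

Lemma word_eval_cons x w : word_eval (x :: w) = signg (a x.1) x.2 * word_eval w.
Proof. exact: big_cons. Qed.

Definition iter_comm (k : nat) (J : seq nat) : G := foldl (fun u j => [~ u, a j]) (a k) J.

Lemma iter_comm_rcons k J j : iter_comm k (rcons J j) = [~ iter_comm k J, a j].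
Proof. by rewrite /iter_comm -cats1 foldl_cat. Qed.

Lemma iter_comm_bicent k J j : j \in k :: J -> class_bicent (a j) (iter_comm k J).
Proof.
elim/last_ind: J => [|J i IH]; first by rewrite inE => /eqP ->; apply: class_bicent_id.
rewrite iter_comm_rcons -rcons_cons mem_rcons inE => /predU1P[->|/IH].
  exact: class_bicent_commgr.
exact: class_bicent_commgl.
Qed.

Lemma iter_comm_commute k I J : commute (iter_comm k I) (iter_comm k J).
Proof.
by apply: (class_bicent_commute (a_commute_conj k)); apply: iter_comm_bicent; rewrite mem_head.
Qed.

Lemma iter_comm_expn k J : iter_comm k J ^+ n = 1.
Proof.
elim/last_ind: J => [|J j IH]; first exact: a_expn.
have kJ : class_bicent (a k) (iter_comm k J) by apply: iter_comm_bicent; rewrite mem_head.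
rewrite iter_comm_rcons commgEl expgMn; first by rewrite expVgn -conjXg IH conj1g mulg1 invg1.
by apply: (class_bicent_commute (a_commute_conj k)); [apply: class_bicentV | apply: class_bicentJ].
Qed.

Lemma iter_comm_nonuniq k J : ~~ uniq (k :: J) -> iter_comm k J = 1.
Proof.
elim/last_ind: J => [//|J j IH]; rewrite -rcons_cons rcons_uniq negb_and negbK iter_comm_rcons.
case/orP=> [kJ|/IH ->]; last exact: comm1g.
apply/eqP/commgP; rewrite -[a j]conjg1.
by apply: class_bicent_commute_conj => //; apply: iter_comm_bicent.
Qed.

(* A list of signed index sequences stands for the product of the iterated
   commutators they index; these all commute. *)
Definition comm_prod (k : nat) (z : seq (bool * seq nat)) : G :=
  \prod_(s <- z) signg (iter_comm k s.2) s.1.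

Definition scale_sign (e : bool) (z : seq (bool * seq nat)) := [seq (s.1 == e, s.2) | s <- z].

Definition exponent (z : seq (bool * seq nat)) (J : seq nat) : int :=
  (\sum_(s <- z) (s.2 == J)%:R * (-1) ^+ (~~ s.1))%R.

Lemma comm_prod_cat k z z' : comm_prod k (z ++ z') = comm_prod k z * comm_prod k z'.
Proof. exact: big_cat. Qed.

Lemma comm_prod_scale k z e : comm_prod k (scale_sign e z) = signg (comm_prod k z) e.
Proof.
elim: z => [|[f I] z IH]; first by rewrite /comm_prod !big_nil; case: e; rewrite //= invg1.
rewrite /comm_prod !big_cons -!/(comm_prod _ _) IH /=.
have Iz : commute (signg (iter_comm k I) f) (comm_prod k z).
  by apply: commute_prod => s _; apply/commute_signg/iter_comm_commute.
case: e {IH} => /=; first by case: f Iz.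
by rewrite Iz invgM; case: f {Iz}; rewrite //= ?invgK.
Qed.

Lemma exponent_cat z z' J : exponent (z ++ z') J = (exponent z J + exponent z' J)%R.
Proof. exact: big_cat. Qed.

Lemma exponent_scale z e J : exponent (scale_sign e z) J = ((-1) ^+ (~~ e) * exponent z J)%R.
Proof.
rewrite /exponent big_map mulr_sumr; apply: eq_bigr => s _ /=; rewrite mulrCA.
by case: e s.1 => [] [].
Qed.

Lemma exponent_filter (P : pred (seq nat)) z J :
  exponent [seq s <- z | P s.2] J = (if P J then exponent z J else 0)%R.
Proof.
rewrite /exponent big_filter; case: ifP => PJ.
  rewrite big_mkcond; apply: eq_bigr => s _; case: eqP => [->|_]; first by rewrite PJ.
  by rewrite mul0r if_same.
by rewrite big1 // => s; case: eqP => [->|_ _]; rewrite ?PJ ?mul0r.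
Qed.

Lemma comm_prod_filter k z (P : pred (bool * seq nat)) :
  comm_prod k z = comm_prod k (filter P z) * comm_prod k (filter (predC P) z).
Proof.
elim: z => [|s z IH] /=; first by rewrite /comm_prod !big_nil mulg1.
rewrite /comm_prod big_cons -/(comm_prod k z) IH; case: (P s) => /=.
  by rewrite big_cons -!/(comm_prod _ _) mulgA.
rewrite big_cons -!/(comm_prod _ _) !mulgA; congr (_ * _).
by apply: commute_prod => t _; apply/commute_signg/iter_comm_commute.
Qed.

Lemma expgn_eq_mod (u : G) p r : u ^+ n = 1 -> p = r %[mod n] -> u ^+ p = u ^+ r.
Proof.
move=> un pr; rewrite (divn_eq p n) (divn_eq r n) pr !expgnDr ![(_ * n)%N]mulnC.
by rewrite !expgnA un !expg1n.
Qed.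

Lemma comm_prod_constant k J z : all (fun s => s.2 == J) z ->
  exists p r, exponent z J = (Posz p - Posz r)%R /\
    comm_prod k z = iter_comm k J ^+ p * iter_comm k J ^- r.
Proof.
elim: z => [_|[e I] z IH] /=; first by exists 0, 0; rewrite /exponent /comm_prod !big_nil mulgV.
case/andP=> /eqP -> /IH[p [r [zJ zE]]] {IH}.
rewrite /comm_prod /exponent !big_cons -/(comm_prod k z) -/(exponent z J) zJ zE /= eqxx mul1r.
case: e => /=; first by exists p.+1, r; rewrite expgS mulgA; split=> //; lia.
exists p, r.+1; split; first by lia.
have : commute (iter_comm k J)^-1 (iter_comm k J ^+ p).
  by apply/commuteX/commute_sym/commuteV.
by rewrite mulgA => ->; rewrite -mulgA -invgM -expgSr.
Qed.

Lemma comm_prod_trivial k z :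
  (forall J, uniq (k :: J) -> (exponent z J = 0 %[mod n])%Z) -> comm_prod k z = 1.
Proof.
have [r] := ubnP (size z); elim: r z => [//|r IH] [|[e I] z] sz z0.
  by rewrite /comm_prod big_nil.
set zI := (e, I) :: z in z0 *; rewrite (comm_prod_filter _ _ (fun s => s.2 == I)).
rewrite (IH [seq s <- zI | s.2 != I]) ?mulg1 => [||J uJ].
- have [uI|nuI] := boolP (uniq (k :: I)); last first.
    rewrite /comm_prod big_filter big1 // => s /eqP ->.
    by rewrite iter_comm_nonuniq //; case: s.1; rewrite //= invg1.
  have [p [m [zI_exp ->]]] := comm_prod_constant k (filter_all (fun s => s.2 == I) zI).
  have /eqP := z0 I uI; move: zI_exp; rewrite (exponent_filter (pred1 I)) /= eqxx => ->.
  rewrite eqz_mod_dvd subr0 -eqz_mod_dvd !modz_nat => /eqP[/expgn_eq_mod->].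
    by rewrite mulgV.
  exact: iter_comm_expn.
- by rewrite /= eqxx; apply: leq_ltn_trans (_ : size z < r); rewrite // size_filter count_size.
- by rewrite (exponent_filter (predC1 I)); case: ifP => // _; apply: z0.
Qed.

(* Conjugating iter_comm k J by a word multiplies out as u ^ a_j = u [u, a_j]. *)
Fixpoint conj_expansion (h : aword) (J : seq nat) : seq (bool * seq nat) :=
  if h is (j, e) :: h' then
    conj_expansion h' J ++ scale_sign e (conj_expansion h' (rcons J j))
  else [:: (true, J)].

Lemma iter_comm_conj_letter k J j e :
  iter_comm k J ^ signg (a j) e = iter_comm k J * signg (iter_comm k (rcons J j)) e.
Proof.
rewrite iter_comm_rcons; set u := iter_comm k J.
case: e => /=; first by rewrite commgEl mulVKg.
have uj : commute [~ u, a j] (a j).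
  by rewrite -[X in commute _ X]conjg1; apply/class_bicent_commute_conj/class_bicent_commgr.
apply: (canLR (conjgK (a j))); rewrite conjMg conjVg [[~ u, _] ^ _]conjgE uj mulKg.
by rewrite commgEl invgM invgK mulVKg.
Qed.

Lemma iter_comm_conj k J h : iter_comm k J ^ word_eval h = comm_prod k (conj_expansion h J).
Proof.
elim: h J => [|[j e] h IH] J; first by rewrite /word_eval /comm_prod big_nil big_seq1 conjg1.
rewrite word_eval_cons conjgM iter_comm_conj_letter conjMg conjg_signg !IH.
by rewrite /= comm_prod_cat comm_prod_scale.
Qed.

Lemma conj_expansion_prefix h J s : s \in conj_expansion h J -> prefix J s.2.
Proof.
elim: h J s => [|[j e] h IH] J s /=; first by rewrite inE => /eqP ->; apply: prefix_refl.
rewrite mem_cat => /orP[/IH //|/mapP[t /IH Jt ->]] /=.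
exact: prefix_trans (prefix_rcons _ _) Jt.
Qed.

Lemma exponent_non_prefix h I J : ~~ prefix I J -> exponent (conj_expansion h I) J = 0%R.
Proof.
move=> IJ; rewrite /exponent big_seq big1 // => s /conj_expansion_prefix.
by case: eqP => [->|_ _]; rewrite ?(negPf IJ) // mul0r.
Qed.

Lemma exponent_conj_expansion h J M : exponent (conj_expansion h J) (J ++ M) = rcoef h M.
Proof.
elim: h J M => [|[j e] h IH] J M /=.
  by rewrite /exponent big_seq1 mulr1 -{1}[J]cats0 eqseq_cat // eqxx eq_sym; case: eqP.
rewrite exponent_cat IH exponent_scale; congr (_ + _)%R; case: M => [|i M].
  rewrite exponent_non_prefix ?mulr0 // cats0.
  by apply/negP => /size_prefix; rewrite size_rcons ltnn.
case: eqP => [->|ij]; first by rewrite -cat_rcons IH.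
rewrite exponent_non_prefix ?mulr0 // -cats1 prefix_catr //= prefix0s andbT.
by apply/nandP; right; apply/eqP => /esym.
Qed.

Lemma word_eval_erase k w :
  exists z, word_eval w = word_eval [seq y <- w | y.1 != k] * comm_prod k z /\
    forall J, k \notin J -> exponent z J = rcoef w (k :: J).
Proof.
elim: w => [|[j e] w [z [w_eval z_exp]]].
  exists [::]; rewrite /word_eval /comm_prod !big_nil mulg1; split=> // J _.
  by rewrite /exponent big_nil.
rewrite word_eval_cons w_eval /=; case: eqP => [->|jk] /=; last first.
  exists z; split; first by rewrite word_eval_cons mulgA.
  by move=> J kJ; rewrite z_exp //; case: eqP => [/esym //|_]; rewrite addr0.
set w' := filter _ _; exists (scale_sign e (conj_expansion w' [::]) ++ z); split=> [|J kJ].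
  rewrite comm_prod_cat comm_prod_scale -iter_comm_conj -conjg_signg mulgA [RHS]mulgA.
  by congr (_ * _); apply: conjgC.
rewrite exponent_cat exponent_scale z_exp // eqxx addrC.
by rewrite -[J]cat0s exponent_conj_expansion rcoef_erase.
Qed.

Theorem word_eval_trivial w :
  (forall M, M != [::] -> uniq M -> (rcoef w M = 0 %[mod n])%Z) -> word_eval w = 1.
Proof.
have [r] := ubnP (size (undup (map fst w))).
elim: r w => [//|r IH] [|y w] sz w0; first by rewrite /word_eval big_nil.
have [z [-> z_exp]] := word_eval_erase y.1 (y :: w).
rewrite comm_prod_trivial ?mulg1 => [|J /= /andP[yJ uJ]]; last first.
  by rewrite z_exp // w0 //= yJ.
apply: IH => [|M M0 uM].
  rewrite -ltnS; apply: leq_trans sz; rewrite ltnS.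
  rewrite -(filter_map fst (fun j => j != y.1)) -filter_undup size_filter.
  rewrite -(count_predC (fun j => j != y.1) (undup _)) -addn1 leq_add2l -has_count.
  by apply/hasP; exists y.1; rewrite ?mem_undup ?mem_head //= eqxx.
have [yM|yM] := boolP (y.1 \in M); last by rewrite rcoef_erase ?w0.
rewrite (rcoef_absent yM) //; apply/mapP => -[x]; rewrite mem_filter => /andP[xy _] yx.
by rewrite yx eqxx in xy.
Qed.

End ReducedFreeImage.

(** * The reduced free group modulo n-th powers *)

Section WordGroup.
Variables (T : choiceType) (R : relation (seq (T * bool))) (RC : group_congruence R).
Implicit Types (u v : seq (T * bool)).

Definition congrb u v : bool := if excluded_middle_informative (R u v) then true else false.

Lemma congrbP u v : reflect (R u v) (congrb u v).
Proof. by rewrite /congrb; case: excluded_middle_informative => uv; constructor. Qed.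

Lemma congrb_refl : reflexive congrb.
Proof. by move=> u; apply/congrbP; reflexivity. Qed.

Lemma congrb_sym : symmetric congrb.
Proof. by move=> u v; apply/congrbP/congrbP; apply: symmetry. Qed.

Lemma congrb_trans : transitive congrb.
Proof. by move=> v u w /congrbP uv /congrbP vw; apply/congrbP; rewrite uv. Qed.

Canonical congrb_equiv := EquivRel congrb congrb_refl congrb_sym congrb_trans.

Definition word_group := {eq_quot congrb}%qT.
HB.instance Definition _ := Choice.on word_group.
HB.instance Definition _ := Quotient.on word_group.

Definition word_class u : word_group := (\pi u)%qT.

Lemma word_classP u v : word_class u = word_class v <-> R u v.
Proof. by split=> [/eqmodP/congrbP | /congrbP/eqmodP]. Qed.

Lemma repr_word_class u : R (repr (word_class u)) u.
Proof. by apply/word_classP; apply: reprK. Qed.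

Lemma word_class_ind (P : word_group -> Prop) :
  (forall u, P (word_class u)) -> forall x, P x.
Proof. by move=> Pu x; rewrite -[x]reprK. Qed.

Definition class_mul (x y : word_group) := word_class (repr x ++ repr y).
Definition class_inv (x : word_group) := word_class (invw (repr x)).

Lemma class_mulE u v : class_mul (word_class u) (word_class v) = word_class (u ++ v).
Proof. by apply/word_classP; rewrite !repr_word_class; reflexivity. Qed.

Lemma class_invE u : class_inv (word_class u) = word_class (invw u).
Proof. by apply/word_classP; rewrite repr_word_class; reflexivity. Qed.

Lemma class_mulA : associative class_mul.
Proof. by do 3!elim/word_class_ind => ?; rewrite !class_mulE catA. Qed.

Lemma class_mul1 : left_id (word_class [::]) class_mul.
Proof. by elim/word_class_ind => u; rewrite class_mulE. Qed.

Lemma class_mulr1 : right_id (word_class [::]) class_mul.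
Proof. by elim/word_class_ind => u; rewrite class_mulE cats0. Qed.

Lemma class_mulV : left_inverse (word_class [::]) class_inv class_mul.
Proof.
elim/word_class_ind => u; rewrite class_invE class_mulE; apply/word_classP.
exact: congr_mulVw.
Qed.

Lemma class_mulrV : right_inverse (word_class [::]) class_inv class_mul.
Proof.
elim/word_class_ind => u; rewrite class_invE class_mulE; apply/word_classP.
exact: congr_mulwV.
Qed.

HB.instance Definition _ :=
  isGroup.Build word_group class_mulA class_mul1 class_mulr1 class_mulV class_mulrV.

Lemma word_classM u v : (word_class u * word_class v)%g = word_class (u ++ v).
Proof. exact: class_mulE. Qed.

Lemma word_classV u : ((word_class u)^-1)%g = word_class (invw u).
Proof. exact: class_invE. Qed.

Lemma word_classJ u h : (word_class u ^ word_class h)%g = word_class (conjw u h).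
Proof. by rewrite conjgE word_classV (word_classM u) word_classM. Qed.

Lemma word_class_nseq k x : (word_class [:: x] ^+ k)%g = word_class (nseq k x).
Proof. by elim: k => [//|k IH]; rewrite expgS IH word_classM. Qed.

End WordGroup.

(* The last relation makes a_j commute with its conjugates, by letting g and g a_j
   conjugate a_j in the same way. *)
Inductive reduced_step (n : nat) (D : pred nat) : relation aword :=
| reduced_cancel p s x : D x.1 -> reduced_step n D (p ++ [:: x; invl x] ++ s) (p ++ s)
| reduced_power p s j : D j -> reduced_step n D (p ++ nseq n (j, true) ++ s) (p ++ s)
| reduced_commute p s j g : D j -> word_in D g ->
    reduced_step n D (p ++ conjw [:: (j, true)] g ++ s)
                     (p ++ conjw [:: (j, true)] (rcons g (j, true)) ++ s).

Definition reduced_congr n D : relation aword := clos_refl_sym_trans _ (reduced_step n D).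

Lemma word_in_invw D w : word_in D (invw w) = word_in D w.
Proof. by rewrite /word_in all_rev all_map. Qed.

Lemma word_in_conjw D u h : word_in D (conjw u h) = word_in D h && word_in D u.
Proof. by rewrite !word_in_cat word_in_invw andbCA andbb andbC. Qed.

Lemma filter_invw (D : pred nat) (w : aword) :
  [seq x <- invw w | D x.1] = invw [seq x <- w | D x.1].
Proof. by rewrite /invw filter_rev filter_map. Qed.

Lemma reduced_group_congruence n : group_congruence (reduced_congr n predT).
Proof.
apply: group_congruence_closure => [a b _ _ [p s x _|p s j _|p s j g _ _]|x].
- by have := @reduced_cancel n predT (a ++ p) (s ++ b) x isT; rewrite -!catA.
- by have := @reduced_power n predT (a ++ p) (s ++ b) j isT; rewrite -!catA.
- have := @reduced_commute n predT (a ++ p) (s ++ b) j g isT; rewrite -!catA; apply.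
  exact/allP.
- exact: (@reduced_cancel n predT [::] [::] x).
Qed.

Lemma reduced_congr_erase n (D : pred nat) u v : reduced_congr n predT u v ->
  reduced_congr n D [seq x <- u | D x.1] [seq x <- v | D x.1].
Proof.
elim=> {u v} [_ _ [p s x _|p s j _|p s j g _ _]|u|u v _|u v w _ uv _ vw].
- rewrite !filter_cat /=; case Dx: (D x.1); last exact: rst_refl.
  exact/rst_step/reduced_cancel.
- rewrite !filter_cat filter_nseq /=; case Dj: (D j); last exact: rst_refl.
  by rewrite mul1n; apply/rst_step/reduced_power.
- rewrite /conjw !filter_cat !filter_invw filter_rcons /=; case: ifP => Dj; last exact: rst_refl.
  exact/rst_step/reduced_commute/filter_all.
- exact: rst_refl.
- exact: rst_sym.
- exact: rst_trans uv vw.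
Qed.

Section ReducedFreeGroup.
Variable n : nat.
Local Notation rfree := (word_group (reduced_group_congruence n)).
Local Notation class := (word_class (reduced_group_congruence n)).

Lemma class_generator_commute_conj k (g : rfree) :
  commute (class [:: (k, true)]) (class [:: (k, true)] ^ g)%g.
Proof.
elim/word_class_ind: g => g; apply: commute_sym; rewrite /commute conjgC; congr (_ * _)%g.
rewrite -conjgM word_classM !word_classJ cats1; apply/word_classP/rst_sym/rst_step.
have := @reduced_commute n predT [::] [::] k g isT; rewrite !cats0; apply; exact/allP.
Qed.

Lemma class_generator_expn k : (class [:: (k, true)] ^+ n)%g = 1%g.
Proof.
rewrite word_class_nseq; apply/word_classP/rst_step.
by have := @reduced_power n predT [::] [::] k isT; rewrite !cats0.
Qed.

Lemma word_eval_class w : word_eval (fun k => class [:: (k, true)]) w = class w.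
Proof.
elim: w => [|[k e] w IH]; first by rewrite /word_eval big_nil.
rewrite word_eval_cons IH -[in RHS]cat1s -word_classM; congr (_ * _)%g.
by case: e => //=; rewrite word_classV.
Qed.

End ReducedFreeGroup.

Theorem reduced_congr_of_rcoef (n : nat) (D : pred nat) u v : word_in D u -> word_in D v ->
  (forall M, uniq M -> all D M -> (rcoef u M = rcoef v M %[mod n])%Z) ->
  reduced_congr n D u v.
Proof.
move=> Du Dv uvD.
have uv q : magnus_eq n q predT u v.
  move=> M uM _ _; have [|/allPn[k kM Dk]] := boolP (all D M); first exact: uvD.
  have absent w : word_in D w -> k \notin map fst w.
    by move=> Dw; apply: contra Dk => /mapP[x xw ->]; apply: (allP Dw).
  by rewrite !(rcoef_absent kM) ?absent.
suff: reduced_congr n predT u v by move/(reduced_congr_erase D); rewrite !(all_filterP _).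
apply/(word_classP (reduced_group_congruence n)).
apply: (mulgI (word_class _ (invw v))); rewrite !word_classM -!word_eval_class.
transitivity (1 : word_group (reduced_group_congruence n))%g.
  apply: (@word_eval_trivial _ n) => [||M M0 uM].
  - exact: class_generator_commute_conj.
  - exact: class_generator_expn.
  - have uv1 : magnus_eq n (size M).+1 predT (invw v ++ u) [::] by rewrite uv; apply: congr_mulVw.
    by rewrite uv1 ?all_predT //= (negPf M0).
by rewrite word_eval_class; apply/esym/word_classP/(@congr_mulVw _ _ (reduced_group_congruence n)).
Qed.

(** * Gauss diagrams *)

Section NestedSequences.
Variables (T U : Type).
Implicit Types (ss : seq (seq T)).

Lemma nth_map_nil (f : seq T -> seq U) ss k : f [::] = [::] ->
  nth [::] (map f ss) k = f (nth [::] ss k).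
Proof.
move=> f0; have [kss|ssk] := ltnP k (size ss); first by rewrite (nth_map [::]).
by rewrite !nth_default ?size_map.
Qed.

Lemma eq_from_nth_nil ss ss' : size ss = size ss' ->
  (forall k, nth [::] ss k = nth [::] ss' k) -> ss = ss'.
Proof. by move=> sz eq_ss; apply: (eq_from_nth (x0 := [::])) => // k _. Qed.

End NestedSequences.

Section NestedSequencesEq.
Variable T : eqType.
Implicit Types (ss : seq (seq T)) (u v w : seq T).

Lemma mem_nth_lt ss x k : x \in nth [::] ss k -> k < size ss.
Proof. by rewrite ltnNge; apply: contraTN => /(nth_default _) ->. Qed.

Lemma mem_nth_flatten ss x k : x \in nth [::] ss k -> x \in flatten ss.
Proof.
move=> xk; apply/flattenP; exists (nth [::] ss k) => //.
exact/mem_nth/(mem_nth_lt xk).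
Qed.

Lemma flatten_nthP ss x : reflect (exists k, x \in nth [::] ss k) (x \in flatten ss).
Proof.
apply: (iffP idP) => [/flattenP[s /(nthP [::])[k _ <-] xk]|[k /mem_nth_flatten //]].
by exists k.
Qed.

Lemma nth_subseq_flatten ss k : subseq (nth [::] ss k) (flatten ss).
Proof.
elim: ss k => [|s ss IH] [|k] //=; first exact: prefix_subseq.
by apply: subseq_trans (IH k) _; apply: suffix_subseq.
Qed.

Lemma uniq_flatten_nth ss x i j :
  uniq (flatten ss) -> x \in nth [::] ss i -> x \in nth [::] ss j -> i = j.
Proof.
elim: ss i j => [|s ss IH] i j /=; first by rewrite nth_nil.
rewrite cat_uniq => /and3P[us /hasPn dis uss].
case: i j => [|i] [|j] //= xi xj; last by congr _.+1; apply: IH.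
  by have /= := dis x (mem_nth_flatten xj); rewrite xi.
by have /= := dis x (mem_nth_flatten xi); rewrite xj.
Qed.

Lemma uniq_cat_mem u w v x : uniq (u ++ w ++ v) -> x \in w -> (x \notin u) /\ (x \notin v).
Proof.
rewrite uniq_catCA cat_uniq => /and3P[_ /hasPn w_disj _] xw.
by split; apply/negP => x_in; have := w_disj x; rewrite mem_cat x_in ?orbT /= xw => /(_ isT).
Qed.

Lemma map_uniq_inj_in (T' : eqType) (f : T -> T') u : uniq (map f u) -> {in u &, injective f}.
Proof.
elim: u => //= z u IH /andP[zu uu] x y; rewrite !inE.
case/predU1P=> [->|xu] /predU1P[->|yu] fxy //; last exact: IH fxy.
  by rewrite fxy map_f in zu.
by rewrite -fxy map_f in zu.
Qed.

Lemma perm_flatten_nth ss ss' : size ss = size ss' ->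
  (forall k, perm_eq (nth [::] ss k) (nth [::] ss' k)) -> perm_eq (flatten ss) (flatten ss').
Proof.
elim: ss ss' => [|s ss IH] [|s' ss'] //= [sz] perm_ss.
by apply: perm_cat; [apply: (perm_ss 0) | apply: IH => // k; apply: (perm_ss k.+1)].
Qed.

End NestedSequencesEq.

Local Notation strand d k := (@nth (seq letter) [::] d k).

Definition endpoint (l : letter) : nat * bool := (lid l, lover l).
Definition other_end (l : letter) : letter := (lid l, ~~ lover l, lsgn l).

Lemma endpoint_other_end l : endpoint (other_end l) = (lid l, ~~ lover l).
Proof. by []. Qed.

Definition paired (s : seq letter) : Prop :=
  uniq (map endpoint s) /\ {in s, forall l, other_end l \in s}.

Lemma paired_perm s s' : perm_eq s s' -> paired s -> paired s'.
Proof.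
move=> ss' [us other_s]; split; first by rewrite -(perm_uniq (perm_map endpoint ss')).
by move=> l; rewrite -!(perm_mem ss'); apply: other_s.
Qed.

Lemma paired_filter (P : pred nat) s : paired s -> paired [seq l <- s | P (lid l)].
Proof.
move=> [us other_s]; split; first exact: subseq_uniq (map_subseq _ (filter_subseq _ _)) us.
by move=> l; rewrite !mem_filter => /andP[-> /other_s].
Qed.

Lemma paired_relabel (f : nat -> nat) s : injective f -> paired s ->
  paired [seq (f (lid l), lover l, lsgn l) : letter | l <- s].
Proof.
move=> f_inj [us other_s]; split.
  rewrite -map_comp (eq_map (g := (fun p => (f p.1, p.2)) \o endpoint)) // map_comp.
  by rewrite map_inj_uniq // => -[c o] [c' o'] [/f_inj -> ->].
move=> _ /mapP[l ls ->]; apply/mapP; exists (other_end l) => //; exact: other_s.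
Qed.

Lemma paired_cons c e s : c \notin map lid s -> paired s -> paired (Tl c e :: Hl c e :: s).
Proof.
move=> c_new [us other_s]; have new_end b : (c, b) \notin map endpoint s.
  by apply: contra c_new => /mapP[l ls [-> _]]; apply: map_f.
split.
  rewrite /= -[endpoint (Tl c e)]/(c, true) -[endpoint (Hl c e)]/(c, false).
  by rewrite inE negb_or us !new_end xpair_eqE andbF.
move=> l; rewrite !inE => /or3P[/eqP ->|/eqP ->|/other_s ->]; last by rewrite !orbT.
  by rewrite [other_end _]/(Hl c e) eqxx orbT.
by rewrite [other_end _]/(Tl c e) eqxx.
Qed.

Lemma wfP m d : wf m d <-> size d = m /\ paired (flatten d).
Proof.
pose ends := map endpoint (flatten d); have count_ends c b : count_mem (c, b) ends =
    count (fun l => (lid l == c) && (if b then lover l else ~~ lover l)) (flatten d).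
  by rewrite count_map; apply: eq_count => l; rewrite /= xpair_eqE; case: b (lover l) => [] [].
split=> [[sz [balanced sgn]]|[sz [uniq_ends other_d]]]; split=> //.
  have le1 p : count_mem p ends <= 1.
    by case: p => c []; have [same le_c] := balanced c; rewrite count_ends //= -same.
  have uniq_ends : uniq ends.
    apply: count_mem_uniq => p; have := le1 p; rewrite -has_pred1 has_count.
    by case: (count _ _) => [|[]].
  split=> // l ld; have : (lid l, ~~ lover l) \in ends.
    have := map_f endpoint ld; rewrite -/ends /endpoint -!has_pred1 !has_count !count_ends.
    by have [same _] := balanced (lid l); case: (lover l); rewrite /= same.
  case/mapP=> x xd [same_id over]; rewrite /other_end same_id over (sgn l x) //.
  by case: x xd {same_id over} => [[]].
have ends_inj := map_uniq_inj_in uniq_ends.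
split=> [c|x y xd yd same_id].
  have := count_ends c true; have := count_ends c false => /= <- <-.
  rewrite !count_uniq_mem //; have -> : ((c, true) \in ends) = ((c, false) \in ends).
    by apply/mapP/mapP => -[l ld [-> over]]; exists (other_end l);
      rewrite ?other_d // endpoint_other_end -over.
  by split=> //; case: (_ \in _).
have [same_over|] := eqVneq (lover x) (lover y).
  by rewrite (ends_inj x y) // /endpoint same_id same_over.
move=> over; rewrite -[lsgn y]/(lsgn (other_end y)) (ends_inj x (other_end y)) ?other_d //.
by rewrite endpoint_other_end /endpoint same_id; case: (lover x) (lover y) over => [] [].
Qed.

Section WellFormed.
Variables (m : nat) (d : gdiag).
Hypothesis wf_d : wf m d.

Lemma wf_size : size d = m.
Proof. by case: wf_d. Qed.

Lemma wf_uniq : uniq (flatten d).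
Proof. by have [_ [/map_uniq]] := (wfP m d).1 wf_d. Qed.

Lemma wf_uniq_endpoints k : uniq (map endpoint (strand d k)).
Proof.
have [_ [uniq_d _]] := (wfP m d).1 wf_d.
exact: subseq_uniq (map_subseq _ (nth_subseq_flatten _ _)) uniq_d.
Qed.

Lemma wf_uniq_strand k : uniq (strand d k).
Proof. exact: map_uniq (wf_uniq_endpoints k). Qed.

Lemma wf_endpoint_inj x y : x \in flatten d -> y \in flatten d -> endpoint x = endpoint y -> x = y.
Proof. by have [_ [/map_uniq_inj_in + _]] := (wfP m d).1 wf_d; apply. Qed.

Lemma wf_lid_neq x l : x \in flatten d -> l \in flatten d -> lover l = lover x -> l != x ->
  lid l != lid x.
Proof.
move=> xd ld ox; apply: contraNneq => lx; apply/eqP/(wf_endpoint_inj ld xd).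
by rewrite /endpoint lx ox.
Qed.

Lemma wf_same_strand x y i j : x \in strand d i -> y \in strand d j ->
  endpoint x = endpoint y -> i = j.
Proof.
move=> xi yj xy; apply: (uniq_flatten_nth wf_uniq xi).
by rewrite (wf_endpoint_inj (mem_nth_flatten xi) (mem_nth_flatten yj) xy).
Qed.

Lemma wf_other_end l : l \in flatten d -> other_end l \in flatten d.
Proof. by have [_ [_ other_d]] := (wfP m d).1 wf_d; apply: other_d. Qed.

Lemma wf_tail_ind (P : nat -> Prop) :
  (forall k l, l \in strand d k -> lover l -> P (lid l)) ->
  forall l, l \in flatten d -> P (lid l).
Proof.
move=> P_tail l ld; have [ol|ol] := boolP (lover l).
  by have /flatten_nthP[k lk] := ld; apply: P_tail lk ol.
by have /flatten_nthP[k lk] := wf_other_end ld; apply: P_tail lk ol.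
Qed.

End WellFormed.

Lemma wf_perm m (d d' : gdiag) : size d = size d' ->
  (forall k, perm_eq (strand d k) (strand d' k)) -> wf m d -> wf m d'.
Proof.
move=> sz perm_strand /wfP[sd pd]; apply/wfP; split; first by rewrite -sz.
exact: paired_perm (perm_flatten_nth sz perm_strand) pd.
Qed.

Lemma strand_del C d k : strand (del C d) k = [seq l <- strand d k | lid l \notin C].
Proof. exact: nth_map_nil. Qed.

Lemma wf_del m C d : wf m d -> wf m (del C d).
Proof.
move=> /wfP[sd pd]; apply/wfP; rewrite size_map -filter_flatten; split=> //.
exact: (paired_filter (fun c => c \notin C)) pd.
Qed.

Lemma del_cons a C d : del (a :: C) d = del C (del [:: a] d).
Proof.
rewrite /del -map_comp; apply: eq_map => s /=; rewrite -filter_predI.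
by apply: eq_filter => l; rewrite /= !inE negb_or andbC.
Qed.

Definition set_strand (d : gdiag) i s : gdiag := set_nth [::] d i s.

Lemma strand_set d i s k : strand (set_strand d i s) k = if k == i then s else strand d k.
Proof. exact: nth_set_nth. Qed.

Lemma size_set_strand d i s : i < size d -> size (set_strand d i s) = size d.
Proof. by move=> id; rewrite size_set_nth; apply/maxn_idPr. Qed.

Lemma set_strand_id d i : i < size d -> set_strand d i (strand d i) = d.
Proof.
move=> id; apply: eq_from_nth_nil => [|k]; rewrite ?size_set_strand // strand_set.
by case: eqP => // ->.
Qed.

Lemma set_strand_twice d i s s' : i < size d ->
  set_strand (set_strand d i s) i s' = set_strand d i s'.
Proof.
by move=> id; apply: eq_from_nth_nil => [|k]; rewrite ?size_set_strand // !strand_set; case: eqP.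
Qed.

Lemma swap_atE d i u x y v : strand d i = u ++ [:: x; y] ++ v ->
  swap_at d i (size u) = set_strand d i (u ++ [:: y; x] ++ v).
Proof.
move=> di; rewrite /swap_at di take_size_cat // !nth_cat ltnn ltnNge leqnSn subnn subSnn /=.
by rewrite -add2n -drop_drop drop_size_cat //= drop0.
Qed.

Lemma at_pairP d i p x y : at_pair d i p x y -> exists u v,
  [/\ strand d i = u ++ [:: x; y] ++ v, i < size d &
      swap_at d i p = set_strand d i (u ++ [:: y; x] ++ v)].
Proof.
case=> u [v [di <-]]; exists u, v; rewrite (swap_atE di); split=> //.
by apply: (@mem_nth_lt _ d x); rewrite di mem_cat mem_head orbT.
Qed.

Lemma perm_swap_at d i p x y : at_pair d i p x y -> size (swap_at d i p) = size d /\
  forall k, perm_eq (strand d k) (strand (swap_at d i p) k).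
Proof.
case/at_pairP=> u [v [di id ->]]; split=> [|k]; first exact: size_set_strand.
rewrite strand_set; case: eqP => [->|_] //.
by rewrite di perm_cat2l perm_cat2r; apply/permP => P /=; rewrite !addn0 addnC.
Qed.

Lemma wf_swap_at m d i p x y : at_pair d i p x y -> wf m d -> wf m (swap_at d i p).
Proof. by case/perm_swap_at => sz perm_d; apply: wf_perm. Qed.

Definition exchange (x y l : letter) : letter :=
  if l == x then y else if l == y then x else l.

Lemma map_exchange_id x y s : x \notin s -> y \notin s -> map (exchange x y) s = s.
Proof.
move=> xs ys; rewrite -[RHS]map_id; apply/eq_in_map => l ls; rewrite /exchange.
by rewrite (negPf (memPn xs _ ls)) (negPf (memPn ys _ ls)).
Qed.

(* Endpoints occur only once, so transposing two adjacent endpoints is the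
   global exchange of the two letters. *)
Lemma swap_at_exchange m d i p x y : wf m d -> at_pair d i p x y ->
  swap_at d i p = map (map (exchange x y)) d.
Proof.
move=> wf_d /at_pairP[u [v [di id ->]]].
have us := wf_uniq_strand wf_d i; rewrite di in us.
have [xu xv] : x \notin u /\ x \notin v.
  by apply: (uniq_cat_mem us); rewrite mem_head.
have [yu yv] : y \notin u /\ y \notin v.
  by apply: (uniq_cat_mem us); rewrite !inE eqxx orbT.
have xy : x != y by move: us; rewrite uniq_catCA /= inE => /andP[/norP[]].
have notin k z : k != i -> z \in strand d i -> z \notin strand d k.
  by move=> /eqP ki zi; apply/negP => zk; apply: ki (uniq_flatten_nth (wf_uniq wf_d) zk zi).
apply: eq_from_nth_nil => [|k]; first by rewrite size_set_strand ?size_map.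
rewrite strand_set nth_map_nil //; case: eqVneq => [->|ki].
  rewrite di !map_cat (map_exchange_id xu yu) (map_exchange_id xv yv) /= /exchange !eqxx.
  by rewrite [y == x]eq_sym (negPf xy).
by rewrite map_exchange_id // notin // di mem_cat !inE eqxx !orbT.
Qed.

Lemma at_pair_map (f : letter -> letter) d i p x y :
  at_pair d i p x y -> at_pair (map (map f) d) i p (f x) (f y).
Proof.
move=> [u [v [di up]]]; exists (map f u), (map f v).
by rewrite nth_map_nil // di map_cat size_map.
Qed.

Lemma del_swap_at C d i p x y : lid x \in C -> lid y \in C -> at_pair d i p x y ->
  del C (swap_at d i p) = del C d.
Proof.
move=> xC yC /at_pairP[u [v [di id ->]]].
apply: eq_from_nth_nil => [|k]; first by rewrite !size_map size_set_strand.
rewrite !strand_del strand_set; case: eqP => // ->.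
by rewrite di !filter_cat /= xC yC.
Qed.

(** ** Arrows with both ends on one strand *)

Definition self_arrow (d : gdiag) i c : bool :=
  all (mem (map endpoint (strand d i))) [:: (c, true); (c, false)].

Lemma self_arrowP d i c : reflect
  (exists x y, [/\ x \in strand d i, y \in strand d i, endpoint x = (c, true)
                 & endpoint y = (c, false)]) (self_arrow d i c).
Proof.
rewrite /self_arrow /= andbT; apply: (iffP andP) => [[/mapP[x xi ->] /mapP[y yi ->]]|].
  by exists x, y.
by case=> x [y [xi yi <- <-]]; split; apply: map_f.
Qed.

Lemma self_arrow_del C d i c : c \notin C -> self_arrow (del C d) i c = self_arrow d i c.
Proof.
move=> cC; apply: eq_in_all => p; rewrite strand_del !inE => p_c.
have {p_c} pC : p.1 \notin C by case/orP: p_c => /eqP ->.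
apply/mapP/mapP => -[l]; first by rewrite mem_filter => /andP[_ li] ->; exists l.
by move=> li p_l; exists l => //; rewrite mem_filter li -[lid l]/((endpoint l).1) -p_l pC.
Qed.

Lemma perm_self_arrow d d' i c : (forall k, perm_eq (strand d k) (strand d' k)) ->
  self_arrow d i c -> self_arrow d' i c.
Proof.
by move=> perm_d; apply: sub_all => p; rewrite /= (perm_mem (perm_map endpoint (perm_d i))).
Qed.

Lemma sv_stepP m d d' : wf m d' ->
  sv_step d d' <-> exists c i, d = del [:: c] d' /\ self_arrow d' i c.
Proof.
move=> wf_d'; have count_id c i : count (fun l => lid l == c) (strand d' i) =
    ((c, true) \in map endpoint (strand d' i)) + ((c, false) \in map endpoint (strand d' i)).
  rewrite -!count_uniq_mem ?(wf_uniq_endpoints wf_d') // !count_map -count_predUI.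
  rewrite [X in _ = _ + X](_ : _ = 0) ?addn0.
    by apply: eq_count => l /=; rewrite !xpair_eqE; case: (lid l == c) (lover l) => [] [].
  apply/eqP; rewrite -leqn0 leqNgt -has_count; apply/hasPn => l _ /=.
  by rewrite !xpair_eqE; case: (lover l); rewrite ?andbF.
rewrite /self_arrow; split=> [[c [i [-> [_ two]]]]|[c [i [-> /= /and3P[ci ci' _]]]]].
  exists c, i; split=> //; move: two; rewrite count_id /=.
  by case: (_ \in _); case: (_ \in _).
by exists c, i; rewrite has_count !count_id ci ci'.
Qed.

Lemma R1_sv m d d' : wf m d' -> R1_step d d' -> sv_step d d'.
Proof.
move=> wf_d' [c [x [y [-> [<- [yx [i [u [v di]]]]]]]]].
apply/(sv_stepP _ wf_d'); exists (lid x), i; split=> //; apply/self_arrowP.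
have [xi yi] : x \in strand d' i /\ y \in strand d' i.
  by rewrite di !mem_cat !inE !eqxx !orbT.
have xy : lover x != lover y.
  have := wf_uniq_endpoints wf_d' i; rewrite di !map_cat !cat_uniq /= inE.
  by rewrite /endpoint yx xpair_eqE eqxx => /and5P[_ _ /andP[]].
rewrite /endpoint; case ox: (lover x) xy; case oy: (lover y) => // _.
  by exists x, y; rewrite ox oy yx.
by exists y, x; rewrite ox oy yx.
Qed.

Definition tail_strand (d : gdiag) (c : nat) : nat :=
  find (has (fun l => (lid l == c) && lover l)) d.

Lemma tail_strandE m d k l : wf m d -> l \in strand d k -> lover l -> tail_strand d (lid l) = k.
Proof.
move=> wf_d lk ol; have has_l : has (fun x => (lid x == lid l) && lover x) (strand d k).
  by apply/hasP; exists l; rewrite ?eqxx.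
have has_d : has (has (fun x => (lid x == lid l) && lover x)) d.
  by apply/hasP; exists (strand d k) => //; apply: mem_nth (mem_nth_lt lk).
have /hasP[x xj /andP[/eqP xl ox]] := nth_find [::] has_d.
by apply: (wf_same_strand wf_d xj lk); rewrite /endpoint xl ox ol.
Qed.

Lemma tail_strand_tail m d l : wf m d -> l \in flatten d ->
  (lid l, true) \in map endpoint (strand d (tail_strand d (lid l))).
Proof.
move=> wf_d; move: l.
apply: (wf_tail_ind wf_d
  (P := fun c => (c, true) \in map endpoint (strand d (tail_strand d c)))) => k l lk ol.
by rewrite (tail_strandE wf_d lk ol) -ol; apply: (map_f endpoint lk).
Qed.

Definition heads (s : seq letter) := [seq l <- s | ~~ lover l].

Lemma over_arcE m d k u l v : wf m d -> strand d k = u ++ l :: v -> lover l ->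
  over_arc d (lid l) = (k, size (heads u)).
Proof.
move=> wf_d dk ol; have lk : l \in strand d k by rewrite dk mem_cat mem_head orbT.
rewrite /over_arc -/(tail_strand d (lid l)) (tail_strandE wf_d lk ol) dk find_cat.
rewrite ifN /= ?eqxx ?ol ?addn0 ?take_size_cat ?size_filter //.
apply/hasPn => x xu; apply/negP => /andP[/eqP xl ox].
have := wf_uniq_endpoints wf_d k; rewrite dk map_cat cat_uniq => /and3P[_ /hasPn u_disj _].
case/negP: (u_disj (endpoint l) (mem_head _ _)); apply/mapP; exists x => //.
by rewrite /endpoint xl ox ol.
Qed.

(** * Colorings *)

Definition reading (t : nat -> aword) (s : seq letter) : aword :=
  flatten [seq expw (t (lid l)) (lsgn l) | l <- heads s].

Section Reading.
Implicit Types (t : nat -> aword) (s u v : seq letter).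

Lemma reading_cat t u v : reading t (u ++ v) = reading t u ++ reading t v.
Proof. by rewrite /reading /heads filter_cat map_cat flatten_cat. Qed.

Lemma reading_head t l : ~~ lover l -> reading t [:: l] = expw (t (lid l)) (lsgn l).
Proof. by rewrite /reading /= => ->; rewrite /= cats0. Qed.

Lemma reading_tails t s : all lover s -> reading t s = [::].
Proof.
move=> s_tails; rewrite /reading /heads (_ : filter _ _ = [::]) //.
apply/eqP; rewrite -[_ == _]negbK -has_filter -all_predC (eq_all (a2 := lover)) // => l /=.
by rewrite negbK.
Qed.

Lemma reading_filter t s (P : pred letter) : (forall l, l \in s -> ~~ lover l -> P l) ->
  reading t (filter P s) = reading t s.
Proof.
move=> heads_P; rewrite /reading /heads -filter_predI; congr (flatten (map _ _)).
by apply: eq_in_filter => l ls /=; case: (boolP (lover l)) => //= /heads_P ->.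
Qed.

Lemma reading_heads t s : reading t (heads s) = reading t s.
Proof. exact: reading_filter. Qed.

Lemma eq_reading t t' s : (forall l, l \in s -> ~~ lover l -> t (lid l) = t' (lid l)) ->
  reading t s = reading t' s.
Proof.
move=> tt'; congr flatten; apply/eq_in_map => l; rewrite mem_filter => /andP[ol ls].
by rewrite tt'.
Qed.

Lemma congr_reading (R : relation aword) {RC : group_congruence R} t t' s :
  (forall l, l \in s -> ~~ lover l -> R (t (lid l)) (t' (lid l))) ->
  R (reading t s) (reading t' s).
Proof.
elim: s => [_|l s IH tt']; first by reflexivity.
rewrite -cat1s !reading_cat IH => [|x xs]; last by apply: tt'; rewrite inE xs orbT.
have [ol|ol] := boolP (lover l); last first.
  by rewrite !(reading_head _ ol) (tt' l) ?mem_head //; reflexivity.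
have l_tail : all lover [:: l] by rewrite /= ol.
by rewrite !(reading_tails _ l_tail); reflexivity.
Qed.

End Reading.

(* y is the meridian at the start of s; tc and hc give the meridians of the over-arcs
   as seen from the tails and from the heads. *)
Fixpoint strand_coloring (E : relation aword) (tc hc : nat -> aword) (y : aword)
    (s : seq letter) : Prop :=
  if s is l :: s' then
    if lover l then E (tc (lid l)) y /\ strand_coloring E tc hc y s'
    else strand_coloring E tc hc (conjw y (expw (hc (lid l)) (lsgn l))) s'
  else True.

Definition coloring E (d : gdiag) (t : nat -> aword) : Prop :=
  forall k, strand_coloring E t t [:: (k, true)] (strand d k).

Lemma strand_coloring_cat E tc hc y u v : strand_coloring E tc hc y (u ++ v) <->
  strand_coloring E tc hc y u /\ strand_coloring E tc hc (conjw y (reading hc u)) v.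
Proof.
elim: u y => [|l u IH] y; first by rewrite /= conjw0; split=> [|[]].
rewrite -[in reading _ _]cat1s reading_cat conjw_cat /=.
have [ol|ol] := boolP (lover l); last by rewrite reading_head //; apply: IH.
rewrite reading_tails /= ?ol // conjw0.
by split=> [[yl /IH[]]|[[yl yu] yv]]; do ?split; rewrite // IH.
Qed.

Lemma strand_coloringP E tc hc y s : strand_coloring E tc hc y s <->
  forall u l v, s = u ++ l :: v -> lover l -> E (tc (lid l)) (conjw y (reading hc u)).
Proof.
split=> [col u l v s_eq ol|]; first by move: col; rewrite s_eq strand_coloring_cat /= ol => -[_ []].
elim: s y => //= l s IH y tails_s.
have rec y' : conjw y (reading hc [:: l]) = y' -> strand_coloring E tc hc y' s.
  move=> <-; apply: IH => u x v s_eq ox; rewrite -conjw_cat -reading_cat.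
  by apply: (tails_s (l :: u) x v) => //; rewrite s_eq.
case: ifP => ol; last by apply: rec; rewrite reading_head ?ol.
split; last by apply: rec; rewrite reading_tails /= ?ol // conjw0.
by have := tails_s [::] l s erefl ol; rewrite conjw0.
Qed.

Lemma strand_coloring_filter E tc hc y s (P : pred letter) :
  (forall l, l \in s -> ~~ lover l -> P l) ->
  strand_coloring E tc hc y s -> strand_coloring E tc hc y (filter P s).
Proof.
elim: s y => //= l s IH y heads_P; have [ol|ol] := boolP (lover l).
  case=> yl /IH col_s; have {}col_s : strand_coloring E tc hc y (filter P s).
    by apply: col_s => x xs; apply: heads_P; rewrite inE xs orbT.
  by case: ifP => _ //=; rewrite ol.
rewrite heads_P ?mem_head //= (negPf ol); apply: IH => x xs.
by apply: heads_P; rewrite inE xs orbT.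
Qed.

Lemma strand_coloring_congr (R : relation aword) {RC : group_congruence R} tc hc tc' hc' y y' s :
  R y y' ->
  (forall l, l \in s -> lover l -> R (tc (lid l)) (tc' (lid l))) ->
  (forall l, l \in s -> ~~ lover l -> R (hc (lid l)) (hc' (lid l))) ->
  strand_coloring R tc hc y s -> strand_coloring R tc' hc' y' s.
Proof.
move=> yy tt hh /strand_coloringP col; apply/strand_coloringP => u l v s_eq ol.
rewrite -tt ?s_eq ?mem_cat ?mem_head ?orbT // (col u l v s_eq ol) yy.
rewrite (congr_reading (t' := hc')); first by reflexivity.
by move=> x xu; apply: hh; rewrite s_eq mem_cat xu.
Qed.

Lemma eq_strand_coloring E tc hc tc' hc' y s :
  (forall l, l \in s -> lover l -> tc (lid l) = tc' (lid l)) ->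
  (forall l, l \in s -> ~~ lover l -> hc (lid l) = hc' (lid l)) ->
  strand_coloring E tc hc y s -> strand_coloring E tc' hc' y s.
Proof.
move=> tt hh /strand_coloringP col; apply/strand_coloringP => u l v s_eq ol.
rewrite -tt // ?s_eq ?mem_cat ?mem_head ?orbT // -(eq_reading (t := hc)); first exact: col s_eq ol.
by move=> x xu; apply: hh; rewrite s_eq mem_cat xu.
Qed.

Lemma strand_coloring_heads E tc hc y s : all (predC lover) s -> strand_coloring E tc hc y s.
Proof. by elim: s y => //= l s IH y /andP[/negPf -> /IH]. Qed.

Lemma strand_coloring_tails E tc hc y s : all lover s ->
  (forall l, l \in s -> E (tc (lid l)) y) -> strand_coloring E tc hc y s.
Proof.
elim: s => //= l s IH /andP[-> s_tails] s_y; split; first exact/s_y/mem_head.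
by apply: IH => // x xs; apply: s_y; rewrite inE xs orbT.
Qed.

Lemma strand_coloring_replace_heads (R : relation aword) {RC : group_congruence R}
    tc hc hc' y u w w' v :
  all (predC lover) w -> all (predC lover) w' ->
  (forall l, l \in u ++ v -> ~~ lover l -> R (hc (lid l)) (hc' (lid l))) ->
  R (conjw y (reading hc (u ++ w))) (conjw y (reading hc' (u ++ w'))) ->
  strand_coloring R tc hc y (u ++ w ++ v) -> strand_coloring R tc hc' y (u ++ w' ++ v).
Proof.
move=> w_heads w'_heads hh ww'; rewrite !catA.
move=> /strand_coloring_cat[/strand_coloring_cat[col_u _] col_v].
apply/strand_coloring_cat; split; last first.
  apply: strand_coloring_congr col_v => // l lv; first by reflexivity.
  by apply: hh; rewrite mem_cat lv orbT.
apply/strand_coloring_cat; split; last exact: strand_coloring_heads.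
apply: strand_coloring_congr col_u => // [|l _ _|l lu]; try by reflexivity.
by apply: hh; rewrite mem_cat lu.
Qed.

Lemma coloring_tail E d t k u l v : coloring E d t -> strand d k = u ++ l :: v -> lover l ->
  E (t (lid l)) (conjw [:: (k, true)] (reading t u)).
Proof. by move=> col dk; move/strand_coloringP: (col k); apply; apply: dk. Qed.

Lemma coloring_sub (E E' : relation aword) d t : (forall u v, E u v -> E' u v) ->
  coloring E d t -> coloring E' d t.
Proof.
move=> EE' col k; apply/strand_coloringP => u l v dk ol; apply: EE'.
exact: coloring_tail col dk ol.
Qed.

Lemma coloring_tail_block E d t j u w v x : coloring E d t ->
  strand d j = u ++ w ++ v -> all lover w -> x \in w ->
  E (t (lid x)) (conjw [:: (j, true)] (reading t u)).
Proof.
move=> col + w_tails xw; case/splitPr: xw w_tails => w1 w2.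
rewrite all_cat /= -!catA catA => /and3P[w1_tails ox _] dj.
by have := coloring_tail col dj ox; rewrite reading_cat (reading_tails _ w1_tails) cats0.
Qed.

Local Notation magnus_coloring n q := (coloring (magnus_eq n q predT)).

Lemma magnus_coloring_sub n q q' d t : q' <= q ->
  magnus_coloring n q d t -> magnus_coloring n q' d t.
Proof. by move=> qq; apply: coloring_sub => u v; apply: magnus_eq_sub. Qed.

Lemma magnus_coloring_unique m n q d t t' l : wf m d ->
  magnus_coloring n q d t -> magnus_coloring n q d t' -> l \in flatten d ->
  magnus_eq n q predT (t (lid l)) (t' (lid l)).
Proof.
move=> wf_d; elim: q l => [|q IH] l col col' ld; first by move=> M _; rewrite ltn0.
move: l ld; apply: (wf_tail_ind wf_d (P := fun c => magnus_eq _ _ _ (t c) (t' c))) => k l lk ol.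
case/splitPr dk : _ / lk => [u v].
rewrite (coloring_tail col dk ol) (coloring_tail col' dk ol).
apply: magnus_eq_conj_succ; apply: congr_reading => x xu _.
apply: IH; first exact: magnus_coloring_sub col; first exact: magnus_coloring_sub col'.
by apply: (@mem_nth_flatten _ _ _ k); rewrite dk mem_cat xu.
Qed.

(** ** Existence of colorings *)

Definition arc_color (t : nat -> aword) (d : gdiag) (g : gen) : aword :=
  conjw [:: (g.1, true)] (reading t (take g.2 (heads (strand d g.1)))).

Lemma arc_color_over m d t k u l v : wf m d -> strand d k = u ++ l :: v -> lover l ->
  arc_color t d (over_arc d (lid l)) = conjw [:: (k, true)] (reading t u).
Proof.
move=> wf_d dk ol; rewrite (over_arcE wf_d dk ol) /arc_color dk /heads filter_cat.
by rewrite take_size_cat // reading_heads.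
Qed.

Lemma arc_color_succ t d i j l : j < size (heads (strand d i)) ->
  l = nth l (heads (strand d i)) j ->
  arc_color t d (i, j.+1) = conjw (arc_color t d (i, j)) (expw (t (lid l)) (lsgn l)).
Proof.
move=> j_lt l_nth; have ol : ~~ lover l.
  by have := mem_nth l j_lt; rewrite -l_nth mem_filter => /andP[].
by rewrite /arc_color /= (take_nth l) // -l_nth -cats1 reading_cat reading_head // conjw_cat.
Qed.

Lemma magnus_arc_color_succ n q t t' d g : (forall c, magnus_eq n q predT (t c) (t' c)) ->
  magnus_eq n q.+1 predT (arc_color t d g) (arc_color t' d g).
Proof. by move=> tt'; apply: magnus_eq_conj_succ; apply: congr_reading. Qed.

Fixpoint approx_coloring (d : gdiag) (r : nat) : nat -> aword :=
  if r is r'.+1 then fun c => arc_color (approx_coloring d r') d (over_arc d c) else fun=> [::].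

Lemma approx_coloring_stable n d r c :
  magnus_eq n r predT (approx_coloring d r c) (approx_coloring d r.+1 c).
Proof.
elim: r c => [|r IH] c; first by move=> M _; rewrite ltn0.
exact: magnus_arc_color_succ.
Qed.

Lemma approx_coloringP m n d q : wf m d -> magnus_coloring n q d (approx_coloring d q).
Proof.
move=> wf_d k; apply/strand_coloringP => u l v dk ol.
by rewrite -(arc_color_over _ wf_d dk ol); apply: approx_coloring_stable.
Qed.

Lemma arc_color_over_arc m n q d t l : wf m d -> magnus_coloring n q d t -> l \in flatten d ->
  magnus_eq n q predT (arc_color t d (over_arc d (lid l))) (t (lid l)).
Proof.
move=> wf_d col; pose P c := magnus_eq n q predT (arc_color t d (over_arc d c)) (t c).
move: l; apply: (wf_tail_ind wf_d (P := P)) => k x xk ox; case/splitPr dk : _ / xk => [u v].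
by rewrite /P (arc_color_over _ wf_d dk ox) (coloring_tail col dk ox).
Qed.

(* Moving the tail x in front of the head h changes the meridian of its arrow, as
   seen from the tails, to that of the arc before h. *)
Lemma strand_coloring_tail_past_head E m d i u h x v t : Reflexive E -> wf m d ->
  strand d i = u ++ [:: h; x] ++ v -> ~~ lover h -> lover x -> coloring E d t ->
  forall k, strand_coloring E [eta t with lid x |-> conjw [:: (i, true)] (reading t u)] t
    [:: (k, true)] (strand (set_strand d i (u ++ [:: x; h] ++ v)) k).
Proof.
move=> E_refl wf_d di oh ox col k; set t' := [eta t with _ |-> _].
have xi : x \in strand d i by rewrite di mem_cat !inE eqxx !orbT.
have tt' (s : seq letter) j : {subset s <= strand d j} -> x \notin s ->
    forall l, l \in s -> lover l -> t (lid l) = t' (lid l).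
  move=> sj xs l ls ol; rewrite /t' /= ifN //.
  apply: (wf_lid_neq wf_d (mem_nth_flatten xi) (mem_nth_flatten (sj l ls))); first by rewrite ol.
  by apply: contraNneq xs => <-.
rewrite strand_set; case: eqVneq => [->|ki]; last first.
  apply: eq_strand_coloring (col k) => //; apply: (tt' (strand d k) k) => //.
  by apply: contra ki => xk; apply/eqP/(uniq_flatten_nth (wf_uniq wf_d) xk xi).
have [xu xv] : x \notin u /\ x \notin v.
  apply: (@uniq_cat_mem _ u [:: h; x]); last by rewrite !inE eqxx orbT.
  by rewrite -di; apply: wf_uniq_strand wf_d i.
have := col i; rewrite di => /strand_coloring_cat[col_u /= +]; rewrite ox (negPf oh) => -[_ col_v].
apply/strand_coloring_cat; split; last rewrite /= ox (negPf oh) /t' /= eqxx; last split=> //.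
  apply: eq_strand_coloring col_u => //; apply: (tt' u i) => // l lu.
  by rewrite di mem_cat lu.
apply: eq_strand_coloring col_v => //; apply: (tt' v i) => // l lv.
by rewrite di !mem_cat lv !orbT.
Qed.

(** * Milnor numbers *)

Definition word_color (t : nat -> aword) (d : gdiag) (w : word) : aword :=
  flatten [seq expw (arc_color t d x.1) x.2 | x <- w].

Lemma word_color_cat t d u v : word_color t d (u ++ v) = word_color t d u ++ word_color t d v.
Proof. by rewrite /word_color map_cat flatten_cat. Qed.

Lemma word_color_letter t d x : word_color t d [:: x] = expw (arc_color t d x.1) x.2.
Proof. exact: cats0. Qed.

Lemma word_color_invw t d (w : word) : word_color t d (invw w) = invw (word_color t d w).
Proof.
elim: w => [//|x w IH]; rewrite -cat1s word_color_cat !invw_cat word_color_cat IH.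
by rewrite !word_color_letter /= invw_expw.
Qed.

Lemma arc_color_first t d i : arc_color t d (i, 0) = [:: (i, true)].
Proof. by rewrite /arc_color take0 conjw0. Qed.

Lemma word_color_emb t d lam : word_color t d (emb lam) = lam.
Proof.
elim: lam => [//|[j e] lam IH]; rewrite /= -cat1s word_color_cat IH word_color_letter.
by rewrite arc_color_first expw_letter; case: e.
Qed.

Lemma word_color_comm n t d k w : is_comm k w -> magnus_eq n k predT (word_color t d w) [::].
Proof.
elim=> {k w} [w|k w v _ IH].
  by case=> //= _ _ _; rewrite rcoef_nil.
rewrite -[winv w]/(invw w) -[winv v]/(invw v) !word_color_cat !word_color_invw.
rewrite (magnus_eq_comm_succ _ IH) catA -invw_cat; exact: congr_mulVw.
Qed.

Lemma word_color_u_word m n q d t i : wf m d -> magnus_coloring n q d t ->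
  magnus_eq n q predT (word_color t d (u_word d i)) (reading t (strand d i)).
Proof.
move=> wf_d col; rewrite /word_color /u_word -map_comp.
rewrite -[flatten _]/(reading (fun c => arc_color t d (over_arc d c)) (strand d i)).
by apply: congr_reading => l li _; apply: arc_color_over_arc wf_d col (mem_nth_flatten li).
Qed.

Lemma word_color_relator m n q d t r : wf m d -> magnus_coloring n q d t -> is_relator d r ->
  magnus_eq n q predT (word_color t d r) [::].
Proof.
move=> wf_d col [i [j [_ [j_lt ->]]]].
have {}j_lt : j < size (heads (strand d i)) by rewrite size_map in j_lt.
pose l := nth (0, true, true) (heads (strand d i)) j.
have ld : l \in flatten d.
  by have := mem_nth (0, true, true) j_lt; rewrite mem_filter => /andP[_ /mem_nth_flatten].
rewrite (nth_map (0, true, true)) // -/l -[winv _]/(invw _) -[[:: (_, true); _]]cat1s.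
rewrite !word_color_cat word_color_invw !word_color_letter /= (arc_color_over_arc wf_d col ld).
rewrite (@arc_color_succ _ _ _ _ l) //; last by apply: set_nth_default.
by apply: congr_mulVw.
Qed.

Lemma word_color_congr m n q d t w w' : wf m d -> magnus_coloring n q d t ->
  congr_q d q w w' -> magnus_eq n q predT (word_color t d w) (word_color t d w').
Proof.
move=> wf_d col; elim=> {w w'} [w w' step|w|w w' _ ww'|u v w _ uv _ vw] //; last 2 first.
- by symmetry.
- by rewrite uv.
have [u [r [v [-> -> r1]]]] : exists u r v, [/\ w = u ++ r ++ v, w' = u ++ v &
    magnus_eq n q predT (word_color t d r) [::]].
  case: step => {w w'} [u v x|u v r rel|u v r cm];
    [exists u, [:: x; invl x], v | exists u, r, v ..]; split=> //.
  - rewrite -[_ :: _]/([:: x] ++ [:: invl x]) word_color_cat !word_color_letter -invw_expw.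
    exact: congr_mulwV.
  - exact: word_color_relator wf_d col rel.
  - exact: word_color_comm cm.
by rewrite !word_color_cat r1.
Qed.

Lemma word_color_longitude m n q d t i : wf m d -> magnus_coloring n q d t ->
  magnus_eq n q (predC1 i) (word_color t d (longitude d i)) (reading t (strand d i)).
Proof.
move=> wf_d col; have self_arcs k e :
    magnus_eq n q (predC1 i) (word_color t d (nseq k (i, 0, e))) [::].
  elim: k => [//|k IH]; rewrite -add1n nseqD word_color_cat IH word_color_letter arc_color_first.
  by rewrite expw_letter magnus_eq_letter //= eqxx.
have strand_eq := magnus_eq_sub (leqnn q) _ (word_color_u_word i wf_d col).
by rewrite /longitude word_color_cat; case: ifP => _; rewrite self_arcs strand_eq.
Qed.

Definition mu_index m (I : seq 'I_m) : nat := last 0 (map val I).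
Definition mu_seq m (I : seq 'I_m) : seq nat := take (size I).-1 (map val I).

Lemma map_val_rcons m (I : seq 'I_m) : I != [::] ->
  map val I = rcons (mu_seq I) (mu_index I).
Proof.
rewrite /mu_seq /mu_index; case/lastP: I => [//|I i] _.
by rewrite size_rcons map_rcons last_rcons -[in take _ _]cats1 take_size_cat ?size_map.
Qed.

Lemma mu_seq_uniq m (I : seq 'I_m) : I != [::] -> uniq I ->
  [/\ uniq (mu_seq I), size (mu_seq I) < size I & all (predC1 (mu_index I)) (mu_seq I)].
Proof.
move=> /map_val_rcons I_eq; rewrite -(map_inj_uniq val_inj) I_eq rcons_uniq => /andP[iI ->].
split=> //; first by rewrite -(size_map val I) I_eq size_rcons.
by apply/allP => k kI; apply: contraNneq iI => <-.
Qed.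

Lemma mu_index_lt m (I : seq 'I_m) : I != [::] -> mu_index I < m.
Proof.
move=> /map_val_rcons I_eq; have : mu_index I \in map val I by rewrite I_eq mem_rcons mem_head.
by case/mapP=> i _ ->; apply: ltn_ord.
Qed.

Lemma mu_seq_exists m i (M : seq nat) : i < m -> uniq (rcons M i) -> all (gtn m) M ->
  exists I : seq 'I_m, [/\ I != [::], uniq I, mu_index I = i & mu_seq I = M].
Proof.
case: m => [//|m] im uM M_lt; pose I : seq 'I_m.+1 := map inord (rcons M i).
have I_eq : map val I = rcons M i.
  rewrite -map_comp -[RHS]map_id; apply/eq_in_map => k; rewrite mem_rcons inE.
  by case/predU1P=> [->|/(allP M_lt) kM]; rewrite /= inordK.
have I0 : I != [::] by rewrite -size_eq0 size_map size_rcons.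
have := map_val_rcons I0; rewrite I_eq => /rcons_inj[-> ->].
by exists I; split=> //; apply: (@map_uniq _ _ val); rewrite I_eq.
Qed.

Lemma IsMuRep_reading (m n : nat) d t (I : seq 'I_m) c : wf m d -> I != [::] -> uniq I ->
  magnus_coloring n (size I) d t -> IsMuRep d I c ->
  (c = rcoef (reading t (strand d (mu_index I))) (mu_seq I) %[mod n])%Z.
Proof.
move=> wf_d I0 uI col [r [lam [Ir [_ [lam_long ->]]]]].
have [uM sM aM] := mu_seq_uniq I0 uI; rewrite -/(mu_seq I) mcoef_rcoef //.
have col_r := approx_coloringP n r wf_d; set t0 := approx_coloring d r in col_r.
have lam_t0 : magnus_eq n r (predC1 (mu_index I)) lam (reading t0 (strand d (mu_index I))).
  rewrite -(word_color_longitude wf_d col_r) -(word_color_emb t0 d lam).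
  by symmetry; apply: magnus_eq_sub (word_color_congr wf_d col_r lam_long).
rewrite (lam_t0 _ uM (leq_trans sM Ir) aM).
have t0_t : magnus_eq n (size I) predT (reading t0 (strand d (mu_index I)))
    (reading t (strand d (mu_index I))).
  apply: congr_reading => l li _; apply: (magnus_coloring_unique wf_d) (mem_nth_flatten li) => //.
  exact: magnus_coloring_sub Ir col_r.
by rewrite t0_t // all_predT.
Qed.

(** ** Longitudes as words in the first arcs *)

#[export] Instance congr_q_group_congruence d q : group_congruence (congr_q d q).
Proof.
apply: group_congruence_closure => [a b _ _ [u v x|u v r rel|u v r cm]|x].
- by have := ws_free d q (a ++ u) (v ++ b) x; rewrite -!catA.
- by have := ws_rel q (a ++ u) (v ++ b) rel; rewrite -!catA.
- by have := ws_comm d (a ++ u) (v ++ b) cm; rewrite -!catA.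
- exact: (@ws_free d q [::] [::] x).
Qed.

Lemma congr_q_relator d q r : is_relator d r -> congr_q d q r [::].
Proof. by move=> rel; apply: rst_step; have := ws_rel q [::] [::] rel; rewrite cats0. Qed.

Lemma congr_q_comm d q r : is_comm q r -> congr_q d q r [::].
Proof. by move=> cm; apply: rst_step; have := ws_comm d [::] [::] cm; rewrite cats0. Qed.

Lemma congr_q_conj_comm d q (b r : word) : is_comm q r -> congr_q d q.+1 (conjw b r) b.
Proof.
move=> cm; have := congr_q_comm d (commS (invw b) cm).
rewrite -[winv r]/(invw r) -[winv _]/(invw (invw b)) invwK => comm1.
have : congr_q d q.+1 (conjw b r ++ (invw b ++ b)) b.
  have -> : conjw b r ++ (invw b ++ b) = (invw r ++ b ++ r ++ invw b) ++ b.
    by rewrite /conjw -!catA.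
  by rewrite comm1; reflexivity.
by rewrite congr_mulVw cats0.
Qed.

Lemma congr_q_conj_succ d q (a w w' : word) : congr_q d q w w' ->
  congr_q d q.+1 (conjw a w) (conjw a w').
Proof.
elim=> {w w'} [w w' step|w|w w' _ ww'|u v w _ uv _ vw]; last 3 first.
- by reflexivity.
- by symmetry.
- by rewrite uv.
have [u [r [v [-> -> r1]]]] : exists u r v, [/\ w = u ++ r ++ v, w' = u ++ v &
    forall b, congr_q d q.+1 (conjw b r) b].
  case: step => {w w'} [u v x|u v r rel|u v r cm];
    [exists u, [:: x; invl x], v | exists u, r, v ..]; split=> // b.
  - by rewrite (congr_cancel x) conjw0; reflexivity.
  - by rewrite (congr_q_relator _ rel) conjw0; reflexivity.
  - exact: congr_q_conj_comm.
by rewrite !conjw_cat r1; reflexivity.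
Qed.

Section Representability.
Variables (m : nat) (d : gdiag).
Hypothesis wf_d : wf m d.

Definition representable q (w : word) : Prop :=
  exists2 lam, word_in (gtn m) lam & congr_q d q w (emb lam).

Lemma emb_cat u v : emb (u ++ v) = emb u ++ emb v.
Proof. exact: map_cat. Qed.

Lemma emb_expw u e : emb (expw u e) = expw (emb u) e.
Proof. by case: e => //=; rewrite /emb /invw map_rev -!map_comp. Qed.

Lemma emb_conjw u h : emb (conjw u h) = conjw (emb u) (emb h).
Proof. by rewrite /conjw !emb_cat (emb_expw _ false). Qed.

Lemma word_in_expw D w e : word_in D (expw w e) = word_in D w.
Proof. by case: e => //=; apply: word_in_invw. Qed.

Lemma representable_cat q u v : representable q u -> representable q v ->
  representable q (u ++ v).
Proof.
move=> [lu lu_in ulu] [lv lv_in vlv]; exists (lu ++ lv); first by rewrite word_in_cat lu_in.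
by rewrite emb_cat ulu vlv; reflexivity.
Qed.

Lemma representable_expw q u e : representable q u -> representable q (expw u e).
Proof.
move=> [lu lu_in ulu]; exists (expw lu e); first by rewrite word_in_expw.
by rewrite emb_expw ulu; reflexivity.
Qed.

Definition is_arc (g : gen) : bool := (g.1 < m) && (g.2 <= size (u_word d g.1)).

Lemma u_word_arcs i : all (fun x => is_arc x.1) (u_word d i).
Proof.
apply/allP => _ /mapP[l + ->]; rewrite mem_filter => /andP[ol /mem_nth_flatten ld] /=.
have /flatten_nthP[k] := wf_other_end wf_d ld; set l' := other_end l => l'k.
have k_lt : k < m by rewrite -(wf_size wf_d) (mem_nth_lt l'k).
case/splitPr dk : _ / l'k => [u v]; have := over_arcE wf_d dk ol; rewrite /lid /= => ->.
rewrite /is_arc /= k_lt size_map dk filter_cat size_cat; exact: leq_addr.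
Qed.

Lemma representable_of_arcs q w : (forall g, is_arc g -> representable q [:: (g, true)]) ->
  all (fun x => is_arc x.1) w -> representable q w.
Proof.
move=> arcs; elim: w => [|[g e] w IH] /=; first by exists [::]; last by reflexivity.
case/andP=> g_arc /IH; rewrite -cat1s; apply: representable_cat.
by have := representable_expw e (arcs g g_arc); rewrite expw_letter; case: e.
Qed.

Lemma congr_q_arc q i k : i < m -> k <= size (u_word d i) ->
  congr_q d q [:: ((i, k), true)] (conjw [:: ((i, 0), true)] (take k (u_word d i))).
Proof.
move=> im; elim: k => [|k IH] k_le; first by rewrite take0 conjw0; reflexivity.
rewrite (take_nth dfltg) // -cats1 conjw_cat -IH 1?ltnW //.
set a := [:: ((i, k.+1), true)]; set U := [:: nth _ _ _].
have rel : is_relator d (invw a ++ conjw [:: ((i, k), true)] U).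
  by exists i, k; rewrite (wf_size wf_d).
have : congr_q d q (a ++ invw a ++ conjw [:: ((i, k), true)] U) a.
  by rewrite (congr_q_relator q rel) cats0; reflexivity.
by rewrite catA congr_mulwV => <-; reflexivity.
Qed.

Lemma arc_representable q g : 0 < q -> is_arc g -> representable q [:: (g, true)].
Proof.
elim: q g => [//|q IH] [i k] _ /andP[/= im k_le].
have [->|q0] := posnP q; first by exists [::] => //; apply/congr_q_comm/comm1.
have [|lam lam_in lamP] := @representable_of_arcs q (take k (u_word d i)) (fun g => IH g q0).
  by apply/allP => x /mem_take; apply: (allP (u_word_arcs i)).
exists (conjw [:: (i, true)] lam).
  by rewrite word_in_conjw lam_in /word_in /= im.
rewrite (congr_q_arc _ im k_le) (congr_q_conj_succ _ lamP) emb_conjw.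
by reflexivity.
Qed.

Lemma longitude_representable q i : 0 < q -> i < m -> representable q (longitude d i).
Proof.
move=> q0 im; apply: representable_of_arcs => [g|]; first exact: arc_representable.
rewrite /longitude all_cat u_word_arcs andbT.
by case: ifP => _; rewrite all_nseq /is_arc /= im orbT.
Qed.

Lemma mu_w_reading (n : nat) t (I : seq 'I_m) : I != [::] -> uniq I ->
  magnus_coloring n (size I) d t ->
  (mu_w d I = rcoef (reading t (strand d (mu_index I))) (mu_seq I) %[mod n])%Z.
Proof.
move=> I0 uI col; apply: IsMuRep_reading => //; apply: epsilon_spec.
have I_gt0 : 0 < size I by rewrite lt0n size_eq0.
have [lam lam_in lamP] := longitude_representable I_gt0 (mu_index_lt I0).
by exists (mcoef lam (mu_seq I)), (size I), lam.
Qed.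

End Representability.

(** * Invariance of the longitudes *)

(* Discarding X_i in the i-th longitude makes the normalizing power of a_{i1},
   and any self-crossing met by strand i, invisible. *)
Definition same_longitudes n d d' := forall q t t',
  magnus_coloring n q d t -> magnus_coloring n q d' t' ->
  forall i, magnus_eq n q (predC1 i) (reading t (strand d i)) (reading t' (strand d' i)).

Section Invariance.
Variables (m n : nat).

Lemma same_longitudes_sym d d' : same_longitudes n d d' -> same_longitudes n d' d.
Proof. by move=> dd' q t t' col col' i; symmetry; apply: dd'. Qed.

Lemma same_longitudes_trans d d' d'' : wf m d' ->
  same_longitudes n d d' -> same_longitudes n d' d'' -> same_longitudes n d d''.
Proof.
move=> wf_d' dd' dd'' q t t'' col col'' i; have col' := approx_coloringP n q wf_d'.
by rewrite (dd' _ _ _ col col') (dd'' _ _ _ col' col'').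
Qed.

Lemma same_longitudes_transport d d' : wf m d ->
  (forall q t', magnus_coloring n q d' t' -> exists2 t, magnus_coloring n q d t &
    forall i, magnus_eq n q (predC1 i) (reading t (strand d i)) (reading t' (strand d' i))) ->
  same_longitudes n d d'.
Proof.
move=> wf_d transport q t t' col col' i; have [t1 col1 <-] := transport q t' col'.
apply: congr_reading => l li _; apply: magnus_eq_sub (leqnn q) (fun _ _ => isT) _.
exact: magnus_coloring_unique wf_d col col1 (mem_nth_flatten li).
Qed.

Lemma same_longitudes_del d C i u w v : wf m d -> strand d i = u ++ w ++ v ->
  all (predC lover) w -> map lid w =i C ->
  (forall q t, magnus_coloring n q d t ->
     let y := conjw [:: (i, true)] (reading t u) in
     magnus_eq n q predT (conjw y (reading t w)) y /\
     magnus_eq n q (predC1 i) (reading t w) [::]) ->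
  same_longitudes n (del C d) d.
Proof.
move=> wf_d di w_heads wC w1.
have C_heads l : l \in flatten d -> ~~ lover l -> lid l \in C -> l \in w.
  move=> ld ol; rewrite -wC => /mapP[x xw lx]; suff -> : l = x by [].
  have xi : x \in strand d i by rewrite di !mem_cat xw orbT.
  apply: (wf_endpoint_inj wf_d ld (mem_nth_flatten xi)).
  by rewrite /endpoint lx (negPf ol) (negPf (allP w_heads x xw)).
have us := wf_uniq_strand wf_d i; rewrite di in us.
have keep k (s : seq letter) : {subset s <= strand d k} -> (forall l, l \in w -> l \notin s) ->
    forall l, l \in s -> ~~ lover l -> lid l \notin C.
  move=> sk sw l ls ol; apply/negP => /(C_heads l (mem_nth_flatten (sk l ls)) ol)/sw.
  by rewrite ls.
have keep_u : forall l, l \in u -> ~~ lover l -> lid l \notin C.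
  apply: (keep i u) => [l lu|l lw]; first by rewrite di mem_cat lu.
  by have [] := uniq_cat_mem us lw.
have keep_v : forall l, l \in v -> ~~ lover l -> lid l \notin C.
  apply: (keep i v) => [l lv|l lw]; first by rewrite di !mem_cat lv !orbT.
  by have [] := uniq_cat_mem us lw.
have keep_other k : k != i -> forall l, l \in strand d k -> ~~ lover l -> lid l \notin C.
  move=> ki; apply: (keep k (strand d k)) => // l lw; apply: contra ki => lk; apply/eqP.
  by apply: uniq_flatten_nth (wf_uniq wf_d) lk _; rewrite di !mem_cat lw orbT.
have w_gone : [seq l <- w | lid l \notin C] = [::].
  apply/eqP; rewrite -[_ == _]negbK -has_filter; apply/hasPn => l lw.
  by rewrite negbK -wC map_f.
apply: same_longitudes_transport => [|q t col]; first exact: wf_del.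
have [yw w_off_i] := w1 q t col.
exists t => k; rewrite strand_del; have [->|ki] := eqVneq k i.
- rewrite di !filter_cat w_gone -filter_cat; apply: strand_coloring_filter.
    by move=> l; rewrite mem_cat => /orP[]; [apply: keep_u | apply: keep_v].
  have := col i; rewrite di; apply: (strand_coloring_replace_heads (w' := [::])) => //.
  by rewrite cats0 reading_cat conjw_cat yw.
- exact: strand_coloring_filter (keep_other k ki) (col k).
- by rewrite di !filter_cat w_gone !reading_cat !reading_filter // w_off_i.
- by rewrite reading_filter //; apply: keep_other.
Qed.

Lemma same_longitudes_del_trivial d C i u w v : wf m d -> strand d i = u ++ w ++ v ->
  all (predC lover) w -> map lid w =i C ->
  (forall q t, magnus_coloring n q d t -> magnus_eq n q predT (reading t w) [::]) ->
  same_longitudes n (del C d) d.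
Proof.
move=> wf_d di w_heads wC w1; apply: (same_longitudes_del wf_d di) => // q t col y.
split; first by rewrite (w1 q t col) conjw0.
exact: magnus_eq_sub (leqnn q) (fun _ _ => isT) (w1 q t col).
Qed.

Lemma same_longitudes_self_arrow d i c : wf m d -> self_arrow d i c ->
  same_longitudes n (del [:: c] d) d.
Proof.
move=> wf_d /self_arrowP[x [h [xi hi [xc ox] [hc oh]]]].
case/splitPr di : _ / hi => [u v]; apply: (same_longitudes_del (w := [:: h]) wf_d di).
- by rewrite /= oh.
- by move=> k; rewrite !inE hc.
move=> q t col y; rewrite reading_head ?oh // hc.
case/splitPr dx : _ / xi => [p r].
have tc : magnus_eq n q predT (t c) (conjw [:: (i, true)] (reading t p)).
  by rewrite -xc; apply: (coloring_tail col dx).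
have g_off_i D : ~~ D i -> magnus_eq n q D (expw (t c) (lsgn h)) [::].
  move=> Di; rewrite (magnus_eq_sub (leqnn q) _ tc) // expw_conjw expw_letter.
  exact: magnus_eq_conj_letter.
split; last by apply: g_off_i; rewrite /= eqxx.
apply: (congr_conjw_commute (R := magnus_eq n q predT)); apply: (magnus_eq_commute_off (k := i)).
  by apply: magnus_eq_conj_letter; rewrite /= eqxx.
by apply: g_off_i; rewrite /= eqxx.
Qed.

Lemma same_longitudes_sv d d' : wf m d' -> sv_step d d' -> same_longitudes n d d'.
Proof.
move=> wf_d' /(sv_stepP _ wf_d')[c [i [-> self_c]]].
exact: same_longitudes_self_arrow self_c.
Qed.

Lemma same_longitudes_R2 d d' : wf m d' -> R2_step d d' -> same_longitudes n d d'.
Proof.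
move=> wf_d'; suff R2_ordered c c' e : d = del [:: c; c'] d' ->
    has_block d' [:: Tl c e; Tl c' (~~ e)] \/ has_block d' [:: Tl c' (~~ e); Tl c e] ->
    has_block d' [:: Hl c e; Hl c' (~~ e)] -> same_longitudes n d d'.
  case=> c [c' [e [d_eq [tails [heads|heads]]]]]; first exact: R2_ordered tails heads.
  apply: (R2_ordered c' c (~~ e)); rewrite ?negbK //; last by case: tails; [right | left].
  by rewrite d_eq; apply: eq_map => s; apply: eq_filter => l; rewrite !inE orbC.
move=> -> tails [i [u [v di]]].
have [j [p same_tails]] : exists j p, forall E t, coloring E d' t ->
    E (t c) (conjw [:: (j, true)] (reading t p)) /\ E (t c') (conjw [:: (j, true)] (reading t p)).
  case: tails => [] [j [p [s dj]]]; exists j, p => E t col;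
    by split; [apply: (coloring_tail_block (x := Tl c e) col dj) |
               apply: (coloring_tail_block (x := Tl c' (~~ e)) col dj)]; rewrite // !inE eqxx ?orbT.
apply: (same_longitudes_del_trivial wf_d' di) => // q t col; have [tc tc'] := same_tails _ t col.
rewrite -cat1s reading_cat !reading_head // /lid /lsgn /= tc tc' -invw_expw.
exact: congr_mulwV.
Qed.

Lemma reading_constant_heads (R : relation aword) {RC : group_congruence R} t s z e :
  all (fun l => ~~ lover l && (lsgn l == e)) s -> (forall l, l \in s -> R (t (lid l)) z) ->
  R (reading t s) (flatten (nseq (size s) (expw z e))).
Proof.
elim: s => [|l s IH] /=; first by reflexivity.
case/andP=> /andP[ol /eqP le] s_heads tz; rewrite -cat1s reading_cat reading_head // le.
rewrite IH // => [|x xs]; last by apply: tz; rewrite inE xs orbT.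
by rewrite (tz l) ?mem_head //; reflexivity.
Qed.

Lemma block_ids m' d C i b u w v : wf m' d -> uniq C -> strand d i = u ++ w ++ v ->
  size w = size C -> all (fun l => (lover l == b) && (lid l \in C)) w -> map lid w =i C.
Proof.
move=> wf_d uC di size_w w_C; have [|||_ //] := uniq_min_size (s1 := map lid w) (s2 := C).
- have := wf_uniq_endpoints wf_d i; rewrite di !map_cat uniq_catCA cat_uniq => /and3P[+ _ _].
  rewrite (_ : map endpoint w = [seq (c, b) | c <- map lid w]); first exact: map_uniq.
  rewrite -map_comp; apply/eq_in_map => l /(allP w_C)/andP[/eqP lb _].
  by rewrite /endpoint lb.
- by move=> _ /mapP[l /(allP w_C)/andP[_ lC] ->].
- by rewrite size_map size_w.
Qed.

Lemma same_longitudes_Vn d d' : wf m d' -> Vn_step n d d' -> same_longitudes n d d'.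
Proof.
move=> wf_d' [C [e [wo [wu [uC [size_C [-> [size_wo [size_wu [tails [heads]]]]]]]]]]].
move=> [[j [p [s dj]]] [i [u [v di]]]].
have wo_C : map lid wo =i C.
  apply: (block_ids wf_d' uC dj (b := true)); first by rewrite size_wo.
  by apply: sub_all tails => l /andP[/andP[-> ->]].
have wu_C : map lid wu =i C.
  apply: (block_ids wf_d' uC di (b := false)); first by rewrite size_wu.
  by apply: sub_all heads => l /andP[/andP[/negPf -> ->]].
apply: (same_longitudes_del_trivial wf_d' di) => // [|q t col].
  by apply: sub_all heads => l /andP[/andP[]].
set z := conjw [:: (j, true)] (reading t p).
have tz l : l \in wu -> magnus_eq n q predT (t (lid l)) z.
  move/(map_f lid); rewrite wu_C -wo_C => /mapP[x xwo ->].
  by apply: (coloring_tail_block col dj) xwo; apply: sub_all tails => y /andP[/andP[]].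
rewrite (reading_constant_heads (e := e) _ tz); last first.
  by apply: sub_all heads => l /andP[/andP[-> _] ->].
rewrite /z expw_conjw expw_letter congr_conjw_nseq size_wu.
have -> : flatten (nseq n [:: (j, true == e)]) = nseq n (j, true == e).
  by elim: (n) => //= k ->.
by rewrite magnus_eq_nseq; apply: congr_conj1w.
Qed.

Lemma same_longitudes_relabel f d : wf m d -> same_longitudes n d (relabel f d).
Proof.
move=> wf_d; apply: same_longitudes_transport => // q t col; exists (t \o f) => k.
  have := col k; rewrite nth_map_nil //; elim: (strand d k) [:: (k, true)] => //= l s IH y.
  by rewrite [lover (_, _, _)]/lover /=; case: ifP => _; [case=> ? /IH | move/IH].
by rewrite nth_map_nil // /reading /heads filter_map -map_comp.
Qed.

Lemma same_longitudes_OC d d' : wf m d -> OC_step d d' -> same_longitudes n d d'.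
Proof.
move=> wf_d [i [p [x [y [ox [oy [xy ->]]]]]]].
apply: same_longitudes_sym; apply: same_longitudes_transport => [|q t col].
  exact: wf_swap_at xy wf_d.
have [u [v [di _ ->]]] := at_pairP xy; exists t => k; rewrite strand_set; case: eqP => [->|_] //.
  have := col i; rewrite di => /strand_coloring_cat[col_u /=]; rewrite ox oy => -[yx [yy col_v]].
  by apply/strand_coloring_cat; rewrite /= ox oy.
by rewrite di !reading_cat !(reading_tails _ (s := [:: _; _])) //= ox oy.
Qed.

Lemma R3_block_reading q t t' a b c ea eb ec x y :
  [/\ x = Hl b eb, y = Hl c ec & ea = eb] \/ [/\ x = Hl c ec, y = Hl b eb & ea = ~~ eb] ->
  t' b = t b -> magnus_eq n q predT (t b) (t a) ->
  magnus_eq n q predT (expw (t c) ec) (conjw (expw (t' c) ec) (expw (t a) ea)) ->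
  magnus_eq n q predT (reading t [:: x; y]) (reading t' [:: y; x]).
Proof.
move=> xy t'b tba tc; have [x_head y_head] : ~~ lover x /\ ~~ lover y by case: xy => [] [-> ->].
rewrite -[[:: x; y]]cat1s -[[:: y; x]]cat1s !reading_cat !reading_head //.
case: xy => [] [-> -> ea_eb]; rewrite /lid /lsgn /= t'b tba tc.
  by rewrite -ea_eb congr_mul_conjw.
have -> : expw (t a) eb = invw (expw (t a) ea) by rewrite ea_eb invw_expw negbK.
exact: congr_conjw_mulV.
Qed.

Lemma R3_coloring q d t a b c ea eb ec i1 u1 v1 i2 u2 v2 x y
    (d1 := set_strand d i1 (u1 ++ [:: Tl c ec; Hl a ea] ++ v1))
    (d' := set_strand d1 i2 (u2 ++ [:: y; x] ++ v2)) :
  wf m d -> wf m d1 -> b != c -> magnus_coloring n q d t ->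
  magnus_eq n q predT (t b) (t a) ->
  strand d i1 = u1 ++ [:: Hl a ea; Tl c ec] ++ v1 -> strand d1 i2 = u2 ++ [:: x; y] ++ v2 ->
  [/\ x = Hl b eb, y = Hl c ec & ea = eb] \/ [/\ x = Hl c ec, y = Hl b eb & ea = ~~ eb] ->
  exists2 t', magnus_coloring n q d' t' &
    forall k, magnus_eq n q predT (reading t (strand d k)) (reading t' (strand d' k)).
Proof.
move=> wf_d wf_d1 bc col tba di1 d1i2 xy.
set Y := conjw [:: (i1, true)] (reading t u1); pose t' := [eta t with c |-> Y].
have half : forall k, strand_coloring (magnus_eq n q predT) t' t [:: (k, true)] (strand d1 k).
  exact: strand_coloring_tail_past_head wf_d di1 isT isT col.
have t'c : t' c = Y by rewrite /t' /= eqxx.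
have t'E k : k != c -> t' k = t k by rewrite /t' /= => /negPf ->.
clearbody t'.
have tc : magnus_eq n q predT (expw (t c) ec) (conjw (expw Y ec) (expw (t a) ea)).
  have := coloring_tail (u := u1 ++ [:: Hl a ea]) (l := Tl c ec) (v := v1) col.
  rewrite -catA => /(_ _ di1 isT) tc; rewrite (tc : magnus_eq _ _ _ (t c) _).
  by rewrite reading_cat conjw_cat reading_head // expw_conjw.
have [x_head y_head] : ~~ lover x /\ ~~ lover y by case: xy => [] [-> ->].
have block : magnus_eq n q predT (reading t [:: x; y]) (reading t' [:: y; x]).
  by apply: (R3_block_reading xy (t'E b bc) tba); rewrite t'c.
have Hc_block : Hl c ec \in [:: x; y] by case: xy => [] [-> -> _]; rewrite !inE eqxx ?orbT.
have Hc : Hl c ec \in flatten d1.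
  by apply: (@mem_nth_flatten _ _ _ i2); rewrite d1i2 !mem_cat Hc_block orbT.
have tt' k l : l \in strand d1 k -> l != Hl c ec -> ~~ lover l -> t (lid l) = t' (lid l).
  by move=> lk lc ol; rewrite t'E // (wf_lid_neq wf_d1 Hc (mem_nth_flatten lk) (negPf ol)).
have us := wf_uniq_strand wf_d1 i2; rewrite d1i2 in us.
have [cu cv] := uniq_cat_mem us Hc_block.
have tt'_u : forall l, l \in u2 -> ~~ lover l -> t (lid l) = t' (lid l).
  move=> l lu; apply: (tt' i2); first by rewrite d1i2 mem_cat lu.
  by apply: contraNneq cu => <-.
have tt'_v : forall l, l \in v2 -> ~~ lover l -> t (lid l) = t' (lid l).
  move=> l lv; apply: (tt' i2); first by rewrite d1i2 !mem_cat lv !orbT.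
  by apply: contraNneq cv => <-.
have tt'_other k : k != i2 -> forall l, l \in strand d1 k -> ~~ lover l -> t (lid l) = t' (lid l).
  move=> ki l lk; apply: (tt' k) => //; apply: contra ki => /eqP l_c; apply/eqP.
  by apply: (uniq_flatten_nth (wf_uniq wf_d1) lk); rewrite l_c d1i2 !mem_cat Hc_block orbT.
exists t' => k; rewrite strand_set; case: eqVneq => [->|ki].
- have := half i2; rewrite d1i2.
  apply: strand_coloring_replace_heads; rewrite /= ?x_head ?y_head //.
  + by move=> l; rewrite mem_cat => /orP[lu|lv] ol; [rewrite tt'_u | rewrite tt'_v].
  + by rewrite !reading_cat !conjw_cat block (eq_reading tt'_u).
- exact: eq_strand_coloring (tt'_other k ki) (half k).
- rewrite !reading_cat -(eq_reading tt'_u) -(eq_reading tt'_v) -block -!reading_cat -d1i2.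
  rewrite strand_set; case: eqP => // ->.
  by rewrite di1 !reading_cat.
- rewrite -(eq_reading (tt'_other k ki)) strand_set; case: eqP => // ->.
  by rewrite di1 !reading_cat.
Qed.

Lemma same_longitudes_R3_nondegenerate d a b c ea eb ec i1 p1 i2 p2 x y :
  wf m d -> a != c -> b != c ->
  has_block d [:: Tl a ea; Tl b eb] \/ has_block d [:: Tl b eb; Tl a ea] ->
  at_pair d i1 p1 (Hl a ea) (Tl c ec) -> at_pair (swap_at d i1 p1) i2 p2 x y ->
  [/\ x = Hl b eb, y = Hl c ec & ea = eb] \/ [/\ x = Hl c ec, y = Hl b eb & ea = ~~ eb] ->
  same_longitudes n d (swap_at (swap_at d i1 p1) i2 p2).
Proof.
move=> wf_d ac bc tails ac_pair xy_pair xy.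
have wf_d1 := wf_swap_at ac_pair wf_d; have wf_d' := wf_swap_at xy_pair wf_d1.
apply: same_longitudes_sym; apply: same_longitudes_transport => // q t col.
have tba : magnus_eq n q predT (t b) (t a).
  case: tails => [] [j [p [s dj]]];
    have tail := coloring_tail_block (x := Tl b eb) col dj _ _;
    rewrite (tail : _ -> _ -> magnus_eq _ _ _ (t b) _) ?inE ?eqxx ?orbT //; symmetry;
    by apply: (coloring_tail_block (x := Tl a ea) col dj); rewrite ?inE ?eqxx ?orbT.
have [u1 [v1 [di1 _ d1E]]] := at_pairP ac_pair.
have [u2 [v2 [d1i2 _ ->]]] := at_pairP xy_pair; rewrite d1E in wf_d1 d1i2 *.
have [t' col' tt'] := R3_coloring wf_d wf_d1 bc col tba di1 d1i2 xy.
by exists t' => // i; symmetry; apply: magnus_eq_sub (leqnn q) (fun _ _ => isT) (tt' i).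
Qed.

Lemma same_longitudes_self_arrows d i C : wf m d -> uniq C -> all (self_arrow d i) C ->
  same_longitudes n (del C d) d.
Proof.
elim: C d => [|a C IH] d wf_d /=.
  have -> : del [::] d = d by rewrite -[RHS]map_id; apply: eq_map => s; apply: filter_predT.
  by move=> _ _; apply: same_longitudes_transport => // q t col; exists t.
case/andP=> aC uC /andP[self_a self_C]; have wf_a : wf m (del [:: a] d) by apply: wf_del.
rewrite del_cons.
apply: (same_longitudes_trans wf_a); last exact: same_longitudes_self_arrow self_a.
apply: IH => //; apply/allP => c cC; rewrite self_arrow_del ?(allP self_C) //.
by rewrite inE; apply: contraNneq aC => <-.
Qed.

Lemma same_longitudes_R3_degenerate d a b ea eb ec i1 p1 i2 p2 x y :
  wf m d -> a != b ->
  has_block d [:: Tl a ea; Tl b eb] \/ has_block d [:: Tl b eb; Tl a ea] ->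
  at_pair d i1 p1 (Hl a ea) (Tl a ec) -> at_pair d i2 p2 x y ->
  (x = Hl b eb /\ y = Hl a ec) \/ (x = Hl a ec /\ y = Hl b eb) ->
  same_longitudes n d (swap_at (swap_at d i1 p1) i2 p2).
Proof.
move=> wf_d ab tails aa_pair xy_pair xy.
have Ha : Hl a ea \in strand d i1 /\ Tl a ec \in strand d i1.
  by have [u [v [-> _ _]]] := at_pairP aa_pair; rewrite !mem_cat !inE !eqxx !orbT.
have Hb : Hl a ec \in strand d i2 /\ Hl b eb \in strand d i2.
  have [u [v [-> _ _]]] := at_pairP xy_pair; rewrite !mem_cat.
  by case: xy => [] [-> ->]; rewrite !inE !eqxx !orbT.
have [j [Taj Tbj]] : exists j, Tl a ea \in strand d j /\ Tl b eb \in strand d j.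
  by case: tails => [] [j [u [v dj]]]; exists j; rewrite dj !mem_cat !inE !eqxx !orbT.
have i2E : i2 = i1 by apply: (wf_same_strand wf_d Hb.1 Ha.1).
have jE : j = i1 by apply: (wf_same_strand wf_d Taj Ha.2).
rewrite {i2}i2E {j}jE in xy_pair Hb Taj Tbj *.
have self_ab : all (self_arrow d i1) [:: a; b].
  rewrite /= andbT; apply/andP; split; apply/self_arrowP.
    by exists (Tl a ea), (Hl a ea); case: Ha.
  by exists (Tl b eb), (Hl b eb); case: Hb.
have uab : uniq [:: a; b] by rewrite /= inE ab.
have := at_pair_map (exchange (Hl a ea) (Tl a ec)) xy_pair.
rewrite -(swap_at_exchange wf_d aa_pair).
set x' := exchange _ _ x; set y' := exchange _ _ y => xy'_pair.
have id_exchange l : lid l \in [:: a; b] -> lid (exchange (Hl a ea) (Tl a ec) l) \in [:: a; b].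
  by move=> l_ab; rewrite /exchange; do 2?case: ifP => _ //; rewrite mem_head.
have [x'ab y'ab] : lid x' \in [:: a; b] /\ lid y' \in [:: a; b].
  by split; apply: id_exchange; case: xy => [] [xE yE]; rewrite ?xE ?yE !inE eqxx ?orbT.
set d' := swap_at (swap_at _ _ _) _ _.
have wf_d' : wf m d' by apply: wf_swap_at xy'_pair (wf_swap_at aa_pair wf_d).
have del_d' : del [:: a; b] d' = del [:: a; b] d.
  by rewrite (del_swap_at _ _ xy'_pair) // (del_swap_at _ _ aa_pair) // mem_head.
apply: same_longitudes_trans (wf_del [:: a; b] wf_d) _ _.
  exact/same_longitudes_sym/(same_longitudes_self_arrows (i := i1)).
rewrite -del_d'; apply: (same_longitudes_self_arrows (i := i1)) => //.
apply: sub_all self_ab => c; apply: perm_self_arrow => k.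
exact: perm_trans ((perm_swap_at aa_pair).2 k) ((perm_swap_at xy'_pair).2 k).
Qed.

Lemma same_longitudes_R3 d d' : wf m d -> R3_step d d' -> same_longitudes n d d'.
Proof.
move=> wf_d [a [b [c [ea [eb [ec [i1 [p1 [i2 [p2 [tails [ac_pair [bc_pairs ->]]]]]]]]]]]]].
have ends_block x y : has_block d [:: x; y] \/ has_block d [:: y; x] -> lover x = lover y ->
    lid x != lid y.
  move=> blocks oxy; apply/negP => /eqP xy.
  have [[k [u [v dk]]]|[k [u [v dk]]]] := blocks; have := wf_uniq_endpoints wf_d k;
    by rewrite dk !map_cat uniq_catCA /= inE /endpoint xy oxy eqxx.
have ab : a != b by apply: (ends_block (Tl a ea) (Tl b eb) tails erefl).
have bc : b != c.
  apply: (ends_block (Hl b eb) (Hl c ec) _ erefl).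
  by case: bc_pairs => [] [[u [v [di2 _]]] _]; [left | right]; exists i2, u, v.
have [x [y [xy xy_pair]]] : exists x y,
    ([/\ x = Hl b eb, y = Hl c ec & ea = eb] \/ [/\ x = Hl c ec, y = Hl b eb & ea = ~~ eb]) /\
    at_pair d i2 p2 x y.
  case: bc_pairs => [] [pair signs]; [exists (Hl b eb), (Hl c ec) | exists (Hl c ec), (Hl b eb)].
    by split=> //; left.
  by split=> //; right.
have [ac|ac] := eqVneq a c.
  rewrite -ac in ac_pair xy *; apply: same_longitudes_R3_degenerate tails ac_pair xy_pair _ => //.
  by case: xy => [] [-> ->]; [left | right].
apply: (same_longitudes_R3_nondegenerate wf_d ac bc tails ac_pair _ xy).
rewrite (swap_at_exchange wf_d ac_pair); have := at_pair_map (exchange (Hl a ea) (Tl c ec)) xy_pair.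
have fixed l : lid l != a -> lover l = false -> exchange (Hl a ea) (Tl c ec) l = l.
  by rewrite /exchange => la ol; case: eqP => [E|_]; [rewrite E eqxx in la | case: eqP ol => [->|]].
have [x_fixed y_fixed] : exchange (Hl a ea) (Tl c ec) x = x /\ exchange (Hl a ea) (Tl c ec) y = y.
  by case: xy => [] [-> -> _]; rewrite !fixed // eq_sym.
by rewrite x_fixed y_fixed.
Qed.

Lemma same_longitudes_step d d' : Vn_sv_step m n d d' -> same_longitudes n d d'.
Proof.
case=> wf_d [wf_d' [st|[st|[st|[st|[[f [_ ->]]|[st|st]]]]]]].
- exact/same_longitudes_sv/(R1_sv wf_d').
- exact: same_longitudes_R2.
- exact: same_longitudes_R3.
- exact: same_longitudes_OC.
- exact: same_longitudes_relabel.
- exact: same_longitudes_Vn.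
- exact: same_longitudes_sv.
Qed.

Lemma same_longitudes_equiv d d' : Vn_sv_equiv m n d d' ->
  d = d' \/ [/\ wf m d, wf m d' & same_longitudes n d d'].
Proof.
elim=> {d d'} [d d' step|d|d d' _ [->|[wf_d wf_d' dd']]|d d' d'' _ [->|[wf_d wf_d' dd']] _ IH].
- by have [wf_d [wf_d' _]] := step; right; split=> //; apply: same_longitudes_step.
- by left.
- by left.
- by right; split=> //; apply: same_longitudes_sym.
- exact: IH.
- right; case: IH => [<-|[_ wf_d'' d'd'']]; split=> //; exact: same_longitudes_trans d'd''.
Qed.

Theorem mu_w_invariant d d' : wf m d -> Vn_sv_equiv m n d d' ->
  forall I : seq 'I_m, I != [::] -> uniq I -> (mu_w d I = mu_w d' I %[mod n])%Z.
Proof.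
move=> wf_d /same_longitudes_equiv[->|[_ wf_d' dd']] I I0 uI //.
have col := approx_coloringP n (size I) wf_d; have col' := approx_coloringP n (size I) wf_d'.
have [uM sM aM] := mu_seq_uniq I0 uI.
by rewrite (mu_w_reading wf_d I0 uI col) (mu_w_reading wf_d' I0 uI col') (dd' _ _ _ col col').
Qed.

End Invariance.

(** * Adding and sliding arrows *)

#[export] Instance Vn_sv_equivalence m n : Equivalence (Vn_sv_equiv m n).
Proof. by split; [exact: rst_refl | exact: rst_sym | exact: rst_trans]. Qed.

Lemma sv_equiv m n d i c : wf m d -> self_arrow d i c -> Vn_sv_equiv m n (del [:: c] d) d.
Proof.
move=> wf_d self_c; apply: rst_step; split; first exact: wf_del.
by split=> //; do 6!right; apply/(sv_stepP _ wf_d); exists c, i.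
Qed.

Definition arrow_tails (A : seq (nat * bool)) := [seq Tl c.1 c.2 | c <- A].
Definition arrow_heads (A : seq (nat * bool)) := [seq Hl c.1 c.2 | c <- A].

Lemma all_arrow_tails A : all lover (arrow_tails A).
Proof. by rewrite all_map all_predT. Qed.

Lemma all_arrow_heads A : all (predC lover) (arrow_heads A).
Proof. by rewrite all_map all_predT. Qed.

Lemma paired_add_arrows A s : uniq (unzip1 A) -> (forall c, c \in unzip1 A -> c \notin map lid s) ->
  paired s -> paired (arrow_tails A ++ arrow_heads A ++ s).
Proof.
elim: A => //= -[c e] A IH /andP[cA uA] A_new paired_s.
apply: (@paired_perm (Tl c e :: Hl c e :: arrow_tails A ++ arrow_heads A ++ s)).
  by rewrite perm_cons -[Hl c e :: _]cat1s perm_catCA.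
apply: paired_cons; last by apply: IH => // x xA; apply: A_new; rewrite inE xA orbT.
by rewrite !map_cat !mem_cat -!map_comp !negb_or !cA A_new ?mem_head.
Qed.

Definition fresh_for (d : gdiag) (c : nat) : bool := c \notin map lid (flatten d).

Lemma fresh_for_lid d c l : fresh_for d c -> l \in flatten d -> (lid l == c) = false.
Proof. by move=> c_new ld; apply: contraNF c_new => /eqP <-; apply: map_f. Qed.

Definition fresh (d : gdiag) : nat := (\max_(l <- flatten d) lid l).+1.

Lemma fresh_forP d c : fresh d <= c -> fresh_for d c.
Proof.
move=> dc; apply/mapP => -[l ld c_eq]; have := leq_trans dc (eq_leq c_eq).
by rewrite ltnNge (@leq_bigmax_seq _ _ xpredT lid l ld isT).
Qed.

Lemma wf_add_arrows m (d d' : gdiag) A : wf m d -> size d' = size d -> uniq (unzip1 A) ->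
  (forall c, c \in unzip1 A -> fresh_for d c) ->
  perm_eq (flatten d') (arrow_tails A ++ arrow_heads A ++ flatten d) -> wf m d'.
Proof.
move=> /wfP[sd paired_d] sz uA A_new; rewrite perm_sym => perm_d'.
by apply/wfP; rewrite sz; split=> //; apply: paired_perm perm_d' _; apply: paired_add_arrows.
Qed.

Definition tails_first (s : seq letter) : bool := pairwise (fun x y => lover y ==> lover x) s.

Lemma tails_first_cat u v : tails_first (u ++ v) =
  [&& all lover u || all (predC lover) v, tails_first u & tails_first v].
Proof.
rewrite /tails_first pairwise_cat; congr (_ && _); elim: u => //= x u IH.
rewrite allrel_consl IH; case: (lover x) => /=.
  by rewrite (eq_all (a2 := predT)) ?all_predT // => y /=; rewrite implybT.
rewrite (eq_all (a2 := predC lover)) => [|y /=]; last by rewrite implybF.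
by rewrite andb_orr andbb; case: (all (predC _) v); rewrite ?andbF ?orbT.
Qed.

Lemma tails_first_before u l v : tails_first (u ++ l :: v) -> lover l -> all lover u.
Proof. by rewrite tails_first_cat /= => /andP[+ _] ol; rewrite ol orbF. Qed.

Lemma tails_first_tails s : all lover s -> tails_first s.
Proof.
elim: s => //= x s IH /andP[ox /IH ->]; rewrite andbT.
by apply/allP => y _; rewrite ox implybT.
Qed.

Lemma tails_first_heads s : all (predC lover) s -> tails_first s.
Proof.
elim: s => //= x s IH /andP[_ s_heads]; rewrite -/(tails_first s) IH // andbT.
by apply: sub_all s_heads => y /negPf ->.
Qed.

Lemma tails_first_split s : tails_first s -> exists u v,
  [/\ s = u ++ v, all lover u & all (predC lover) v].
Proof.
elim: s => [_|x s IH /= /andP[x_s /IH[u [v [s_eq u_tails v_heads]]]]]; first by exists [::], [::].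
have [ox|ox] := boolP (lover x); first by exists (x :: u), v; rewrite s_eq /= ox.
exists [::], (x :: s); split=> //=; rewrite ox; apply: sub_all x_s => y.
by rewrite (negPf ox) implybF.
Qed.

Lemma tails_first_inversion s : ~~ tails_first s -> exists u h x v,
  [/\ s = u ++ [:: h; x] ++ v, ~~ lover h & lover x].
Proof.
elim: s => [//|y s IH] not_first.
have [s_first|/IH[u [h [x [v [-> oh ox]]]]]] := boolP (tails_first s); last first.
  by exists (y :: u), h, x, v.
have [u [v [s_eq u_tails v_heads]]] := tails_first_split s_first.
have oy : ~~ lover y.
  apply: contra not_first => oy; have yu_tails : all lover (y :: u) by rewrite /= oy.
  by rewrite s_eq -cat_cons tails_first_cat yu_tails tails_first_tails ?tails_first_heads.
case: u u_tails s_eq => [_ s_eq|x u /andP[ox _] ->]; last by exists [::], y, x, (u ++ v).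
by case/negP: not_first; apply: tails_first_heads; rewrite s_eq /= oy.
Qed.

Section Substitution.
Implicit Types (f : letter -> seq letter) (s u v : seq letter).

Definition subst f s : seq letter := flatten (map f s).

Lemma subst_cat f u v : subst f (u ++ v) = subst f u ++ subst f v.
Proof. by rewrite /subst map_cat flatten_cat. Qed.

Lemma subst_id f s : (forall l, l \in s -> f l = [:: l]) -> subst f s = s.
Proof.
elim: s => // l s IH f_id; rewrite -cat1s subst_cat IH => [|x xs].
  by rewrite /subst /= f_id ?mem_head.
by rewrite f_id // inE xs orbT.
Qed.

Lemma strand_subst f (d : gdiag) k : strand (map (subst f) d) k = subst f (strand d k).
Proof. exact: nth_map_nil. Qed.

Lemma strand_subst_block f (d : gdiag) l : l \in flatten d ->
  exists k u v, strand (map (subst f) d) k = u ++ f l ++ v.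
Proof.
case/flatten_nthP=> k lk; case/splitPr dk : _ / lk => [u v].
by exists k, (subst f u), (subst f v); rewrite strand_subst dk subst_cat.
Qed.

Lemma flatten_subst f (d : gdiag) : flatten (map (subst f) d) = subst f (flatten d).
Proof. by elim: d => //= s d ->; rewrite subst_cat. Qed.

Lemma all_subst (P : pred letter) f s : (forall l, P l -> all P (f l)) -> all P s ->
  all P (subst f s).
Proof. by move=> fP; elim: s => //= l s IH /andP[/fP Pl /IH]; rewrite /subst /= all_cat Pl. Qed.

Lemma tails_first_subst f s :
  (forall l, all (fun x => lover x == lover l) (f l)) -> tails_first s -> tails_first (subst f s).
Proof.
move=> f_over /tails_first_split[u [v [-> u_tails v_heads]]].
have fu_tails : all lover (subst f u).
  by apply: all_subst u_tails => l ol; apply: sub_all (f_over l) => x; rewrite ol => /eqP.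
have fv_heads : all (predC lover) (subst f v).
  apply: all_subst v_heads => l /negPf ol.
  by apply: sub_all (f_over l) => x /=; rewrite ol => /eqP ->.
by rewrite subst_cat tails_first_cat fu_tails tails_first_tails ?tails_first_heads.
Qed.

Variables (tc hc tc' hc' : nat -> aword) (f : letter -> seq letter).
Hypothesis f_over : forall l, all (fun x => lover x == lover l) (f l).

Lemma reading_subst s :
  (forall l, l \in s -> ~~ lover l -> reading hc' (f l) = expw (hc (lid l)) (lsgn l)) ->
  reading hc' (subst f s) = reading hc s.
Proof.
elim: s => // l s IH f_heads; rewrite -cat1s subst_cat !reading_cat IH => [|x xs]; last first.
  by apply: f_heads; rewrite inE xs orbT.
congr (_ ++ _); rewrite /subst /= cats0.
have [ol|ol] := boolP (lover l); last by rewrite reading_head // f_heads ?mem_head.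
rewrite !reading_tails //= ?ol //.
by apply: sub_all (f_over l) => x; rewrite ol => /eqP.
Qed.

Lemma strand_coloring_subst E y s :
  (forall l, l \in s -> lover l -> forall x, x \in f l -> tc' (lid x) = tc (lid l)) ->
  (forall l, l \in s -> ~~ lover l -> reading hc' (f l) = expw (hc (lid l)) (lsgn l)) ->
  strand_coloring E tc hc y s -> strand_coloring E tc' hc' y (subst f s).
Proof.
elim: s y => // l s IH y f_tails f_heads; rewrite -cat1s subst_cat.
have f_tails' x : x \in s -> lover x -> forall z, z \in f x -> tc' (lid z) = tc (lid x).
  by move=> xs; apply: f_tails; rewrite inE xs orbT.
have f_heads' x : x \in s -> ~~ lover x -> reading hc' (f x) = expw (hc (lid x)) (lsgn x).
  by move=> xs; apply: f_heads; rewrite inE xs orbT.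
rewrite strand_coloring_cat => -[col_l col_s]; apply/strand_coloring_cat.
have -> : subst f [:: l] = f l by apply: cats0.
move: col_l col_s => /=; have [ol|ol] := boolP (lover l) => col_l.
  have fl_tails : all lover (f l) by apply: sub_all (f_over l) => x; rewrite ol => /eqP.
  rewrite !reading_tails /= ?ol // => col_s; split; last exact: IH.
  elim: (f l) fl_tails (f_tails l (mem_head _ _) ol) => //= x r IHr /andP[-> r_tails] tcE.
  rewrite tcE ?mem_head; split; first by case: col_l.
  by apply: IHr => // z zr; apply: tcE; rewrite inE zr orbT.
rewrite reading_head // f_heads ?mem_head // => col_s; split; last exact: IH.
by apply: strand_coloring_heads; apply: sub_all (f_over l) => x /=; rewrite (negPf ol) => /eqP ->.
Qed.

End Substitution.

Section Slide.
Variables (m n : nat).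
Local Notation "d <~> d'" := (Vn_sv_equiv m n d d') (at level 70).

Definition subst2 (x y : letter) (wx wy : seq letter) (l : letter) : seq letter :=
  if l == x then wx else if l == y then wy else [:: l].

Lemma subst2_id x y wx wy s : x \notin s -> y \notin s -> subst (subst2 x y wx wy) s = s.
Proof.
move=> xs ys; apply: subst_id => l ls; rewrite /subst2.
by rewrite (negPf (memPn xs _ ls)) (negPf (memPn ys _ ls)).
Qed.

Lemma perm_subst2 x y wx wy s : uniq s -> x \in s -> y \in s -> x != y ->
  perm_eq (subst (subst2 x y (x :: wx) (rcons wy y)) s) (wx ++ wy ++ s).
Proof.
move=> us xs ys xy; set g := subst2 _ _ _ _.
have y_rem : y \in rem x s by rewrite mem_rem_uniq // inE eq_sym xy.
have perm_s : perm_eq s (x :: y :: rem y (rem x s)).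
  by apply: perm_trans (perm_to_rem xs) _; rewrite perm_cons; apply: perm_to_rem.
apply: perm_trans (perm_flatten (perm_map g perm_s)) _.
have -> : flatten (map g [:: x, y & rem y (rem x s)]) =
    (x :: wx) ++ rcons wy y ++ rem y (rem x s).
  rewrite /= -/(subst _ _) subst2_id /g /subst2 ?eqxx 1?eq_sym ?(negPf xy) //.
    by rewrite mem_rem_uniq ?rem_uniq // inE mem_rem_uniq // inE eqxx andbF.
  by rewrite mem_rem_uniq ?rem_uniq // inE eqxx.
by apply/permP => P; rewrite -cats1 !count_cat (permP perm_s) /=; lia.
Qed.

Lemma R2_add d x y e (b := fresh d) (b' := (fresh d).+1)
    (d' := map (subst (subst2 x y [:: x; Tl b e; Tl b' (~~ e)] [:: Hl b' (~~ e); Hl b e; y])) d) :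
  wf m d -> x \in flatten d -> y \in flatten d -> lover x -> ~~ lover y ->
  wf m d' /\ d <~> d'.
Proof.
move=> wf_d xd yd ox oy; have xy : x != y by apply: contraTneq ox => ->.
have [b_new b'_new] : fresh_for d b /\ fresh_for d b' by split; apply: fresh_forP.
have bb' : b != b' by rewrite neq_ltn ltnSn.
have wf_d' : wf m d'.
  apply: (@wf_add_arrows m d d' [:: (b, e); (b', ~~ e)]) => //.
  - by rewrite size_map.
  - by rewrite /= inE bb'.
  - by move=> c; rewrite !inE => /orP[] /eqP ->.
  rewrite flatten_subst.
  have := perm_subst2 [:: Tl b e; Tl b' (~~ e)] [:: Hl b' (~~ e); Hl b e] (wf_uniq wf_d) xd yd xy.
  move/perm_trans; apply.
  by rewrite perm_cat2l perm_cat2r; apply/permP => P /=; rewrite !addn0 addnC.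
split=> //; apply: rst_step; split=> //; split=> //; right; left; exists b, b', e.
have [kx xk] := flatten_nthP _ _ xd; have [ky yk] := flatten_nthP _ _ yd.
set g := subst2 x y _ _ in d' wf_d' *.
have gx : g x = [:: x; Tl b e; Tl b' (~~ e)] by rewrite /g /subst2 eqxx.
have gy : g y = [:: Hl b' (~~ e); Hl b e; y] by rewrite /g /subst2 eqxx eq_sym (negPf xy).
have old l : l \in flatten d -> lid l \notin [:: b; b'].
  by move=> ld; rewrite !inE (fresh_for_lid b_new ld) (fresh_for_lid b'_new ld).
have del_g l : l \in flatten d -> [seq z <- g l | lid z \notin [:: b; b']] = [:: l].
  move=> ld; have [->|lx] := eqVneq l x; first by rewrite gx /= (old x) // !inE !eqxx orbT.
  have [->|ly] := eqVneq l y; first by rewrite gy /= (old y) // !inE !eqxx orbT.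
  by rewrite /g /subst2 (negPf lx) (negPf ly) /= old.
split; last split.
- rewrite /d' /del -map_comp -[LHS]map_id; apply/eq_in_map => s sd /=.
  rewrite /subst filter_flatten -map_comp; apply/esym/(@subst_id (fun l => _)) => l ls.
  by apply: del_g; apply/flattenP; exists s.
- left; case/splitPr dk : _ / xk => [u v]; exists kx, (rcons (subst g u) x), (subst g v).
  by rewrite strand_subst dk subst_cat cat_rcons; congr (_ ++ _); rewrite /subst /= gx.
- right; case/splitPr dk : _ / yk => [u v]; exists ky, (subst g u), (y :: subst g v).
  by rewrite strand_subst dk subst_cat; congr (_ ++ _); rewrite /subst /= gy.
Qed.

Lemma Tl_eq c c' e e' : (Tl c e == Tl c' e') = (c == c') && (e == e').
Proof. by rewrite /Tl !xpair_eqE andbT. Qed.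

Lemma Hl_eq c c' e e' : (Hl c e == Hl c' e') = (c == c') && (e == e').
Proof. by rewrite /Hl !xpair_eqE andbT. Qed.

Lemma Tl_Hl c c' e e' : (Tl c e == Hl c' e') = false.
Proof. by rewrite /Tl /Hl !xpair_eqE andbF. Qed.

Lemma Hl_Tl c c' e e' : (Hl c e == Tl c' e') = false.
Proof. by rewrite eq_sym Tl_Hl. Qed.

(* R3 acts on d with the two copies of a as the substitution below acts on the
   diagram where the head of a and the tail of c are exchanged. *)
Lemma exchange_subst2 a b b' c ea ec l : a != c ->
  lid l \notin [:: b; b'] -> a \notin [:: b; b'] -> c \notin [:: b; b'] -> b != b' ->
  [seq exchange (Hl b ea) (Hl c ec) (exchange (Hl a ea) (Tl c ec) x) |
    x <- subst2 (Tl a ea) (Hl c ec) [:: Tl a ea; Tl b ea; Tl b' (~~ ea)]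
           [:: Hl b' (~~ ea); Hl b ea; Hl c ec] l] =
  subst2 (Tl a ea) (Hl c ec) [:: Tl a ea; Tl b ea; Tl b' (~~ ea)]
    [:: Hl b' (~~ ea); Hl c ec; Hl b ea] (exchange (Hl a ea) (Tl c ec) l).
Proof.
rewrite !inE !negb_or => ac /andP[lb lb'] /andP[ab ab'] /andP[cb cb'] bb'.
have ne := (negPf ac, negPf ab, negPf ab', negPf cb, negPf cb', negPf bb').
have eqs := (Tl_eq, Hl_eq, Tl_Hl, Hl_Tl, eqxx, ne, eq_sym c a, eq_sym b a, eq_sym b' a,
  eq_sym b c, eq_sym b' c, eq_sym b' b).
rewrite /subst2 /exchange.
have [->|lTa] := eqVneq l (Tl a ea); first by do 4!rewrite /= ?eqs.
have [->|lHc] := eqVneq l (Hl c ec); first by do 4!rewrite /= ?eqs.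
have [->|lHa] := eqVneq l (Hl a ea); first by do 4!rewrite /= ?eqs.
have [->|lTc] := eqVneq l (Tl c ec); first by do 4!rewrite /= ?eqs.
have lHb : l != Hl b ea by apply: contraNneq lb => ->.
by rewrite (negPf lTa) (negPf lHc) /= (negPf lHa) (negPf lTc) (negPf lHb) (negPf lHc).
Qed.

Definition slide_subst (d : gdiag) a ea c ec : letter -> seq letter :=
  subst2 (Tl a ea) (Hl c ec)
    [:: Tl a ea; Tl (fresh d) ea; Tl (fresh d).+1 (~~ ea)]
    [:: Hl (fresh d).+1 (~~ ea); Hl c ec; Hl (fresh d) ea].

Lemma slide_subst_over d a ea c ec l :
  all (fun x => lover x == lover l) (slide_subst d a ea c ec l).
Proof.
rewrite /slide_subst /subst2; case: eqP => [->|_] //; case: eqP => [->|_] //.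
by rewrite /= eqxx.
Qed.

Lemma slide_subst_tail_lid (t : nat -> aword) d a ea c ec l x :
  t (fresh d) = t a -> t (fresh d).+1 = t a -> lover l ->
  x \in slide_subst d a ea c ec l -> t (lid x) = t (lid l).
Proof.
move=> tb tb' ol; rewrite /slide_subst /subst2; case: eqP => [->|_].
  by rewrite !inE => /or3P[] /eqP ->.
by case: eqP => [l_Hc|_]; [rewrite l_Hc in ol | rewrite inE => /eqP ->].
Qed.

Lemma reading_slide_subst (t t' : nat -> aword) d a ea c ec l :
  t' (fresh d) = t a -> t' (fresh d).+1 = t a -> t c = conjw (t' c) (expw (t a) ea) ->
  ~~ lover l -> (l != Hl c ec -> t' (lid l) = t (lid l)) ->
  reading t' (slide_subst d a ea c ec l) = expw (t (lid l)) (lsgn l).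
Proof.
move=> t'b t'b' tc ol t'l; rewrite /slide_subst /subst2; case: eqP => [l_Ta|_].
  by rewrite l_Ta in ol.
have [->|/t'l t'_l] := eqVneq l (Hl c ec); last by rewrite reading_head // t'_l.
rewrite -cat1s -[[:: Hl c ec; _]]cat1s !reading_cat !reading_head // /lid /lsgn /=.
by rewrite t'b t'b' tc expw_conjw -invw_expw.
Qed.

Definition parallel_subst (d : gdiag) a ea c ec : letter -> seq letter :=
  subst2 (Tl a ea) (Hl c ec)
    [:: Tl a ea; Tl (fresh d) ea; Tl (fresh d).+1 (~~ ea)]
    [:: Hl (fresh d).+1 (~~ ea); Hl (fresh d) ea; Hl c ec].

Lemma slide_swaps d j u v a ea c ec p k q (d1 := map (subst (parallel_subst d a ea c ec)) d)
    (d2 := swap_at d1 j p) :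
  wf m d -> wf m d1 -> a != c -> strand d j = u ++ [:: Hl a ea; Tl c ec] ++ v ->
  at_pair d1 j p (Hl a ea) (Tl c ec) -> at_pair d1 k q (Hl (fresh d) ea) (Hl c ec) ->
  at_pair d2 k q (Hl (fresh d) ea) (Hl c ec) /\
  map (subst (slide_subst d a ea c ec)) (set_strand d j (u ++ [:: Tl c ec; Hl a ea] ++ v)) =
    swap_at d2 k q.
Proof.
move=> wf_d wf_d1 ac dj ac_pair1 bc_pair1.
have ac_pair : at_pair d j (size u) (Hl a ea) (Tl c ec) by exists u, v.
have [Ha Tc] : Hl a ea \in flatten d /\ Tl c ec \in flatten d.
  by split; apply: (@mem_nth_flatten _ _ _ j); rewrite dj mem_cat !inE eqxx ?orbT.
have old_id l : l \in flatten d -> lid l \notin [:: fresh d; (fresh d).+1].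
  by move=> ld; rewrite !inE !(fresh_for_lid _ ld) // fresh_forP.
have bc_pair2 : at_pair d2 k q (Hl (fresh d) ea) (Hl c ec).
  rewrite /d2 (swap_at_exchange wf_d1 ac_pair1).
  have := at_pair_map (exchange (Hl a ea) (Tl c ec)) bc_pair1.
  have := old_id _ Ha; rewrite !inE negb_or => /andP[/negPf ab _].
  by rewrite /exchange !Hl_eq !Hl_Tl [fresh d == _]eq_sym ab [c == _]eq_sym (negPf ac).
split=> //; rewrite (swap_at_exchange (wf_swap_at ac_pair1 wf_d1) bc_pair2).
rewrite /d2 (swap_at_exchange wf_d1 ac_pair1) -(swap_atE dj) (swap_at_exchange wf_d ac_pair).
rewrite /d1 -!map_comp; apply/eq_in_map => s sd /=.
rewrite -map_comp map_flatten /subst -!map_comp.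
congr flatten; apply/eq_in_map => l ls; apply/esym/exchange_subst2 => //.
- by apply: old_id; apply/flattenP; exists s.
- exact: (old_id _ Ha).
- exact: (old_id _ Tc).
- by rewrite neq_ltn leqnn.
Qed.

(* An R2 move creates two parallel copies of a next to the head of c, and R3 then
   moves the tail of c across the head of a. *)
Lemma slide d j u v a ea c ec
    (d' := map (subst (slide_subst d a ea c ec))
             (set_strand d j (u ++ [:: Tl c ec; Hl a ea] ++ v))) :
  wf m d -> a != c -> strand d j = u ++ [:: Hl a ea; Tl c ec] ++ v -> wf m d' /\ d <~> d'.
Proof.
move=> wf_d ac dj.
have [Ha Tc] : Hl a ea \in flatten d /\ Tl c ec \in flatten d.
  by split; apply: (@mem_nth_flatten _ _ _ j); rewrite dj mem_cat !inE eqxx ?orbT.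
have [Ta Hc] : Tl a ea \in flatten d /\ Hl c ec \in flatten d.
  by split; [exact: (wf_other_end wf_d Ha) | exact: (wf_other_end wf_d Tc)].
have [wf_d1 d_d1] := R2_add ea wf_d Ta Hc isT isT.
set g := subst2 _ _ _ _ in wf_d1 d_d1; set d1 := map _ d in wf_d1 d_d1.
set b := fresh d; set b' := (fresh d).+1.
have gTa : g (Tl a ea) = [:: Tl a ea; Tl b ea; Tl b' (~~ ea)] by rewrite /g /subst2 eqxx.
have gHc : g (Hl c ec) = [:: Hl b' (~~ ea); Hl b ea; Hl c ec] by rewrite /g /subst2 Hl_Tl eqxx.
have gHa : g (Hl a ea) = [:: Hl a ea] by rewrite /g /subst2 Hl_Tl Hl_eq (negPf ac).
have gTc : g (Tl c ec) = [:: Tl c ec] by rewrite /g /subst2 Tl_Hl Tl_eq eq_sym (negPf ac).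
have [ka [a1 [a2]]] := strand_subst_block g Ta; rewrite gTa => d1ka.
have [kc [c1 [c2]]] := strand_subst_block g Hc; rewrite gHc => d1kc.
have ac_pair1 : at_pair d1 j (size (subst g u)) (Hl a ea) (Tl c ec).
  exists (subst g u), (subst g v); split=> //.
  by rewrite strand_subst dj !subst_cat {2}/subst /= gHa gTc.
have bc_pair1 : at_pair d1 kc (size (rcons c1 (Hl b' (~~ ea)))) (Hl b ea) (Hl c ec).
  by exists (rcons c1 (Hl b' (~~ ea))), c2; rewrite d1kc cat_rcons.
have ab_block : has_block d1 [:: Tl a ea; Tl b ea] by exists ka, a1, (Tl b' (~~ ea) :: a2).
have [bc_pair2 d'E] := slide_swaps wf_d wf_d1 ac dj ac_pair1 bc_pair1.
rewrite /d' d'E; have wf_d' := wf_swap_at bc_pair2 (wf_swap_at ac_pair1 wf_d1).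
split=> //; transitivity d1 => //; apply: rst_step; split=> //; split=> //; right; right; left.
exists a, b, c, ea, ea, ec, j, (size (subst g u)), kc, (size (rcons c1 (Hl b' (~~ ea)))).
by split; [left | split=> //; split=> //; left].
Qed.

Lemma slide_exact_coloring d j u v a ea c ec t
    (d' := map (subst (slide_subst d a ea c ec))
             (set_strand d j (u ++ [:: Tl c ec; Hl a ea] ++ v))) :
  wf m d -> a != c -> strand d j = u ++ [:: Hl a ea; Tl c ec] ++ v -> coloring eq d t ->
  exists2 t', coloring eq d' t' & forall k, reading t' (strand d' k) = reading t (strand d k).
Proof.
move=> wf_d ac dj col; set Y := conjw [:: (j, true)] (reading t u).
have tc : t c = conjw Y (expw (t a) ea).
  have := coloring_tail (u := u ++ [:: Hl a ea]) (l := Tl c ec) (v := v) col.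
  by rewrite -catA => /(_ _ dj isT); rewrite reading_cat conjw_cat reading_head.
pose t1 := [eta t with c |-> Y]; set d1 := set_strand d j _ in d' *.
have half : forall k, strand_coloring eq t1 t [:: (k, true)] (strand d1 k).
  exact: (strand_coloring_tail_past_head _ wf_d dj isT isT col).
have perm_d1 k : strand d1 k =i strand d k.
  move=> l; rewrite strand_set; case: eqP => [->|//].
  by rewrite dj !mem_cat !inE [(l == Tl c ec) || _]orbC.
have t1a : t1 a = t a by rewrite /t1 /= (negPf ac).
have t1c : t1 c = Y by rewrite /t1 /= eqxx.
have t1_other l : lid l != c -> t1 (lid l) = t (lid l) by rewrite /t1 /= => /negPf ->.
clearbody t1; pose t' := [eta t1 with fresh d |-> t a, (fresh d).+1 |-> t a].
have old_id k l : l \in strand d1 k -> t' (lid l) = t1 (lid l).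
  rewrite perm_d1 => /mem_nth_flatten ld; rewrite /t' /=.
  by rewrite !(fresh_for_lid _ ld) // fresh_forP.
have t'_new : t' (fresh d) = t a /\ t' (fresh d).+1 = t a.
  by rewrite /t' /= !eqxx; case: ifP.
have [Haj Tcj] : Hl a ea \in strand d j /\ Tl c ec \in strand d j.
  by rewrite dj !mem_cat !inE !eqxx !orbT.
have t'a : t' a = t a by rewrite -t1a -[a]/(lid (Hl a ea)) (old_id j) // perm_d1.
have t'c : t' c = Y by rewrite -t1c -[c]/(lid (Tl c ec)) (old_id j) // perm_d1.
clearbody t'.
have f_over := slide_subst_over d a ea c ec.
have f_tails k l : l \in strand d1 k -> lover l ->
    forall x, x \in slide_subst d a ea c ec l -> t' (lid x) = t1 (lid l).
  move=> lk ol x xl; rewrite -(old_id _ _ lk).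
  by apply: slide_subst_tail_lid ol xl; rewrite ?t'_new.1 ?t'_new.2 t'a.
have f_heads k l : l \in strand d1 k -> ~~ lover l ->
    reading t' (slide_subst d a ea c ec l) = expw (t (lid l)) (lsgn l).
  move=> lk ol; apply: (reading_slide_subst t'_new.1 t'_new.2 _ ol) => [|lHc].
    by rewrite t'c.
  rewrite (old_id _ _ lk) t1_other //.
  have ld : l \in flatten d by move: lk; rewrite perm_d1 => /mem_nth_flatten.
  exact: (wf_lid_neq wf_d (wf_other_end wf_d (mem_nth_flatten Tcj)) ld (negPf ol) lHc).
exists t' => k; rewrite strand_subst.
  apply: (strand_coloring_subst f_over) (half k) => l lk; first exact: f_tails lk.
  exact: f_heads lk.
rewrite (reading_subst f_over (f_heads k)) /d1 strand_set; case: eqP => [->|_] //.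
by rewrite dj !reading_cat.
Qed.

Definition exact_readings d d' := forall t, coloring eq d t ->
  exists2 t', coloring eq d' t' & forall k, reading t' (strand d' k) = reading t (strand d k).

Fixpoint inversions (s : seq letter) : nat :=
  if s is x :: s' then (if lover x then 0 else count lover s') + inversions s' else 0.

Lemma inversions_swap u h x v : ~~ lover h -> lover x ->
  inversions (u ++ [:: h; x] ++ v) = (inversions (u ++ [:: x; h] ++ v)).+1.
Proof.
move=> /negPf oh ox; elim: u => [|y u IH] /=; first by rewrite oh ox /= add0n add1n addSn.
by rewrite IH addnS !count_cat /= oh ox; case: (lover y).
Qed.

Definition self_free (s : seq letter) : Prop :=
  {in s &, forall x y, lid x = lid y -> lover x = lover y}.

(* Sliding the tails of the part r of strand j past its heads adds letters next to
   tails and heads of other strands and to tails of u only, so the inversions of r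
   decrease. *)
Lemma push_tails d j u r : wf m d -> strand d j = u ++ r -> all lover u -> self_free r ->
  exists d', [/\ wf m d', d <~> d', tails_first (strand d' j), exact_readings d d' &
    forall k, k != j -> tails_first (strand d k) -> tails_first (strand d' k)].
Proof.
have [N] := ubnP (inversions r); elim: N d u r => [//|N IH] d u r r_lt wf_d dj u_tails r_free.
have [r_first|/tails_first_inversion[r1 [h [x [r2 [r_eq oh ox]]]]]] := boolP (tails_first r).
  exists d; split=> //; first by reflexivity.
    by rewrite dj tails_first_cat u_tails tails_first_tails.
  by move=> t col; exists t.
case: h x oh ox r_eq => [[a []] ea] [[c []] ec] // _ _ r_eq.
have [Har Tcr] : Hl a ea \in r /\ Tl c ec \in r.
  by rewrite r_eq !mem_cat !inE !eqxx !orbT.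
have ac : a != c by apply/eqP => ac; have := r_free _ _ Har Tcr ac.
have dj' : strand d j = (u ++ r1) ++ [:: Hl a ea; Tl c ec] ++ r2 by rewrite dj r_eq -!catA.
have [wf_d1 d_d1] := slide wf_d ac dj'; set d1 := map _ _ in wf_d1 d_d1.
have d_d1_exact : exact_readings d d1 by move=> t; apply: slide_exact_coloring wf_d ac dj'.
pose r' := r1 ++ [:: Tl c ec; Hl a ea] ++ r2.
have r'_r : r' =i r.
  by move=> l; rewrite r_eq /r' !mem_cat !inE [(l == Tl c ec) || _]orbC.
pose f := slide_subst d a ea c ec.
have f_over := slide_subst_over d a ea c ec.
have d1j : strand d1 j = subst f u ++ r'.
  rewrite strand_subst strand_set eqxx -catA subst_cat; congr (_ ++ _); apply: subst2_id.
    by rewrite r'_r; apply/negP => Tar; have := r_free _ _ Har Tar erefl.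
  by rewrite r'_r; apply/negP => Hcr; have := r_free _ _ Hcr Tcr erefl.
have fu_tails : all lover (subst f u).
  by apply: all_subst u_tails => l ol; apply: sub_all (f_over l) => y; rewrite ol => /eqP.
have [||d' [wf_d' d1_d' d'j d1_d'_exact d'_first]] := IH d1 (subst f u) r' _ wf_d1 d1j fu_tails.
- by move: r_lt; rewrite r_eq inversions_swap // ltnS.
- by move=> y z; rewrite !r'_r; apply: r_free.
exists d'; split=> //.
- by transitivity d1.
- move=> t /d_d1_exact[t1 /d1_d'_exact[t' col' t'1] t1_t].
  by exists t' => // k; rewrite t'1.
- move=> k kj dk; apply: d'_first => //; rewrite strand_subst strand_set (negPf kj).
  exact: tails_first_subst.
Qed.

Definition ascending d : Prop := wf m d /\ forall k, tails_first (strand d k).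

Lemma remove_self_arrows d j : wf m d -> exists d', [/\ wf m d', d <~> d', self_free (strand d' j) &
  forall k, tails_first (strand d k) -> tails_first (strand d' k)].
Proof.
have [N] := ubnP (size (strand d j)); elim: N d => [//|N IH] d d_lt wf_d.
have [/hasP[x xj]|/hasPn no_self] := boolP (has (fun x => self_arrow d j (lid x)) (strand d j)).
  set d1 := del [:: lid x] d => self_x; have wf_d1 : wf m d1 by apply: wf_del.
  have [|d' [wf_d' d1_d' d'j d'_first]] := IH d1 _ wf_d1.
    rewrite -ltnS; apply: leq_trans d_lt; rewrite ltnS strand_del size_filter.
    rewrite -(count_predC (fun l => lid l \notin [:: lid x])).
    by rewrite -addn1 leq_add2l -has_count; apply/hasP; exists x; rewrite //= inE eqxx.
  exists d'; split=> //; first by transitivity d1 => //; symmetry; apply: sv_equiv self_x.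
  by move=> k dk; apply: d'_first; rewrite strand_del; apply: pairwise_filter.
exists d; split=> //; first by reflexivity.
move=> x y xj yj xy; have := no_self x xj; apply: contraNeq => oxy; apply/self_arrowP.
case ox: (lover x) oxy; case oy: (lover y) => // _.
  by exists x, y; rewrite /endpoint ox oy xy.
by exists y, x; rewrite /endpoint ox oy xy.
Qed.

Theorem ascending_exists d : wf m d -> exists2 d', d <~> d' & ascending d'.
Proof.
move=> wf_d; have first_strands r : exists d',
    [/\ wf m d', d <~> d' & forall k, k < r -> tails_first (strand d' k)].
  elim: r => [|r [d1 [wf_d1 d_d1 d1_first]]]; first by exists d; split=> //; reflexivity.
  have [d2 [wf_d2 d1_d2 d2r d2_first]] := remove_self_arrows r wf_d1.
  have [d3 [wf_d3 d2_d3 d3r _ d3_first]] := push_tails (u := [::]) wf_d2 erefl isT d2r.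
  exists d3; split=> //; first by transitivity d1 => //; transitivity d2.
  move=> k; rewrite ltnS leq_eqVlt => /predU1P[->//|kr].
  by apply: d3_first; [rewrite neq_ltn kr | apply/d2_first/d1_first].
have [d' [wf_d' d_d' d'_first]] := first_strands m.
exists d' => //; split=> // k; have [/d'_first //|mk] := ltnP k m.
by rewrite nth_default // (wf_size wf_d').
Qed.

End Slide.

(** * Ascending diagrams *)

Definition tail_meridian (d : gdiag) (c : nat) : aword := [:: (tail_strand d c, true)].

(* On an ascending diagram these words are the longitudes. *)
Definition head_word (d : gdiag) k : aword := reading (tail_meridian d) (strand d k).

Lemma reading_tail_meridian d s :
  reading (tail_meridian d) s = [seq (tail_strand d (lid l), lsgn l) | l <- heads s].
Proof.
rewrite /reading; elim: (heads s) => //= l {}s ->.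
by rewrite /tail_meridian; case: (lsgn l).
Qed.

Lemma head_wordE d k :
  head_word d k = [seq (tail_strand d (lid l), lsgn l) | l <- heads (strand d k)].
Proof. exact: reading_tail_meridian. Qed.

Lemma ascending_coloring m d : ascending m d -> coloring eq d (tail_meridian d).
Proof.
move=> [wf_d d_first] k; have [u [v [dk u_tails v_heads]]] := tails_first_split (d_first k).
rewrite dk; apply/strand_coloring_cat; split; last exact: strand_coloring_heads.
apply: strand_coloring_tails => // l lu.
by rewrite /tail_meridian (@tail_strandE m d k) ?(allP u_tails) // dk mem_cat lu.
Qed.

Lemma ascending_reading m d t k : ascending m d -> coloring eq d t ->
  reading t (strand d k) = head_word d k.
Proof.
move=> asc_d col; have [wf_d d_first] := asc_d; apply: eq_reading => l /mem_nth_flatten ld _.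
move: l ld; apply: (wf_tail_ind wf_d (P := fun c => t c = tail_meridian d c)) => i l li ol.
case/splitPr di : _ / li => [u v]; rewrite (coloring_tail col di ol).
rewrite (coloring_tail (ascending_coloring asc_d) di ol).
by have := d_first i; rewrite di => /tails_first_before/(_ ol) u_tails; rewrite !reading_tails.
Qed.

Lemma perm_eq_adjacent_ind (T : eqType) (P : seq T -> seq T -> Prop) :
  (forall s, P s s) -> (forall r s t, P r s -> P s t -> P r t) ->
  (forall u x y v, P (u ++ [:: x; y] ++ v) (u ++ [:: y; x] ++ v)) ->
  forall s t, perm_eq s t -> P s t.
Proof.
move=> P_refl P_trans P_swap s t.
have to_front u p x v : P (p ++ u ++ x :: v) (p ++ x :: u ++ v).
  elim: u p => [//|y u IH] p; have := IH (rcons p y); rewrite !cat_rcons => /P_trans; apply.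
  exact: (P_swap p y x (u ++ v)).
suff context p : perm_eq s t -> P (p ++ s) (p ++ t) by exact: (context [::]).
elim: t s p => [|x t IH] s p st; first by move: st => /perm_nilP ->.
have xs : x \in s by rewrite (perm_mem st) mem_head.
case/splitPr: xs st => u v st; apply: P_trans (to_front u p x v) _.
rewrite -!cat_rcons; apply: IH; rewrite -(perm_cons x) -(permPr st).
by rewrite -[x :: u ++ v]/([:: x] ++ u ++ v) perm_catCA.
Qed.

Lemma injective_extension (s s' : seq nat) : uniq s -> uniq s' -> size s = size s' ->
  exists2 f : nat -> nat, injective f & map f s = s'.
Proof.
move=> us us' sz; pose N := (\max_(x <- s') x).+1.
pose f x := if x \in s then nth 0 s' (index x s) else N + x; exists f.
  have f_lt x : x \in s -> f x < N.
    move=> xs; rewrite /f xs ltnS; apply: (@leq_bigmax_seq _ _ xpredT id) => //.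
    by apply: mem_nth; rewrite -sz index_mem.
  move=> x y; have [xs|xs] := boolP (x \in s); have [ys|ys] := boolP (y \in s).
  - rewrite /f xs ys => /eqP; rewrite nth_uniq -?sz ?index_mem // => /eqP xy.
    by rewrite -(nth_index 0 xs) xy nth_index.
  - by move=> fxy; have := f_lt x xs; rewrite fxy /f (negPf ys) ltnNge leq_addr.
  - by move=> fxy; have := f_lt y ys; rewrite -fxy /f (negPf xs) ltnNge leq_addr.
  - by rewrite /f (negPf xs) (negPf ys) => /addnI.
apply: (@eq_from_nth _ 0); rewrite size_map // => i i_lt.
by rewrite (nth_map 0) // /f mem_nth // index_uniq.
Qed.

Section AscendingUniqueness.
Variables (m n : nat).
Local Notation "d <~> d'" := (Vn_sv_equiv m n d d') (at level 70).

Lemma OC_block d k u v s s' : wf m d -> k < size d -> strand d k = u ++ s ++ v -> all lover s ->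
  perm_eq s s' -> d <~> set_strand d k (u ++ s' ++ v).
Proof.
move=> wf_d k_lt dk s_tails; pose D r := set_strand d k (u ++ r ++ v).
have D_size r : size (D r) = size d by apply: size_set_strand.
have dE : d = D s by rewrite /D -dk set_strand_id.
pose P r r' := all lover r -> wf m (D r) -> [/\ all lover r', wf m (D r') & D r <~> D r'].
move=> ss'; suff: P s s' by rewrite /P -dE => -[].
apply: perm_eq_adjacent_ind ss' => [r|r1 r2 r3 P12 P23|p x y q] r_tails wf_r.
- by split=> //; reflexivity.
- have [r2_tails wf_r2 r12] := P12 r_tails wf_r; have [r3_tails wf_r3 r23] := P23 r2_tails wf_r2.
  by split=> //; transitivity (D r2).
move: (r_tails); rewrite !all_cat /= => /and3P[p_tails /and3P[ox oy _] q_tails].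
have Dk : strand (D (p ++ [:: x; y] ++ q)) k = (u ++ p) ++ [:: x; y] ++ (q ++ v).
  by rewrite strand_set eqxx -!catA.
have xy_pair : at_pair (D (p ++ [:: x; y] ++ q)) k (size (u ++ p)) x y.
  by exists (u ++ p), (q ++ v).
have swapE : swap_at (D (p ++ [:: x; y] ++ q)) k (size (u ++ p)) = D (p ++ [:: y; x] ++ q).
  by rewrite (swap_atE Dk) /D set_strand_twice // -!catA.
have wf_r' : wf m (D (p ++ [:: y; x] ++ q)) by rewrite -swapE; apply: wf_swap_at xy_pair wf_r.
split=> //; first by rewrite p_tails ox oy.
apply: rst_step; split=> //; split=> //; do 3!right; left.
by exists k, (size (u ++ p)), x, y; rewrite swapE.
Qed.

Lemma tails_first_eq s : tails_first s -> s = filter lover s ++ heads s.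
Proof.
case/tails_first_split=> u [v [-> u_tails v_heads]]; rewrite /heads !filter_cat.
rewrite (all_filterP u_tails) (all_filterP v_heads).
rewrite (eq_in_filter (a2 := pred0)) ?filter_pred0 => [|l /(allP v_heads)/negPf //].
rewrite (eq_in_filter (s := u) (a2 := pred0)) ?filter_pred0 ?cats0 // => l /(allP u_tails) /= ->.
by [].
Qed.

Lemma ascending_OC d d' : ascending m d -> ascending m d' ->
  (forall k, heads (strand d k) = heads (strand d' k)) ->
  (forall k, perm_eq (filter lover (strand d k)) (filter lover (strand d' k))) -> d <~> d'.
Proof.
move=> [wf_d d_first] [wf_d' d'_first] same_heads perm_tails.
have dE k : strand d k = filter lover (strand d k) ++ heads (strand d' k).
  by rewrite -same_heads; apply/tails_first_eq/d_first.
have d'E k := tails_first_eq (d'_first k).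
have [sd sd'] := (wf_size wf_d, wf_size wf_d').
have mixed r : r <= m -> exists d1, [/\ wf m d1, d <~> d1 &
    forall k, strand d1 k = if k < r then strand d' k else strand d k].
  elim: r => [_|r IH r_lt]; first by exists d; split=> //; reflexivity.
  have [d1 [wf_d1 d_d1 d1E]] := IH (ltnW r_lt); have r_lt1 : r < size d1 by rewrite (wf_size wf_d1).
  have d1r : strand d1 r = [::] ++ filter lover (strand d r) ++ heads (strand d' r).
    by rewrite d1E ltnn cat0s -dE.
  have step := OC_block wf_d1 r_lt1 d1r (filter_all _ _) (perm_tails r).
  rewrite cat0s -d'E in step; exists (set_strand d1 r (strand d' r)); split.
  - apply: wf_perm wf_d1; first by rewrite size_set_strand.
    move=> k; rewrite strand_set; case: eqP => [->|_] //.
    by rewrite d1r cat0s [X in perm_eq _ X]d'E perm_cat2r.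
  - by transitivity d1.
  - move=> k; rewrite strand_set d1E [k < r.+1]ltnS [k <= r]leq_eqVlt.
    by case: eqVneq => [->|].
have [d1 [wf_d1 d_d1 d1E]] := mixed m (leqnn m).
suff <- : d1 = d' by [].
apply: eq_from_nth_nil => [|k]; first by rewrite (wf_size wf_d1) sd'.
by rewrite d1E; case: ltnP => // mk; rewrite !nth_default // ?sd ?sd'.
Qed.

Lemma tails_determined_by_heads d d' k l : wf m d -> wf m d' ->
  (forall i, heads (strand d i) = heads (strand d' i)) ->
  (forall i, head_word d i = head_word d' i) ->
  l \in strand d k -> lover l -> l \in strand d' k.
Proof.
move=> wf_d wf_d' same_heads same_words lk ol.
have /flatten_nthP[i hi] := wf_other_end wf_d (mem_nth_flatten lk).
have h_head : other_end l \in heads (strand d i).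
  by rewrite mem_filter hi andbT -[lover _]/(~~ lover l) negbK.
have hi' : other_end l \in strand d' i.
  by move: h_head; rewrite same_heads mem_filter => /andP[].
have same_strand : tail_strand d (lid l) = tail_strand d' (lid l).
  by have := same_words i; rewrite !head_wordE -same_heads => /eq_in_map/(_ _ h_head)[].
have /flatten_nthP[j lj] := wf_other_end wf_d' (mem_nth_flatten hi').
have l_other : other_end (other_end l) = l.
  by rewrite /other_end /lid /lover /= negbK; case: (l) => [[]].
rewrite l_other in lj.
by rewrite -(tail_strandE wf_d lk ol) same_strand (tail_strandE wf_d' lj ol).
Qed.

Lemma wf_relabel f d : injective f -> wf m d -> wf m (relabel f d).
Proof.
move=> f_inj /wfP[sd paired_d]; apply/wfP; rewrite size_map /relabel -map_flatten; split=> //.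
exact: paired_relabel.
Qed.

Lemma tail_strand_relabel f d c : injective f -> tail_strand (relabel f d) (f c) = tail_strand d c.
Proof.
move=> f_inj; rewrite /tail_strand find_map; apply: eq_find => s /=; rewrite has_map.
by apply: eq_has => l; rewrite /= /lid /= (inj_eq f_inj).
Qed.

Lemma strand_relabel f d k :
  strand (relabel f d) k = [seq (f (lid l), lover l, lsgn l) | l <- strand d k].
Proof. exact: nth_map_nil. Qed.

Lemma heads_relabel f d k :
  heads (strand (relabel f d) k) = [seq (f (lid l), lover l, lsgn l) | l <- heads (strand d k)].
Proof. by rewrite strand_relabel /heads filter_map. Qed.

Lemma head_word_relabel f d k : injective f -> head_word (relabel f d) k = head_word d k.
Proof.
move=> f_inj; rewrite !head_wordE heads_relabel -map_comp.
by apply: eq_map => l /=; rewrite tail_strand_relabel.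
Qed.

Lemma eq_heads s s' : all (predC lover) s -> all (predC lover) s' ->
  map lid s = map lid s' -> map lsgn s = map lsgn s' -> s = s'.
Proof.
elim: s s' => [|[[c o] e] s IH] [|[[c' o'] e'] s'] //=; rewrite /lover /lid /lsgn /=.
by move=> /andP[/negbTE -> s_heads] /andP[/negbTE -> s'_heads] [-> ids] [-> signs]; rewrite (IH s').
Qed.

Lemma relabel_heads d d' : wf m d -> wf m d' -> (forall k, head_word d k = head_word d' k) ->
  exists2 f, injective f & forall k, heads (strand (relabel f d) k) = heads (strand d' k).
Proof.
move=> wf_d wf_d' same_words; pose ids d0 := map (fun s => map lid (heads s)) (d0 : gdiag).
have idsE d0 k : nth [::] (ids d0) k = map lid (heads (strand d0 k)) by exact: nth_map_nil.
have uniq_ids d0 : wf m d0 -> uniq (flatten (ids d0)).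
  move=> wf_d0; rewrite /ids (map_comp (map lid) heads) -map_flatten /heads -filter_flatten.
  rewrite map_inj_in_uniq; first exact/filter_uniq/wf_uniq/wf_d0.
  move=> x y; rewrite !mem_filter => /andP[ox xd] /andP[oy yd] xy.
  by apply: (wf_endpoint_inj wf_d0 xd yd); rewrite /endpoint xy (negPf ox) (negPf oy).
have same_sizes k : size (nth [::] (ids d) k) = size (nth [::] (ids d') k).
  by rewrite !idsE !size_map; have := congr1 size (same_words k); rewrite !head_wordE !size_map.
have same_shape : shape (ids d) = shape (ids d').
  have nth_shape (ss : seq (seq nat)) k : nth 0 (shape ss) k = size (nth [::] ss k).
    have [k_lt|k_ge] := ltnP k (size ss); first by rewrite (nth_map [::]).
    by rewrite !nth_default ?size_map.
  apply: (@eq_from_nth _ 0) => [|k _]; first by rewrite !size_map (wf_size wf_d) (wf_size wf_d').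
  by rewrite !nth_shape.
have [|f f_inj f_ids] := injective_extension (uniq_ids d wf_d) (uniq_ids d' wf_d').
  by rewrite !size_flatten same_shape.
have f_idsE : map (map f) (ids d) = ids d'.
  apply: eq_from_flatten_shape; first by rewrite -map_flatten.
  by rewrite -same_shape /shape -map_comp; apply: eq_map => s /=; apply: size_map.
exists f => // k; have same_ids := congr1 (fun ss => nth [::] ss k) f_idsE.
rewrite /= nth_map_nil // !idsE -map_comp in same_ids.
have same_signs : map lsgn (heads (strand d k)) = map lsgn (heads (strand d' k)).
  by have := congr1 (map snd) (same_words k); rewrite !head_wordE -!map_comp.
by rewrite heads_relabel; apply: eq_heads; rewrite -?map_comp // ?all_map filter_all.
Qed.

Theorem ascending_unique d d' : ascending m d -> ascending m d' ->
  (forall k, k < m -> head_word d k = head_word d' k) -> d <~> d'.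
Proof.
move=> asc_d asc_d' words_m; have [[wf_d d_first] [wf_d' _]] := (asc_d, asc_d').
have same_words k : head_word d k = head_word d' k.
  have [/words_m //|mk] := ltnP k m.
  by rewrite /head_word !nth_default // (wf_size wf_d, wf_size wf_d').
have [f f_inj same_heads] := relabel_heads wf_d wf_d' same_words.
have wf_d1 := wf_relabel f_inj wf_d; set d1 := relabel f d in same_heads wf_d1.
have d1_words k : head_word d1 k = head_word d' k by rewrite head_word_relabel.
transitivity d1; first by apply: rst_step; split=> //; split=> //; do 4!right; left; exists f.
apply: ascending_OC => // [|k].
  split=> // k; rewrite strand_relabel.
  case/tails_first_split: (d_first k) => u [v [-> u_tails v_heads]].
  by rewrite map_cat tails_first_cat all_map u_tails tails_first_tails ?tails_first_heads ?all_map.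
apply: uniq_perm; rewrite ?filter_uniq ?(wf_uniq_strand wf_d1) ?(wf_uniq_strand wf_d') // => l.
rewrite !mem_filter; case ol: (lover l) => //=; apply/idP/idP => lk.
  exact: tails_determined_by_heads same_heads d1_words lk ol.
by apply: (tails_determined_by_heads wf_d' wf_d1) lk ol => i.
Qed.

End AscendingUniqueness.

(** * Inserting arrows *)

Lemma perm_set_strand d i s w : i < size d -> perm_eq s (w ++ strand d i) ->
  perm_eq (flatten (set_strand d i s)) (w ++ flatten d).
Proof.
elim: d i => [//|s0 d IH] [|i] /= i_lt perm_s; first by rewrite catA perm_cat2r.
by rewrite perm_sym perm_catCA perm_cat2l perm_sym; apply: IH.
Qed.

Section Extension.
Variables (m : nat) (d d' : gdiag).
Hypotheses (wf_d : wf m d) (wf_d' : wf m d').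
Hypothesis d_sub : forall k, {subset strand d k <= strand d' k}.

Lemma tail_strand_sub l : l \in flatten d -> tail_strand d' (lid l) = tail_strand d (lid l).
Proof.
move: l; apply: (wf_tail_ind wf_d (P := fun c => tail_strand d' c = tail_strand d c)) => k l lk ol.
by rewrite (tail_strandE wf_d lk ol) (tail_strandE wf_d' (d_sub lk) ol).
Qed.

Lemma reading_tail_meridian_sub k s : {subset s <= strand d k} ->
  reading (tail_meridian d') s = reading (tail_meridian d) s.
Proof.
move=> s_sub; apply: eq_reading => l /s_sub/mem_nth_flatten ld _.
by rewrite /tail_meridian tail_strand_sub.
Qed.

End Extension.

Lemma add_arrows m d A i j u v p q (d1 := set_strand d i (u ++ arrow_heads A ++ v))
    (d' := set_strand d1 j (p ++ arrow_tails A ++ q)) :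
  wf m d -> i < m -> j < m -> uniq (unzip1 A) -> (forall c, c \in unzip1 A -> fresh_for d c) ->
  strand d i = u ++ v -> strand d1 j = p ++ q ->
  [/\ wf m d', del (unzip1 A) d' = d, forall k, {subset strand d k <= strand d' k} &
      forall c, c \in unzip1 A -> tail_strand d' c = j].
Proof.
move=> wf_d im jm uA A_new di d1j; have sd := wf_size wf_d.
have sd1 : size d1 = size d by rewrite size_set_strand ?sd.
have sd' : size d' = size d by rewrite size_set_strand ?sd1 ?sd.
have wf_d' : wf m d'.
  apply: (wf_add_arrows wf_d sd' uA A_new).
  apply: perm_trans (_ : perm_eq _ (arrow_tails A ++ flatten d1)) _.
    by apply: perm_set_strand; rewrite ?sd1 ?sd // d1j perm_catCA.
  by rewrite perm_cat2l; apply: perm_set_strand; rewrite ?sd // di perm_catCA.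
have d_d1 k : {subset strand d k <= strand d1 k}.
  move=> l; rewrite strand_set; case: eqP => [->|//].
  by rewrite di !mem_cat => /orP[] ->; rewrite ?orbT.
have d1_d' k : {subset strand d1 k <= strand d' k}.
  move=> l; rewrite [strand d' k]strand_set; case: eqP => [->|//].
  by rewrite d1j !mem_cat => /orP[] ->; rewrite ?orbT.
split=> // [|k l /d_d1/d1_d' //|_ /mapP[[c e] cA ->]]; last first.
  apply: (@tail_strandE m d' j (Tl c e)) => //.
  by rewrite strand_set eqxx !mem_cat (map_f (fun x => Tl x.1 x.2) cA) orbT.
pose old := fun l : letter => lid l \notin unzip1 A.
have new_gone s : map lid s = unzip1 A -> filter old s = [::].
  move=> s_ids; apply/eqP; rewrite -[_ == _]negbK -has_filter; apply/hasPn => l ls.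
  by rewrite negbK -s_ids map_f.
have old_kept s k : {subset s <= strand d k} -> filter old s = s.
  move=> sk; apply/all_filterP/allP => l /sk/mem_nth_flatten ld; apply/negP => /A_new/negP; apply.
  exact: map_f.
have old_d1 k : filter old (strand d1 k) = strand d k.
  rewrite strand_set; case: eqP => [->|_]; last exact: (old_kept _ k).
  rewrite !filter_cat [filter old (arrow_heads A)]new_gone -?map_comp // -filter_cat -di.
  exact: (old_kept _ i).
apply: eq_from_nth_nil => [|k]; first by rewrite size_map.
rewrite strand_del strand_set -/old; case: eqP => [->|_] //.
by rewrite !filter_cat [filter old (arrow_tails A)]new_gone -?map_comp // -filter_cat -d1j.
Qed.

Lemma reading_arrow_heads t j A : (forall c, c \in unzip1 A -> t c = [:: (j, true)]) ->
  reading t (arrow_heads A) = [seq (j, e) | e <- unzip2 A].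
Proof.
elim: A => //= -[c e] A IH tA; rewrite -cat1s reading_cat IH => [|x xA]; last first.
  by apply: tA; rewrite inE xA orbT.
by rewrite reading_head // tA ?mem_head // expw_letter; case: e {tA}.
Qed.

Lemma head_word_split d k p s : tails_first (strand d k) -> head_word d k = p ++ s ->
  exists u v w,
    [/\ strand d k = u ++ v ++ w, all lover u, all (predC lover) v, all (predC lover) w &
      reading (tail_meridian d) v = p /\ reading (tail_meridian d) w = s].
Proof.
case/tails_first_split=> u [h [dk u_tails h_heads]] dk_word.
exists u, (take (size p) h), (drop (size p) h); rewrite cat_take_drop.
have heads_word r : all (predC lover) r ->
    reading (tail_meridian d) r = [seq (tail_strand d (lid l), lsgn l) | l <- r].
  by rewrite reading_tail_meridian => /all_filterP; rewrite /heads => ->.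
have [take_heads drop_heads] :
    all (predC lover) (take (size p) h) /\ all (predC lover) (drop (size p) h).
  by apply/andP; rewrite -all_cat cat_take_drop.
rewrite !heads_word // map_take map_drop -heads_word //.
have <- : p ++ s = reading (tail_meridian d) h.
  by rewrite -dk_word /head_word dk reading_cat reading_tails.
by rewrite take_size_cat // drop_size_cat.
Qed.

Lemma insert_arrows m d i j es p s : ascending m d -> i < m -> j < m -> head_word d i = p ++ s ->
  exists d' A, [/\ ascending m d', head_word d' i = p ++ [seq (j, e) | e <- es] ++ s &
      forall k, k != i -> head_word d' k = head_word d k] /\
    [/\ unzip2 A = es, uniq (unzip1 A), d = del (unzip1 A) d',
        exists u v, strand d' j = u ++ arrow_tails A ++ v &
        exists u v, strand d' i = u ++ arrow_heads A ++ v].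
Proof.
move=> [wf_d d_first] im jm di_word.
have [u [v [w [di u_tails v_heads w_heads [v_word w_word]]]]] :=
  head_word_split (d_first i) di_word.
pose A := zip (iota (fresh d) (size es)) es.
have A_ids : unzip1 A = iota (fresh d) (size es) by rewrite unzip1_zip ?size_iota.
have A_signs : unzip2 A = es by rewrite unzip2_zip ?size_iota.
have uA : uniq (unzip1 A) by rewrite A_ids iota_uniq.
have A_new c : c \in unzip1 A -> fresh_for d c.
  by rewrite A_ids mem_iota => /andP[/fresh_forP].
pose d1 := set_strand d i ((u ++ v) ++ arrow_heads A ++ w).
pose d' := set_strand d1 j ([::] ++ arrow_tails A ++ strand d1 j).
rewrite catA in di.
have [wf_d' del_d' d_d' A_strand] :=
  add_arrows wf_d im jm uA A_new di (erefl : strand d1 j = [::] ++ _).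
rewrite -/d1 -/d' in wf_d' del_d' d_d' A_strand.
pose front k := if k == j then arrow_tails A else [::].
have front_tails k : all lover (front k).
  by rewrite /front; case: ifP => // _; apply: all_arrow_tails.
have d'E k : strand d' k = front k ++ strand d1 k.
  by rewrite [LHS]strand_set /front; case: eqP => // ->.
have d1i : strand d1 i = (u ++ v) ++ arrow_heads A ++ w by rewrite strand_set eqxx.
have d1E k : k != i -> strand d1 k = strand d k by rewrite strand_set => /negPf ->.
have old_word k r : {subset r <= strand d k} ->
    reading (tail_meridian d') r = reading (tail_meridian d) r.
  exact: (reading_tail_meridian_sub wf_d wf_d' d_d').
have v_sub : {subset v <= strand d i} by move=> l lv; rewrite di !mem_cat lv orbT.
have w_sub : {subset w <= strand d i} by move=> l lw; rewrite di !mem_cat lw orbT.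
exists d', A; split; split=> //.
- split=> // k; rewrite d'E tails_first_cat front_tails tails_first_tails //=.
  have [->|ki] := eqVneq k i; last by rewrite d1E.
  rewrite d1i -catA tails_first_cat u_tails tails_first_tails //=.
  by apply: tails_first_heads; rewrite !all_cat v_heads w_heads all_arrow_heads.
- rewrite /head_word d'E d1i !reading_cat.
  rewrite (reading_tails _ (front_tails i)) (reading_tails _ u_tails) /=.
  rewrite (old_word i v) // v_word (old_word i w) // w_word.
  rewrite (reading_arrow_heads (j := j)) ?A_signs // => c /A_strand.
  by rewrite /tail_meridian => ->.
- by move=> k ki; rewrite /head_word d'E d1E // reading_cat reading_tails // (old_word k).
- by exists [::], (strand d1 j); rewrite d'E /front eqxx.
- by exists (front i ++ u ++ v), w; rewrite d'E d1i -!catA.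
Qed.

(* The only obstruction for f to be ascending is the tail of c on strand j, which
   stands behind the heads h. *)
Record late_tail m (f : gdiag) i j c (u h w p s : seq letter) : Prop := LateTail {
  late_wf : wf m f;
  late_neq : i != j;
  late_tails_first : forall k, k != j -> tails_first (strand f k);
  late_tail_strand : strand f j = u ++ h ++ Tl c true :: w;
  late_head_strand : strand f i = p ++ Hl c true :: s;
  late_tails : all lover u;
  late_heads_before : all (predC lover) h;
  late_heads_after : all (predC lover) w
}.

Section LateTail.
Variables (m : nat) (f : gdiag) (i j c : nat) (u h w p s : seq letter).
Hypothesis late : late_tail m f i j c u h w p s.

Let wf_f : wf m f. Proof. exact: late_wf late. Qed.
Let ij : i != j. Proof. exact: late_neq late. Qed.
Let fj : strand f j = u ++ h ++ Tl c true :: w. Proof. exact: late_tail_strand late. Qed.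
Let fi : strand f i = p ++ Hl c true :: s. Proof. exact: late_head_strand late. Qed.

Definition conjugated_meridian : nat -> aword :=
  [eta tail_meridian f with c |-> conjw [:: (j, true)] (reading (tail_meridian f) h)].

Let tail_c : Tl c true \in strand f j.
Proof. by rewrite fj !mem_cat mem_head !orbT. Qed.

Let head_c : Hl c true \in strand f i.
Proof. by rewrite fi mem_cat mem_head orbT. Qed.

Let head_c_strand k : k != i -> Hl c true \notin strand f k.
Proof. by apply: contraNN => head_ck; apply/eqP/(wf_same_strand wf_f head_ck head_c). Qed.

Lemma conjugated_meridianE k : k != c -> conjugated_meridian k = tail_meridian f k.
Proof. by rewrite /conjugated_meridian /= => /negPf ->. Qed.

Lemma reading_conjugated_meridian r k : {subset r <= strand f k} -> Hl c true \notin r ->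
  reading conjugated_meridian r = reading (tail_meridian f) r.
Proof.
move=> rk cr; apply: eq_reading => l lr ol; apply: conjugated_meridianE.
apply: (wf_lid_neq wf_f (mem_nth_flatten head_c) (mem_nth_flatten (rk l lr)) (negPf ol)).
by apply: contraNneq cr => <-.
Qed.

Lemma conjugated_meridian_coloring : coloring eq f conjugated_meridian.
Proof.
have tail_t k l : l \in strand f k -> lover l -> l != Tl c true ->
    conjugated_meridian (lid l) = [:: (k, true)].
  move=> lk ol l_c; rewrite conjugated_meridianE; last first.
    exact: (wf_lid_neq wf_f (mem_nth_flatten tail_c) (mem_nth_flatten lk) ol l_c).
  by rewrite /tail_meridian (tail_strandE wf_f lk ol).
move=> k; have [->|kj] := eqVneq k j; last first.
  have [r [q [fk r_tails q_heads]]] := tails_first_split (late_tails_first late kj).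
  rewrite fk; apply/strand_coloring_cat; split; last exact: strand_coloring_heads.
  apply: strand_coloring_tails => // l lr; have lk : l \in strand f k by rewrite fk mem_cat lr.
  apply: tail_t; rewrite ?(allP r_tails) //; apply: contra kj => /eqP l_c.
  by rewrite l_c in lk; apply/eqP/(wf_same_strand wf_f lk tail_c).
have ji : j != i by rewrite eq_sym.
have uh_sub : {subset u ++ h <= strand f j} by move=> l l_uh; rewrite fj catA mem_cat l_uh.
have uh_reading : reading conjugated_meridian (u ++ h) = reading (tail_meridian f) h.
  rewrite (reading_conjugated_meridian uh_sub) ?reading_cat ?(reading_tails _ (late_tails late)) //.
  by apply: contraNN (head_c_strand ji) => /uh_sub.
rewrite fj catA; apply/strand_coloring_cat; split.
  apply/strand_coloring_cat; split; last exact: strand_coloring_heads (late_heads_before late).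
  apply: strand_coloring_tails (late_tails late) _ => l lu.
  apply: tail_t; rewrite ?(allP (late_tails late)) //.
    by apply: uh_sub; rewrite mem_cat lu.
  apply/eqP => l_c; have := wf_uniq_strand wf_f j; rewrite fj catA -cat1s => uh_uniq.
  have [/negP + _] := uniq_cat_mem uh_uniq (mem_head (Tl c true) [::]).
  by apply; rewrite -l_c mem_cat lu.
rewrite uh_reading; split; first by rewrite /conjugated_meridian /= eqxx.
exact: strand_coloring_heads (late_heads_after late).
Qed.

Lemma late_tail_self_free : self_free (h ++ Tl c true :: w).
Proof.
have tail_eq l : l \in h ++ Tl c true :: w -> lover l -> l = Tl c true.
  rewrite mem_cat inE => /or3P[lh|/eqP ->|lw] ol //.
    by have := allP (late_heads_before late) l lh; rewrite /= ol.
  by have := allP (late_heads_after late) l lw; rewrite /= ol.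
have head_lid l : l \in h ++ Tl c true :: w -> ~~ lover l -> lid l != c.
  move=> lr ol; have lj : l \in strand f j by rewrite fj mem_cat lr orbT.
  apply: (wf_lid_neq wf_f (mem_nth_flatten head_c) (mem_nth_flatten lj) (negPf ol)).
  by apply: contraTneq lj => ->; apply: head_c_strand; rewrite eq_sym.
move=> x y xr yr; case ox: (lover x); case oy: (lover y) => // xy.
  by have := head_lid y yr; rewrite oy -xy (tail_eq x) // eqxx => /(_ isT).
by have := head_lid x xr; rewrite ox xy (tail_eq y) // eqxx => /(_ isT).
Qed.

(* Pushing the tail of c in front of the heads h conjugates its letter by their word. *)
Lemma conjugated_arrow n : exists d, [/\ Vn_sv_equiv m n f d, ascending m d,
    head_word d i = reading (tail_meridian f) p ++
      conjw [:: (j, true)] (reading (tail_meridian f) h) ++ reading (tail_meridian f) s &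
    forall k, k != i -> head_word d k = reading (tail_meridian f) (strand f k)].
Proof.
have [d [wf_d f_d d_j d_exact d_first]] :=
  push_tails n wf_f fj (late_tails late) late_tail_self_free.
have [t col_d t_f] := d_exact _ conjugated_meridian_coloring.
have asc_d : ascending m d.
  by split=> // k; have [->|kj] := eqVneq k j; last exact/d_first/(late_tails_first late).
have d_word k : head_word d k = reading conjugated_meridian (strand f k).
  by rewrite -t_f (ascending_reading k asc_d col_d).
exists d; split=> // [|k ki]; last first.
  by rewrite d_word (reading_conjugated_meridian (k := k)) ?head_c_strand.
have := wf_uniq_strand wf_f i; rewrite fi -cat1s => i_uniq.
have [cp cs] := uniq_cat_mem i_uniq (mem_head (Hl c true) [::]).
rewrite d_word fi -cat1s !reading_cat reading_head //.
rewrite (reading_conjugated_meridian (k := i) _ cp) => [|l lp]; last by rewrite fi mem_cat lp.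
rewrite (reading_conjugated_meridian (k := i) _ cs) => [|l ls].
  by rewrite /conjugated_meridian /= eqxx.
by rewrite fi mem_cat inE ls !orbT.
Qed.
End LateTail.

Lemma late_tail_del m f i j c u h w p s a (P := fun l : letter => lid l \notin [:: a]) :
  late_tail m f i j c u h w p s -> a != c ->
  late_tail m (del [:: a] f) i j c (filter P u) (filter P h) (filter P w) (filter P p) (filter P s).
Proof.
move=> [wf_f ij f_first fj fi u_tails h_heads w_heads] ac.
have all_P Q t : all Q t -> all Q (filter P t).
  by rewrite all_filter; apply: sub_all => x /= ->; rewrite implybT.
have Pc o e : lid (c, o, e) \notin [:: a] by rewrite inE /lid /= eq_sym.
split=> //; rewrite ?strand_del ?fj ?fi ?filter_cat /= ?Pc //.
- exact: wf_del.
- by move=> k kj; rewrite strand_del; apply: pairwise_filter (f_first k kj).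
- exact: all_P.
- exact: all_P.
- exact: all_P.
Qed.

Lemma reading_del m f a e k s : wf m f -> Hl a e \in flatten f -> {subset s <= strand f k} ->
  Hl a e \notin s ->
  reading (tail_meridian (del [:: a] f)) (filter (fun l => lid l \notin [:: a]) s) =
  reading (tail_meridian f) s.
Proof.
move=> wf_f Ha s_sub s_a; have del_sub k' : {subset strand (del [:: a] f) k' <= strand f k'}.
  by move=> l; rewrite strand_del mem_filter => /andP[].
rewrite -(reading_tail_meridian_sub (wf_del _ wf_f) wf_f del_sub (k := k)) => [|l].
  apply: reading_filter => l ls ol; rewrite inE.
  apply: (wf_lid_neq wf_f Ha (mem_nth_flatten (s_sub l ls)) (negPf ol)).
  by apply: contraNneq s_a => <-.
by rewrite strand_del !mem_filter => /andP[-> /s_sub].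
Qed.

Lemma late_tail_del_head m f i j c u h w p s a (f' := del [:: a] f)
    (keep := filter (fun l : letter => lid l \notin [:: a])) :
  late_tail m f i j c u (rcons h (Hl a true)) w p s -> tail_strand f a = j ->
  [/\ late_tail m f' i j c (keep u) (keep h) (keep w) (keep p) (keep s), self_arrow f j a,
    forall k z, k != j -> {subset z <= strand f k} ->
      reading (tail_meridian f') (keep z) = reading (tail_meridian f) z,
    reading (tail_meridian f') (keep h) = reading (tail_meridian f) h &
    reading (tail_meridian f') (keep w) = reading (tail_meridian f) w].
Proof.
move=> late fa; have [wf_f ij _ fj fi _ _ _] := late.
have Haj : Hl a true \in strand f j by rewrite fj !mem_cat mem_rcons mem_head orbT.
have Haf := mem_nth_flatten Haj.
have Hci : Hl c true \in strand f i by rewrite fi mem_cat mem_head orbT.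
have ac : a != c.
  by apply: contra_neq ij => a_c; apply: (wf_same_strand wf_f Hci Haj); rewrite a_c.
have keep_h : keep (rcons h (Hl a true)) = keep h by rewrite /keep filter_rcons inE eqxx.
have [h_sub w_sub] : {subset h <= strand f j} /\ {subset w <= strand f j}.
  by split=> l lz; rewrite fj !mem_cat mem_rcons !inE lz ?orbT.
have [Ha_h Ha_w] : Hl a true \notin h /\ Hl a true \notin w.
  have := wf_uniq_strand wf_f j; rewrite fj cat_rcons -cat1s catA.
  case/uniq_cat_mem/(_ (mem_head _ _)).
  by rewrite mem_cat inE !negb_or => /andP[_ ->] /andP[_ ->].
split.
- by rewrite -keep_h; apply: late_tail_del late ac.
- rewrite /self_arrow /= -{1}fa (tail_strand_tail wf_f Haf) andbT.
  exact: (map_f endpoint Haj).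
- move=> k z kj z_sub; apply: (reading_del wf_f Haf z_sub).
  by apply: contra kj => /z_sub Hak; apply/eqP/(wf_same_strand wf_f Hak Haj).
- exact: (reading_del wf_f Haf h_sub).
- exact: (reading_del wf_f Haf w_sub).
Qed.

Lemma late_tail_exists m e i j p s g r : ascending m e -> i < m -> j < m -> i != j ->
  head_word e i = p ++ s -> head_word e j = g ++ r ->
  exists f c u h w x y, late_tail m f i j c u h w x y /\
    [/\ reading (tail_meridian f) h = g, reading (tail_meridian f) w = r,
      reading (tail_meridian f) x = p, reading (tail_meridian f) y = s &
      forall k, k != i -> k != j -> reading (tail_meridian f) (strand f k) = head_word e k].
Proof.
move=> [wf_e e_first] im jm ij ei_word ej_word.
have [u1 [x [y [ei u1_tails x_heads y_heads [<- <-]]]]] := head_word_split (e_first i) ei_word.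
have [u [h [w [ej u_tails h_heads w_heads [<- <-]]]]] := head_word_split (e_first j) ej_word.
pose c := fresh e.
pose d1 := set_strand e i ((u1 ++ x) ++ [:: Hl c true] ++ y).
have d1j : strand d1 j = (u ++ h) ++ w by rewrite strand_set eq_sym (negPf ij) ej catA.
pose f := set_strand d1 j ((u ++ h) ++ [:: Tl c true] ++ w).
have ei' : strand e i = (u1 ++ x) ++ y by rewrite ei catA.
have [] := add_arrows (A := [:: (c, true)]) wf_e im jm isT _ ei' d1j.
  by move=> _ /[1!inE] /eqP ->; apply: fresh_forP.
rewrite -/f => wf_f _ e_f _.
have fi : strand f i = (u1 ++ x) ++ Hl c true :: y by rewrite strand_set (negPf ij) strand_set eqxx.
have fj : strand f j = u ++ h ++ Tl c true :: w by rewrite strand_set eqxx -catA.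
have fE k : k != i -> k != j -> strand f k = strand e k.
  by move=> /negPf ki /negPf kj; rewrite !strand_set ki kj.
have old_word k t : {subset t <= strand e k} ->
  reading (tail_meridian f) t = reading (tail_meridian e) t.
  exact: (reading_tail_meridian_sub wf_e wf_f e_f).
exists f, c, u, h, w, (u1 ++ x), y; split.
  split=> // k kj; have [->|ki] := eqVneq k i; last by rewrite fE.
  rewrite fi -catA tails_first_cat u1_tails tails_first_tails //=.
  by rewrite tails_first_heads // all_cat x_heads /= y_heads.
rewrite reading_cat (reading_tails _ u1_tails).
split; last by move=> k ki kj; rewrite fE // (old_word k).
- by apply: (old_word j) => l lh; rewrite ej !mem_cat lh orbT.
- by apply: (old_word j) => l lw; rewrite ej !mem_cat lw !orbT.
- by apply: (old_word i) => l lx; rewrite ei !mem_cat lx orbT.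
- by apply: (old_word i) => l ly; rewrite ei !mem_cat ly !orbT.
Qed.

(** * Families of longitudes *)

Section WordFamilies.
Variables (m n : nat).
Local Notation "d <~> d'" := (Vn_sv_equiv m n d d') (at level 70).
Implicit Types (ws : nat -> aword) (g p s : aword).

Definition word_family ws : Prop := forall k, k < m -> word_in (gtn m) (ws k).

Definition set_word ws i w : nat -> aword := [eta ws with i |-> w].

Definition realizes d ws : Prop := ascending m d /\ forall k, k < m -> head_word d k = ws k.

Definition words_equiv ws ws' : Prop := exists d d', [/\ realizes d ws, realizes d' ws' & d <~> d'].

Lemma set_word_id ws i : set_word ws i (ws i) =1 ws.
Proof. by move=> k; rewrite /set_word /=; case: eqVneq => [->|]. Qed.

Lemma realizes_unique d d' ws : realizes d ws -> realizes d' ws -> d <~> d'.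
Proof.
by move=> [asc_d d_ws] [asc_d' d'_ws]; apply: ascending_unique => // k km; rewrite d_ws // d'_ws.
Qed.

Lemma realizes_eq d ws ws' : ws =1 ws' -> realizes d ws -> realizes d ws'.
Proof. by move=> eq_ws [asc_d d_ws]; split=> // k km; rewrite -eq_ws d_ws. Qed.

Lemma words_equivP d d' ws ws' : words_equiv ws ws' -> realizes d ws -> realizes d' ws' -> d <~> d'.
Proof.
move=> [e [e' [e_ws e'_ws' e_e']]] d_ws d'_ws'; rewrite (realizes_unique d_ws e_ws) e_e'.
exact: realizes_unique e'_ws' d'_ws'.
Qed.

Lemma words_equiv_sym ws ws' : words_equiv ws ws' -> words_equiv ws' ws.
Proof. by case=> d [d' [d_ws d'_ws' d_d']]; exists d', d; split=> //; symmetry. Qed.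

Lemma words_equiv_trans ws ws' ws'' :
  words_equiv ws ws' -> words_equiv ws' ws'' -> words_equiv ws ws''.
Proof.
move=> [d [d' [d_ws d'_ws' d_d']]] [e [e' [e_ws' e'_ws'' e_e']]]; exists d, e'; split=> //.
by rewrite d_d' (realizes_unique d'_ws' e_ws').
Qed.

Lemma words_equiv_eq ws ws' us us' : ws =1 us -> ws' =1 us' ->
  words_equiv ws ws' -> words_equiv us us'.
Proof.
move=> eq_ws eq_ws' [d [d' [d_ws d'_ws' d_d']]]; exists d, d'.
by split=> //; [apply: realizes_eq d_ws | apply: realizes_eq d'_ws'].
Qed.

Lemma ascending_word_family d : ascending m d -> word_family (head_word d).
Proof.
move=> [wf_d _] k _; apply/allP => x; rewrite head_wordE => /mapP[l + ->].
rewrite mem_filter => /andP[_ /mem_nth_flatten ld] /=; move: l ld.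
apply: (wf_tail_ind wf_d (P := fun c => tail_strand d c < m)) => i l li ol.
by rewrite (tail_strandE wf_d li ol) -(wf_size wf_d) (mem_nth_lt li).
Qed.

Lemma ascending_insert_word d i p w s : ascending m d -> i < m -> word_in (gtn m) w ->
  head_word d i = p ++ s -> exists d', [/\ ascending m d', head_word d' i = p ++ w ++ s &
    forall k, k != i -> head_word d' k = head_word d k].
Proof.
move=> asc_d im; elim: w => [|[j e] w IH] /=; first by exists d.
case/andP=> jm /IH{}IH /IH[d1 [asc_d1 d1_i d1_d]].
have [d' [_ [[asc_d' d'_i d'_d1] _]]] := insert_arrows [:: e] asc_d1 im jm d1_i.
by exists d'; split=> // k ki; rewrite d'_d1 ?d1_d.
Qed.

Lemma realizes_exists ws : word_family ws -> exists d, realizes d ws.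
Proof.
move=> ws_m; suff [d [asc_d d_lt _]] : exists d, [/\ ascending m d,
    forall k, k < m -> head_word d k = ws k & forall k, m <= k -> head_word d k = [::]] by exists d.
suff: forall r, r <= m -> exists d, [/\ ascending m d,
    forall k, k < r -> head_word d k = ws k & forall k, r <= k -> head_word d k = [::]] by apply.
elim=> [_|r IH rm].
  have empty k : strand (nseq m [::]) k = [::] by rewrite nth_nseq if_same.
  exists (nseq m [::]); split=> // [|k _]; last by rewrite /head_word empty.
  split=> [|k]; last by rewrite empty.
  apply/wfP; rewrite size_nseq; split=> //; suff -> : flatten (nseq m [::]) = [::] by [].
  by elim: (m).
have [d [asc_d d_lt d_ge]] := IH (ltnW rm).
have [d' [asc_d' d'_r d'_d]] :=
  ascending_insert_word (p := [::]) asc_d rm (ws_m r rm) (d_ge r (leqnn r)).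
exists d'; split=> // k; last by move=> rk; rewrite d'_d ?d_ge // ?(ltnW rk) ?gtn_eqF.
rewrite [k < r.+1]ltnS [k <= r]leq_eqVlt => /predU1P[->|kr]; first by rewrite d'_r cats0.
by rewrite d'_d ?d_lt // ltn_eqF.
Qed.

Lemma words_equiv_refl ws : word_family ws -> words_equiv ws ws.
Proof. by case/realizes_exists=> d d_ws; exists d, d; split=> //; reflexivity. Qed.

Lemma word_family_set ws i w : word_family ws -> word_in (gtn m) w -> word_family (set_word ws i w).
Proof. by move=> ws_m w_m k km; rewrite /set_word /=; case: eqP => // _; apply: ws_m. Qed.

Definition word_equiv ws i w w' : Prop := words_equiv (set_word ws i w) (set_word ws i w').

Lemma word_equiv_insert ws i j es p s : word_family ws -> word_in (gtn m) (p ++ s) ->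
  i < m -> j < m ->
  (forall d A, wf m d -> unzip2 A = es -> uniq (unzip1 A) ->
    (exists u v, strand d j = u ++ arrow_tails A ++ v) ->
    (exists u v, strand d i = u ++ arrow_heads A ++ v) -> del (unzip1 A) d <~> d) ->
  word_equiv ws i (p ++ s) (p ++ [seq (j, e) | e <- es] ++ s).
Proof.
move=> ws_m ps_m im jm move_d.
have [d d_ws] := realizes_exists (word_family_set i ws_m ps_m); have [asc_d d_word] := d_ws.
have di : head_word d i = p ++ s by rewrite d_word // /set_word /= eqxx.
have [d' [A [[asc_d' d'_i d'_d] [A_es uA d_del dj' di']]]] := insert_arrows es asc_d im jm di.
exists d, d'; split=> //; last by rewrite d_del; apply: move_d => //; case: asc_d'.
split=> // k km; rewrite /set_word /=; case: eqVneq => [->|ki] //.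
by rewrite d'_d ?d_word // /set_word /= (negPf ki).
Qed.

Lemma word_equiv_cancel ws i j e p s : word_family ws -> word_in (gtn m) (p ++ s) ->
  i < m -> j < m -> word_equiv ws i (p ++ s) (p ++ [:: (j, e); (j, ~~ e)] ++ s).
Proof.
move=> ws_m ps_m im jm; apply: (word_equiv_insert (es := [:: e; ~~ e])) => // d.
move=> [|[c e1] [|[c' e2] []]] //= wf_d [-> ->] _ [u [v dj]] [u' [v' di]].
apply: rst_step; split; first exact: wf_del.
split=> //; right; left; exists c, c', e; split=> //.
by split; left; [exists j, u, v | exists i, u', v'].
Qed.

Lemma word_equiv_power ws i j p s : word_family ws -> word_in (gtn m) (p ++ s) ->
  i < m -> j < m -> word_equiv ws i (p ++ s) (p ++ nseq n (j, true) ++ s).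
Proof.
move=> ws_m ps_m im jm.
have -> : nseq n (j, true) = [seq (j, e) | e <- nseq n true] by rewrite map_nseq.
apply: word_equiv_insert => // d A wf_d A_signs uA [u [v dj]] [u' [v' di]].
apply: rst_step; split; first exact: wf_del.
have sA : size A = n by rewrite -(size_map snd) -/(unzip2 A) A_signs size_nseq.
have A_in x : x \in A -> (x.1 \in unzip1 A) && (x.2 == true).
  move=> xA; rewrite map_f //; have := map_f snd xA; rewrite -/(unzip2 A) A_signs.
  by rewrite mem_nseq => /andP[_].
split=> //; do 5!right; left; exists (unzip1 A), true, (arrow_tails A), (arrow_heads A).
rewrite !size_map !all_map; split=> //; do 4!split=> //.
  by split; [apply/allP => x /A_in | split; [apply/allP => x /A_in |
    split; [exists j, u, v | exists i, u', v']]].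
Qed.

Lemma word_equiv_self ws i e p s : word_family ws -> word_in (gtn m) (p ++ s) -> i < m ->
  word_equiv ws i (p ++ s) (p ++ (i, e) :: s).
Proof.
move=> ws_m ps_m im; apply: (word_equiv_insert (es := [:: e])) => // d.
move=> [|[c e1] []] //= wf_d [->] _ [u [v du]] [u' [v' du']].
apply: (sv_equiv n (i := i)) => //; apply/self_arrowP.
by exists (Tl c e), (Hl c e); rewrite du mem_cat mem_head orbT -du du' mem_cat mem_head orbT.
Qed.

Lemma word_equiv_mulV ws i g p s : word_family ws -> word_in (gtn m) (p ++ g ++ s) -> i < m ->
  word_equiv ws i (p ++ s) (p ++ g ++ invw g ++ s).
Proof.
move=> ws_m + im; elim: g p s => [|[j e] g IH] p s.
  by move=> ps_m; apply/words_equiv_refl/word_family_set.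
rewrite /word_in !all_cat /= => /and3P[p_m /andP[jm g_m] s_m].
apply: words_equiv_trans (word_equiv_cancel e ws_m _ im jm) _.
  by rewrite /word_in all_cat p_m.
rewrite [invw (_ :: g)]rev_cons cat_rcons /= -!(cat_rcons (j, e)); apply: IH.
by rewrite /word_in !all_cat all_rcons /= jm p_m g_m.
Qed.

Lemma late_tail_realizes ws f i j c u h w x y : late_tail m f i j c u h w x y ->
  (forall k, k < m -> k != i -> k != j -> reading (tail_meridian f) (strand f k) = ws k) ->
  exists2 d, f <~> d & realizes d (set_word (set_word ws i
    (reading (tail_meridian f) x ++ conjw [:: (j, true)] (reading (tail_meridian f) h) ++
     reading (tail_meridian f) y)) j (reading (tail_meridian f) h ++ reading (tail_meridian f) w)).
Proof.
move=> late f_word; have [d [f_d asc_d d_i d_k]] := conjugated_arrow late n.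
exists d => //; split=> // k km; rewrite /set_word /=; case: (eqVneq k j) => [->|kj].
  rewrite d_k; last by rewrite eq_sym (late_neq late).
  rewrite (late_tail_strand late) -cat1s !reading_cat reading_tails ?(late_tails late) //.
by case: eqVneq => [->|ki] //; rewrite d_k // f_word.
Qed.

(* Removing the self-arrow a shortens the word that conjugates the letter of the arrow c
   standing behind the head of a. *)
Lemma words_equiv_self_conjw ws i j p s g v : word_family ws -> i < m -> j < m -> i != j ->
  word_in (gtn m) (p ++ s) -> word_in (gtn m) (g ++ v) ->
  words_equiv (set_word (set_word ws i (p ++ conjw [:: (j, true)] g ++ s)) j (g ++ v))
    (set_word (set_word ws i (p ++ conjw [:: (j, true)] (rcons g (j, true)) ++ s)) j
       (g ++ (j, true) :: v)).
Proof.
move=> ws_m im jm ij ps_m gv_m.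
have [e [asc_e e_word]] :
    exists e, realizes e (set_word (set_word ws i (p ++ s)) j (rcons g (j, true) ++ v)).
  apply/realizes_exists/word_family_set; first exact: word_family_set.
  by move: gv_m; rewrite /word_in !all_cat all_rcons /= jm.
have ei_word : head_word e i = p ++ s by rewrite e_word // /set_word /= (negPf ij) eqxx.
have ej_word : head_word e j = rcons g (j, true) ++ v by rewrite e_word // /set_word /= eqxx.
have [f [c [u [h [w [x [y [late [h_word w_word x_word y_word f_word]]]]]]]]] :=
  late_tail_exists asc_e im jm ij ei_word ej_word.
have {e_word}f_word k : k < m -> k != i -> k != j -> reading (tail_meridian f) (strand f k) = ws k.
  by move=> km ki kj; rewrite f_word // e_word // /set_word /= (negPf kj) (negPf ki).
have [h0 [a [h_eq h0_word fa]]] : exists h0 a, [/\ h = rcons h0 (Hl a true),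
    reading (tail_meridian f) h0 = g & tail_strand f a = j].
  move: (late_heads_before late) h_word; clear late; case/lastP: h => [|h0 l]; first by case: (g).
  rewrite all_rcons /= => /andP[ol h0_heads]; rewrite -cats1 reading_cat.
  rewrite [reading _ [:: l]]reading_tail_meridian /heads /= ol /= cats1.
  move=> /rcons_inj[<- fl l_pos]; exists h0, (lid l); split=> //.
  by rewrite cats1; case: l ol l_pos {fl} => [[a []] []].
have [d' f_d' d'_ws] := late_tail_realizes late f_word.
rewrite h_word w_word x_word y_word cat_rcons in d'_ws; rewrite h_eq in late.
have [late_a self_a keep_word h0_del w_del] := late_tail_del_head late fa.
have [k km ki kj|d f_d] := late_tail_realizes late_a (ws := ws) _.
  by rewrite strand_del (keep_word k) ?f_word.
rewrite h0_del w_del !(keep_word i) // => [|l ly|l lx]; last first.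
- by rewrite (late_head_strand late) mem_cat lx.
- by rewrite (late_head_strand late) mem_cat inE ly !orbT.
rewrite h0_word w_word x_word y_word => d_ws; exists d, d'; split=> //.
by rewrite -f_d (sv_equiv n (late_wf late) self_a).
Qed.

Lemma words_equiv_mulV ws j g : word_family ws -> j < m -> word_in (gtn m) g ->
  words_equiv ws (set_word ws j (g ++ invw g ++ ws j)).
Proof.
move=> ws_m jm g_m; apply: words_equiv_eq (set_word_id ws j) (frefl _) _.
by apply: (word_equiv_mulV (p := [::])) => //; rewrite /= word_in_cat g_m; apply: ws_m.
Qed.

Lemma word_equiv_commute ws i j g p s : word_family ws -> i < m -> j < m -> i != j ->
  word_in (gtn m) (p ++ s) -> word_in (gtn m) g ->
  word_equiv ws i (p ++ conjw [:: (j, true)] g ++ s)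
    (p ++ conjw [:: (j, true)] (rcons g (j, true)) ++ s).
Proof.
move=> ws_m im jm ij ps_m g_m; set u := p ++ _ ++ s; set u' := p ++ _ ++ s.
have gv_m : word_in (gtn m) (g ++ invw g ++ ws j).
  by rewrite !word_in_cat word_in_invw g_m; apply: ws_m.
have insert_gV w : word_in (gtn m) w ->
    words_equiv (set_word ws i w) (set_word (set_word ws i w) j (g ++ invw g ++ ws j)).
  move=> w_m; have <- : set_word ws i w j = ws j by rewrite /set_word /= eq_sym (negPf ij).
  exact: words_equiv_mulV (word_family_set i ws_m w_m) jm g_m.
have [u_m u'_m] : word_in (gtn m) u /\ word_in (gtn m) u'.
  move: ps_m; rewrite !(word_in_cat _ p) !(word_in_cat _ _ s) !word_in_conjw => /andP[-> ->].
  by rewrite -[rcons g _]cats1 word_in_cat g_m /word_in /= jm.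
apply: words_equiv_trans (insert_gV u u_m) _.
apply: words_equiv_trans (words_equiv_self_conjw ws_m im jm ij ps_m gv_m) _.
apply: words_equiv_trans (words_equiv_sym (insert_gV u' u'_m)).
by apply/words_equiv_sym/word_equiv_self => //; apply: word_family_set.
Qed.

Definition others i : pred nat := [pred j | (j < m) && (j != i)].

Lemma word_equiv_reduced ws i u v : word_family ws -> i < m -> word_in (gtn m) u ->
  reduced_congr n (others i) u v -> word_equiv ws i u v.
Proof.
move=> ws_m im u_m uv; suff: word_in (gtn m) u = word_in (gtn m) v /\
    (word_in (gtn m) u -> word_equiv ws i u v) by case=> _; apply.
elim: uv {u_m} => [{}u {}v| |{}u {}v _ [-> uv]|{}u v' {}v _ [-> uv'] _ [<- v'v]].
- have others_in w : word_in (others i) w -> word_in (gtn m) w by apply: sub_all => x /andP[].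
  have word_in_insert p w s : word_in (others i) w ->
      word_in (gtn m) (p ++ w ++ s) = word_in (gtn m) (p ++ s).
    by move=> /others_in w_m; rewrite !word_in_cat w_m.
  case=> [p s [j e] jD|p s j jD|p s j g jD gD].
  + have [jm _] := andP jD; rewrite word_in_insert /= ?jD //.
    by split=> // ps_m; apply/words_equiv_sym/word_equiv_cancel.
  + have [jm _] := andP jD; rewrite word_in_insert /word_in ?all_nseq ?jD ?orbT //.
    by split=> // ps_m; apply/words_equiv_sym/word_equiv_power.
  + have [jm ji] := andP jD; have j_i e : word_in (others i) [:: (j, e)] by rewrite /word_in /= jD.
    rewrite !word_in_insert ?word_in_conjw -?cats1 ?word_in_cat ?j_i ?gD // cats1.
    split=> // ps_m; apply: word_equiv_commute => //.
    * by rewrite eq_sym.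
    * by rewrite word_in_cat.
    * exact: others_in.
- by split=> // u_m; apply/words_equiv_refl/word_family_set.
- by split=> // v_m; apply/words_equiv_sym/uv; rewrite ?uv.
- by split=> // v'_m; apply: words_equiv_trans (uv' v'_m) (v'v v'_m).
Qed.

Lemma word_equiv_erase ws i p u : word_family ws -> i < m -> word_in (gtn m) (p ++ u) ->
  word_equiv ws i (p ++ u) (p ++ [seq x <- u | x.1 != i]).
Proof.
move=> ws_m im; elim: u p => [|[j e] u IH] p pu_m /=.
  exact/words_equiv_refl/word_family_set.
have [->|ji] := eqVneq j i; last by rewrite -!cat_rcons; apply: IH; rewrite cat_rcons.
have pu'_m : word_in (gtn m) (p ++ u).
  by move: pu_m; rewrite -cat1s !word_in_cat => /and3P[-> _ ->].
by apply: words_equiv_trans (IH p pu'_m); apply/words_equiv_sym/word_equiv_self.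
Qed.

Lemma word_equiv_rcoef ws i u v : word_family ws -> i < m ->
  word_in (gtn m) u -> word_in (gtn m) v ->
  (forall M : seq nat, uniq M -> all (others i) M -> (rcoef u M = rcoef v M %[mod n])%Z) ->
  word_equiv ws i u v.
Proof.
move=> ws_m im u_m v_m uv; pose erase w := [seq x <- w : aword | x.1 != i].
have erase_in w : word_in (gtn m) w -> word_in (others i) (erase w).
  by rewrite /word_in all_filter; apply: sub_all => x /= xm; rewrite /others /= xm implybb.
apply: words_equiv_trans (word_equiv_erase (p := [::]) ws_m im u_m) _.
apply: words_equiv_trans (words_equiv_sym (word_equiv_erase (p := [::]) ws_m im v_m)).
apply: word_equiv_reduced => //.
  by rewrite /word_in all_filter; apply: sub_all u_m => x /= xm; rewrite xm implybT.
apply: reduced_congr_of_rcoef; rewrite ?erase_in // => M uM M_i.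
have iM : i \notin M by apply/negP => /(allP M_i); rewrite /others /= eqxx andbF.
by rewrite !rcoef_erase ?uv.
Qed.

Theorem ascending_complete d d' : ascending m d -> ascending m d' ->
  (forall i M, i < m -> uniq M -> all (others i) M ->
     (rcoef (head_word d i) M = rcoef (head_word d' i) M %[mod n])%Z) ->
  d <~> d'.
Proof.
move=> asc_d asc_d' coef; pose mix r k := if k < r then head_word d' k else head_word d k.
have d_m := ascending_word_family asc_d; have d'_m := ascending_word_family asc_d'.
have mix_m r : word_family (mix r) by move=> k km; rewrite /mix; case: ifP => _; auto.
have mix_step r : r < m -> words_equiv (mix r) (mix r.+1).
  move=> rm; have := word_equiv_rcoef (mix_m r) rm (d_m r rm) (d'_m r rm) (fun M => coef r M rm).
  apply: words_equiv_eq => k; rewrite /set_word /mix /=;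
    have [->|kr] := eqVneq k r; rewrite ?ltnn ?leqnn //.
  by rewrite [k < r.+1]ltnS [k <= r]leq_eqVlt (negPf kr).
have mix_r r : r <= m -> words_equiv (mix 0) (mix r).
  elim: r => [_|r IH rm]; first exact: words_equiv_refl.
  exact: words_equiv_trans (IH (ltnW rm)) (mix_step r rm).
apply: (words_equivP (mix_r m (leqnn m))); split=> // k km.
by rewrite /mix km.
Qed.

End WordFamilies.

Lemma mu_w_ascending m (n : nat) d (I : seq 'I_m) : ascending m d -> I != [::] -> uniq I ->
  (mu_w d I = rcoef (head_word d (mu_index I)) (mu_seq I) %[mod n])%Z.
Proof.
move=> asc_d I0 uI; have [wf_d _] := asc_d; apply: mu_w_reading => //.
by apply: coloring_sub (ascending_coloring asc_d) => u v ->.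
Qed.

Theorem theorem1p4 (m n : nat) (sigma sigma' : gdiag) :
  0 < n -> wf m sigma -> wf m sigma' ->
  (Vn_sv_equiv m n sigma sigma' <->
   (forall I : seq 'I_m, I != [::] -> uniq I ->
      (mu_w sigma I == mu_w sigma' I %[mod (Posz n)])%Z)).
Proof.
move=> _ wf_s wf_s'; split=> [equiv I I0 uI|same_mu].
  by apply/eqP; exact: mu_w_invariant.
have [d s_d asc_d] := ascending_exists n wf_s.
have [d' s'_d' asc_d'] := ascending_exists n wf_s'.
rewrite s_d s'_d'; apply: ascending_complete => // i M im uM M_others.
have iM : i \notin M by apply/negP => /(allP M_others); rewrite /others /= eqxx andbF.
have [||I [I0 uI <- <-]] := mu_seq_exists (M := M) im.
- by rewrite rcons_uniq iM.
- by apply: sub_all M_others => k /andP[].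
rewrite -!mu_w_ascending // -(mu_w_invariant wf_s s_d I0 uI).
by rewrite -(mu_w_invariant wf_s' s'_d' I0 uI); apply/eqP/same_mu.
Qed.
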